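(* (Log-binomial scenario.) Let $N\ge1$ be an integer and $0<p<1$, and let $X$ be the stationary birth–death process on $\{0,1,\dots,N\}$ with rates $\lambda_n=(N-n)p$, $\mu_n=n(1-p)$, whose marginal law is binomial $\mathrm{Bin}(N,p)$. Let $c_X=N\log(p(e-1)+1)$ and mother process $\Lambda(t)=\exp\{X(t)-c_X\}$; let $A_n,A,T$ be as in the context. Then for any $$b>\frac{(p(e^2-1)+1)^N}{(p(e-1)+1)^{2N}},$$ $A_n(t)$ converges in $L_2$ to a process $A(t)$, $t\in[0,1]$, such that, if $A(1)\in L_q$ for $q\in(0,\infty)$, $$\mathbb{E}A^q(t)\sim t^{K(q)},\qquad K(q)=q\Big(1+\frac{c_X}{\log b}\Big)-\frac{N}{\log b}\log\big(p(e^q-1)+1\big),$$ and the Rényi function is $T(q)=K(q)-1$.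
   Context: Given a stationary process $X$, a constant $c_X$ and a scaling parameter $b>1$, let $X^{(j)}$, $j\ge0$, be independent copies of $X$, $\Lambda^{(j)}(t)=\exp\{X^{(j)}(t)-c_X\}$, and $A_n(t)=\int_0^t\prod_{j=0}^n\Lambda^{(j)}(sb^j)\,ds$, $t\in[0,1]$. Let $\mu_n(B)=\int_B\prod_{j=0}^n\Lambda^{(j)}(sb^j)ds$ and $\mu$ its almost-sure weak limit. The Rényi function is $T(q)=\liminf_{n\to\infty}(-\tfrac1n)\log_2\mathbb{E}\sum_{k=0}^{2^n-1}\mu^q([k2^{-n},(k+1)2^{-n}])$. $\mathbb{E}A^q(t)\sim t^{K(q)}$ means there are constants $0<\underline C\le\overline C<\infty$ with $\underline C t^{K(q)}\le\mathbb{E}A^q(t)\le\overline C t^{K(q)}$ for all $t\in[0,1]$. *)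

(* Defs.v *)
From HB Require Import structures.
From mathcomp Require Import all_boot all_order all_algebra.
From mathcomp Require Import all_classical all_reals all_analysis.
From mathcomp Require Import measurable_realfun.
Set Implicit Arguments. Unset Strict Implicit. Unset Printing Implicit Defensive.
Import Order.TTheory GRing.Theory Num.Theory.
Import numFieldNormedType.Exports.
Local Open Scope classical_set_scope.
Local Open Scope ring_scope.

Section BirthDeath.
Variable R : realType.
Variables (N : nat) (p : R).

Definition bd_gen : 'M[R]_(N.+1) :=
  \matrix_(i < N.+1, j < N.+1)
    if (j == i.+1 :> nat) then (N - i)%:R * p
    else if (j.+1 == i :> nat) then i%:R * (1 - p)
    else if (j == i) then - ((N - i)%:R * p + i%:R * (1 - p))
    else 0.

Definition bd_trans (t : R) (i j : 'I_N.+1) : R :=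
  limn (fun m : nat => (\sum_(k < m) ((t ^+ k) / (k`!)%:R) *: (bd_gen ^+ k)) i j).

Definition binom_pmf (i : 'I_N.+1) : R :=
  ('C(N, i))%:R * p ^+ i * (1 - p) ^+ (N - i).

Fixpoint chain_prob (t0 : R) (i0 : 'I_N.+1) (ts : seq (R * 'I_N.+1)) : R :=
  match ts with
  | [::] => 1
  | (t, i) :: r => bd_trans (t - t0) i0 i * chain_prob t i r
  end.
End BirthDeath.

Section Process.
Context {R : realType} {d : measure_display} {T : measurableType d}.

Definition cyl_event (X : R -> T -> R) (ts : seq (R * set R)) : set T :=
  foldr (fun (tB : R * set R) A => [set w | X tB.1 w \in tB.2] `&` A) setT ts.

Definition state_event (N : nat) (X : R -> T -> R) (t0 : R) (i0 : 'I_N.+1)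
    (ts : seq (R * 'I_N.+1)) : set T :=
  [set w | X t0 w = (i0 : nat)%:R] `&`
  foldr (fun (ti : R * 'I_N.+1) A => [set w | X ti.1 w = (nat_of_ord ti.2)%:R] `&` A) setT ts.
End Process.

Definition stationary_birth_death {R : realType} {d : measure_display}
    {T : measurableType d} (P : probability T R) (N : nat) (p : R)
    (X : R -> T -> R) : Prop :=
  [/\ (forall t w, exists i : 'I_N.+1, X t w = (i : nat)%:R),
      measurable_fun [set: (R * T)%type] (fun z : R * T => X z.1 z.2) &
      (forall (t0 : R) (i0 : 'I_N.+1) (ts : seq (R * 'I_N.+1)),
         0 <= t0 -> sorted <=%R (t0 :: map fst ts) ->
         P (state_event X t0 i0 ts)
           = (@binom_pmf R N p i0 * @chain_prob R N p t0 i0 ts)%:E)].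

Definition independent_processes {R : realType} {d : measure_display}
    {T : measurableType d} (P : probability T R) (X : nat -> R -> T -> R) : Prop :=
  forall (J : seq nat) (C : nat -> seq (R * set R)),
    uniq J -> (forall j tB, tB \in C j -> measurable tB.2) ->
    P (\bigcap_(j in [set j | j \in J]) cyl_event (X j) (C j))
      = (\prod_(j <- J) P (cyl_event (X j) (C j)))%E.

Section Cascade.
Context {R : realType} {d : measure_display} {T : measurableType d}.
Local Open Scope ereal_scope.

Definition cascade_density (X : nat -> R -> T -> R) (c b : R) (n : nat)
    (s : R) (w : T) : R :=
  (\prod_(j < n.+1) expR (X j (s * b ^+ j) w - c))%R.

Definition cascade_A (X : nat -> R -> T -> R) (c b : R) (n : nat)
    (t : R) (w : T) : R :=
  Rintegral (@lebesgue_measure R) `[0%R, t]%classic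
    (fun s => cascade_density X c b n s w).

Definition dyadic (n k : nat) : set R :=
  `[(k%:R / 2 ^+ n)%R, (k.+1%:R / 2 ^+ n)%R]%classic.

Definition renyi_term (P : probability T R) (mu : T -> {measure set R -> \bar R})
    (q : R) (n : nat) : \bar R :=
  let M := \int[P]_w (\sum_(k < 2 ^ n) (powR (fine (mu w (dyadic n k))) q))%:E in
  match M with
  | EFin r => if (0 < r)%R then (- (ln r / (n%:R * ln 2)))%:E else +oo
  | +oo => -oo
  | -oo => +oo
  end.

Definition renyi_function (P : probability T R) (mu : T -> {measure set R -> \bar R})
    (q : R) : \bar R :=
  limn_einf (renyi_term P mu q).

Definition as_weak_limit (P : probability T R) (X : nat -> R -> T -> R) (c b : R)
    (mu : T -> {measure set R -> \bar R}) : Prop :=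
  [/\ (forall B, measurable B -> measurable_fun [set: T] (fun w => mu w B)),
      (forall w, mu w (~` `[0%R, 1%R]%classic) = 0) &
      {ae P, forall w,
        mu w `[0%R, 1%R]%classic < +oo /\
        forall f : R -> R, {within `[0%R, 1%R]%classic, continuous f} ->
          (fun n => \int[@lebesgue_measure R]_(s in `[0%R, 1%R]%classic)
                     (f s * cascade_density X c b n s w)%:E)
            @ \oo --> \int[mu w]_(s in `[0%R, 1%R]%classic) (f s)%:E}].
End Cascade.

Definition cX {R : realType} (N : nat) (p : R) : R :=
  N%:R * ln (p * (expR 1 - 1) + 1).

Definition K_logbin {R : realType} (N : nat) (p b q : R) : R :=
  q * (1 + cX N p / ln b) - N%:R / ln b * ln (p * (expR q - 1) + 1).

(* Main.v *)
(* For [t > 0], the first level of the cascade on [[a, a + t]] is independent of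
   the others, which after the change of variable [s -> b s] form a stationary
   copy of the cascade on an interval of length [b t].  On the window the first
   factor is constant up to an event of probability [O(t)], whence
     [E A(t)^q = b^(-q) E Lambda^q (1 + O(t)) E A(b t)^q],
   and [b^(-q) E Lambda^q = b^(- K q)].  Iterating until [b^k t] is of order 1
   multiplies errors [1 + O(b^j t)] whose product is bounded above and below.
   Convergence in [L_2] comes from the correlation of the chain,
     [E Lambda(0) Lambda(t) = (1 + c exp(- t))^N],
   computed with the Krawtchouk eigenvectors of the generator: the n-th increment
   has second moment [O((rho / b)^n)] with [rho = E Lambda^2 < b].
   Since paths have no assumed regularity, every identity is proved for Riemann
   sums, where it reduces to finite sums over configurations, and then passed to
   the limit; powers are truncated so that only bounded functions occur. *)

Require Import Defs.
From HB Require Import structures.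
From mathcomp Require Import all_boot all_order all_algebra.
From mathcomp Require Import all_classical all_reals all_analysis.
From mathcomp Require Import measurable_realfun.
From mathcomp Require Import ring lra zify.
Set Implicit Arguments. Unset Strict Implicit. Unset Printing Implicit Defensive.
Import Order.TTheory GRing.Theory Num.Theory.
Import numFieldNormedType.Exports.
Local Open Scope classical_set_scope.
Local Open Scope ring_scope.

(** * Matrix exponentials and the birth-death semigroup *)

(** The relation between [A(t)] and [A(b t)] is obtained as a pair of inequalities, the first level
    being replaced by bounds valid on the whole window. The upper factor [1 + O(t)] is harmless, but
    the lower factor [1 - O(t)] is negative for long windows; its maximum with a positive constant
    still dominates some [exp(- C t)], and the exponents add up along a geometric sequence of
    windows. The inequalities hold in the extended reals; finiteness of the moment at [t = 1]
    reaches [t = b] through the lower one.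

    The estimates are uniform in the left endpoint, because the Rényi function sums over all dyadic
    intervals. Weak convergence alone does not give the mass of a closed interval, since the limit
    might charge its endpoints. Testing against continuous majorants gives [A <= mu] almost surely,
    Fatou bounds the mean of [mu] by the length, which is the mean of [A], and equality follows.

    At [t = 0] the power law needs [K q] to be nonzero, since [powR 0 0 = 1]. Positivity is not
    visible in the formula for [K]; it is derived from the power law on []0, 1]]. *)

Section MatrixExponential.
Variables (R : realType) (n : nat).
Implicit Types (G : 'M[R]_n.+1) (v : 'I_n.+1 -> R).

Definition entry_sum G := \sum_i \sum_j `|G i j|.

Lemma entry_sum_ge0 G : 0 <= entry_sum G.
Proof. by apply: sumr_ge0 => i _; apply: sumr_ge0. Qed.

(** The maximal absolute row sum is a submultiplicative norm, and [entry_sum] bounds it. *)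
Lemma row_sum_expr G k i : \sum_j `|(G ^+ k) i j| <= entry_sum G ^+ k.
Proof.
elim: k i => [|k IH] i.
  rewrite !expr0 (bigD1 i) //= big1 => [|j ij].
    by rewrite !mxE eqxx normr1 addr0.
  by rewrite !mxE eq_sym (negbTE ij) normr0.
have le_row : \sum_j `|(G ^+ k.+1) i j|
    <= \sum_j \sum_l `|G i l| * `|(G ^+ k) l j|.
  apply: ler_sum => j _; rewrite exprS mxE.
  by apply: (le_trans (ler_norm_sum _ _ _)); apply: ler_sum => l _; rewrite normrM.
apply: (le_trans le_row); rewrite exchange_big /=.
have le_ent : \sum_l `|G i l| <= entry_sum G.
  rewrite /entry_sum [leRHS](bigD1 i) //= lerDl.
  by apply: sumr_ge0 => ? _; apply: sumr_ge0.
apply: (@le_trans _ _ (\sum_l `|G i l| * entry_sum G ^+ k)).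
  by apply: ler_sum => l _; rewrite -mulr_sumr ler_wpM2l.
by rewrite -mulr_suml exprS ler_wpM2r// exprn_ge0// entry_sum_ge0.
Qed.

Lemma entry_expr G k i j : `|(G ^+ k) i j| <= entry_sum G ^+ k.
Proof.
apply: le_trans (row_sum_expr G k i).
by rewrite (bigD1 j) //= lerDl sumr_ge0.
Qed.

Definition mxexp_partial G (t : R) i j (m : nat) :=
  (\sum_(k < m) ((t ^+ k) / (k`!)%:R) *: (G ^+ k)) i j.

Lemma mxexp_partialE G t i j :
  mxexp_partial G t i j = series (fun k => t ^+ k / (k`!)%:R * (G ^+ k) i j).
Proof.
apply/funext => m; rewrite /mxexp_partial /series /= summxE big_mkord.
by apply: eq_bigr => k _; rewrite !mxE.
Qed.

Lemma cvg_mxexp_partial G t i j : cvgn (mxexp_partial G t i j).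
Proof.
rewrite mxexp_partialE; apply: normed_cvg.
apply: (@series_le_cvg _ _ (exp_coeff (`|t| * entry_sum G))) => //=.
- by move=> k; rewrite exp_coeff_ge0// mulr_ge0// entry_sum_ge0.
- move=> k; rewrite /exp_coeff /= !normrM normfV normrX exprMn.
  rewrite [`|_%:R|]ger0_norm// mulrAC.
  by rewrite ler_wpM2r ?invr_ge0// ler_wpM2l ?exprn_ge0// entry_expr.
- exact: is_cvg_series_exp_coeff.
Qed.

Lemma cvgn_sum (I : Type) (r : seq I) (f : I -> nat -> R) (l : I -> R) :
  (forall i, f i @ \oo --> l i) ->
  (fun m => \sum_(i <- r) f i m) @ \oo --> \sum_(i <- r) l i.
Proof.
move=> fl; elim: r => [|i r IH].
  by rewrite big_nil; under eq_fun do rewrite big_nil; exact: cvg_cst.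
by rewrite big_cons; under eq_fun do rewrite big_cons; exact: cvgD.
Qed.

(** The relation holds term by term, since [G ^+ k] multiplies [v] by [mu ^+ k]; both sides are then
    limits of one sequence. *)
Lemma mxexp_eigen G t v mu : (forall i, \sum_j G i j * v j = mu * v i) ->
  forall i, \sum_j limn (mxexp_partial G t i j) * v j = expR (mu * t) * v i.
Proof.
move=> Gv i.
have Gkv k i' : \sum_j (G ^+ k) i' j * v j = mu ^+ k * v i'.
  elim: k i' => [|k IH] i'.
    rewrite !expr0 mul1r (bigD1 i') //= big1 => [|j ij].
      by rewrite !mxE eqxx mul1r addr0.
    by rewrite !mxE eq_sym (negbTE ij) mul0r.
  under eq_bigr do rewrite exprS mxE mulr_suml.
  rewrite exchange_big /=.
  under eq_bigr => l _.
    under eq_bigr do rewrite -mulrA.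
    rewrite -mulr_sumr IH mulrCA; over.
  by rewrite -mulr_sumr Gv exprSr mulrA.
have H1 : (fun m => \sum_j mxexp_partial G t i j m * v j) @ \oo -->
    \sum_j limn (mxexp_partial G t i j) * v j.
  apply: cvgn_sum => j; apply: cvgMl; exact: cvg_mxexp_partial.
have H2 : (fun m => \sum_j mxexp_partial G t i j m * v j) @ \oo -->
    expR (mu * t) * v i.
  rewrite (_ : (fun m => _) = (fun m => series (exp_coeff (mu * t)) m * v i)).
    by apply: cvgMl; exact: is_cvg_series_exp_coeff.
  apply/funext => m; under eq_bigr do rewrite mxexp_partialE /series /= mulr_suml.
  rewrite exchange_big /= /series /= mulr_suml; apply: eq_bigr => k _.
  under eq_bigr do rewrite -mulrA.
  by rewrite -mulr_sumr Gkv /exp_coeff /= exprMn; ring.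
exact: (cvg_unique _ H1 H2).
Qed.

Lemma mxexp_diag G t i : 0 <= t <= 1 ->
  `|limn (mxexp_partial G t i i) - 1| <= expR (entry_sum G) * t.
Proof.
move=> /andP[t0 t1].
have H : (fun m => `|mxexp_partial G t i i m.+1 - 1|) @ \oo -->
   `|limn (mxexp_partial G t i i) - 1|.
  apply: cvg_norm; apply: cvgB; last exact: cvg_cst.
  by rewrite (cvg_shiftS (mxexp_partial G t i i)); exact: cvg_mxexp_partial.
have lim_H := cvg_lim (@Rhausdorff R) H.
rewrite -lim_H; apply: limr_le; first by apply/cvg_ex; eexists; exact: H.
apply: nearW => m; rewrite mxexp_partialE /series /= big_nat_recl//=.
rewrite expr0 expr0 fact0 divr1 mul1r !mxE eqxx addrC addKr.
apply: (le_trans (ler_norm_sum _ _ _)).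
(* The term of degree 0 has been cancelled, and [t ^+ k.+1 <= t] on the unit interval extracts a
   factor [t]. *)
apply: (@le_trans _ _ (t * \sum_(0 <= k < m.+1) exp_coeff (entry_sum G) k)).
  rewrite big_nat_recl//= mulrDr mulr_sumr; apply: ler_wpDl.
    by rewrite mulr_ge0// exp_coeff_ge0// entry_sum_ge0.
  apply: ler_sum => k _; rewrite !normrM normfV normrX /exp_coeff /=.
  rewrite [`|_%:R|]ger0_norm// ger0_norm// mulrAC mulrA.
  rewrite ler_wpM2r ?invr_ge0//; apply: ler_pM => //; [exact: exprn_ge0| |exact: entry_expr].
  by rewrite exprS ler_piMr// exprn_ile1.
rewrite mulrC ler_wpM2r//.
have := nondecreasing_cvgn_le _ (@is_cvg_series_exp_coeff R (entry_sum G)) m.+1.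
apply; apply: nondecreasing_series => k _ _; exact: exp_coeff_ge0 (entry_sum_ge0 _).
Qed.

End MatrixExponential.

(** * Krawtchouk eigenvectors, moments and correlation of the mother process *)

Section BirthDeathSemigroup.
Variables (R : realType) (N : nat) (p : R).
Hypothesis p01 : 0 < p < 1.
Local Notation q := (1 - p).

Lemma bd_transE t i j : bd_trans p t i j = limn (mxexp_partial (bd_gen N p) t i j).
Proof. by []. Qed.

(** The summand 1 makes the constant visibly at least 1, so that the jump bound is trivial for steps
    longer than 1. *)
Definition sojourn_const := 1 + expR (entry_sum (bd_gen N p)).

Lemma bd_trans_diag t (i : 'I_N.+1) : 0 <= t <= 1 ->
  1 - sojourn_const * t <= bd_trans p t i i.
Proof.
move=> t01; have := mxexp_diag (bd_gen N p) i t01; rewrite -bd_transE.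
rewrite ler_norml => /andP[+ _]; rewrite /sojourn_const; move: t01 => /andP[t0 t1].
move: (bd_trans _ _ _ _) (expR _) => x y; lra.
Qed.

(** At both ends of the state space the missing neighbour comes with a zero rate, so [v] may be any
    function on [nat]. *)
Lemma bd_gen_apply (v : nat -> R) (i : 'I_N.+1) :
  \sum_j bd_gen N p i j * v j =
  (N - i)%:R * p * (v i.+1 - v i) + i%:R * q * (v i.-1 - v i).
Proof.
have Hup : \sum_(j < N.+1) (if (j == i.+1 :> nat) then (N - i)%:R * p * v j else 0)
   = (N - i)%:R * p * v i.+1.
  rewrite -big_mkcond /=; have [iN|iN] := ltnP i N.
    have -> : v i.+1 = v (Ordinal (iN : i.+1 < N.+1)%N) by [].
    by rewrite (big_pred1 (Ordinal (iN : i.+1 < N.+1)%N)).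
  rewrite (eqP (iN : (N - i)%N == 0%N)) !mul0r big1// => j _; by rewrite !mul0r.
have Hdn : \sum_(j < N.+1) (if (j.+1 == i :> nat) then i%:R * q * v j else 0)
   = i%:R * q * v i.-1.
  rewrite -big_mkcond /=; case: i {Hup} => [[|i] Hi] /=.
    by rewrite !mul0r big1// => j; rewrite /= .
  have Hi' : (i < N.+1)%N by exact: ltnW.
  by rewrite (big_pred1 (Ordinal Hi')).
have Hdg : \sum_(j < N.+1) (if j == i then - ((N - i)%:R * p + i%:R * q) * v j else 0)
   = - ((N - i)%:R * p + i%:R * q) * v i.
  by rewrite -big_mkcond /= (big_pred1 i).
transitivity ((N - i)%:R * p * v i.+1 + i%:R * q * v i.-1 - ((N - i)%:R * p + i%:R * q) * v i).
  rewrite -Hup -Hdn -mulNr -Hdg -!big_split /=; apply: eq_bigr => j _.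
  rewrite !mxE; case: eqP => [ji|ji].
    have -> : (j.+1 == i :> nat) = false by apply/eqP; lia.
    have -> : (j == i) = false by apply/eqP => /(congr1 val) /=; lia.
    by rewrite !addr0.
  case: eqP => [ji'|ji'].
    have -> : (j == i) = false by apply/eqP => /(congr1 val) /=; lia.
    by rewrite add0r addr0.
  by rewrite !add0r; case: ifP => // _; rewrite mul0r.
ring.
Qed.

(* The Krawtchouk generating function: [bd_gen] acts on it as [- 'X * d/dX],
   so its coefficient of degree [k] is an eigenvector of eigenvalue [- k]. *)
Definition krawtchouk (i : nat) : {poly R} :=
  (1 - p *: 'X) ^+ (N - i) * (1 + q *: 'X) ^+ i.

(** The two factors differ by ['X], so a difference of neighbours is ['X] times a product of their
    powers. The birth and death terms are the two halves of the product rule. *)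
Lemma krawtchouk_deriv (i : nat) : (i <= N)%N ->
  ((N - i)%:R * p) *: (krawtchouk i.+1 - krawtchouk i)
  + (i%:R * q) *: (krawtchouk i.-1 - krawtchouk i) = - ('X * (krawtchouk i)^`()).
Proof.
move=> iN; rewrite /krawtchouk.
set A := 1 - p *: 'X; set B := 1 + q *: 'X.
have BA : B - A = 'X by rewrite /A /B scalerBl scale1r; ring.
have dA : A^`() = (- p)%:P.
  by rewrite /A derivB derivZ derivX -(polyC1 R) derivC sub0r alg_polyC polyCN.
have dB : B^`() = q%:P.
  by rewrite /B derivD derivZ derivX -(polyC1 R) derivC add0r alg_polyC.
clearbody A B.
have up : A ^+ (N - i.+1) * B ^+ i.+1 *+ (N - i) - A ^+ (N - i) * B ^+ i *+ (N - i)
  = 'X * A ^+ (N - i).-1 * B ^+ i *+ (N - i).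
  case E : (N - i)%N => [|m]; first by rewrite !mulr0n subr0.
  rewrite -mulrnBl subnS E /= -BA exprS [A ^+ m.+1]exprS; congr (_ *+ _).
  by move: (A ^+ m) (B ^+ i) => x y; ring.
have dn : A ^+ (N - i.-1) * B ^+ i.-1 *+ i - A ^+ (N - i) * B ^+ i *+ i
  = - ('X * A ^+ (N - i) * B ^+ i.-1 *+ i).
  case: i iN {up} => [|i] iN; first by rewrite !mulr0n subr0 oppr0.
  rewrite -mulrnBl -mulNrn /= -BA -(subnSK iN) [A ^+ _.+1]exprS exprS; congr (_ *+ _).
  by move: (A ^+ _) (B ^+ i) => x y; ring.
rewrite derivM !deriv_exp dA dB.
rewrite ![_%:R * _]mulrC -!scalerA !scaler_nat !mulrnBl up dn -!mul_polyC polyCN.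
by ring.
Qed.

Lemma bd_trans_krawtchouk t (i : 'I_N.+1) k :
  \sum_j bd_trans p t i j * (krawtchouk j)`_k = expR (- k%:R * t) * (krawtchouk i)`_k.
Proof.
apply: (@mxexp_eigen R N (bd_gen N p) t (fun i => (krawtchouk i)`_k)) => {}i.
rewrite (bd_gen_apply (fun i => (krawtchouk i)`_k)).
have := congr1 (fun f : {poly R} => f`_k) (krawtchouk_deriv (ltnSE (ltn_ord i))).
rewrite coefD !coefZ !coefB => ->; rewrite coefN coefXM.
case: k => [|k]; first by rewrite /= !oppr0 mul0r.
by rewrite /= coef_deriv mulNr mulr_natl.
Qed.

(** The eigenvalues [exp(- k t)], collected over the degrees [k], amount to rescaling the
    variable. *)
Lemma bd_trans_krawtchouk_gen t (i : 'I_N.+1) x :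
  \sum_j bd_trans p t i j * (krawtchouk j).[x] = (krawtchouk i).[x * expR (- t)].
Proof.
pose M := (\max_(j < N.+1) size (krawtchouk j))%N.
have sz (j : 'I_N.+1) : (size (krawtchouk j) <= M)%N.
  exact: (@leq_bigmax _ (fun j : 'I_N.+1 => size (krawtchouk j))).
under eq_bigr do rewrite (horner_coef_wide _ (sz _)) mulr_sumr.
rewrite exchange_big /= (horner_coef_wide _ (sz i)); apply: eq_bigr => k _.
under eq_bigr do rewrite mulrA.
rewrite -mulr_suml bd_trans_krawtchouk exprMn -expRM_natl mulNr -mulrN; ring.
Qed.

Lemma binom_pgf (x y : R) :
  \sum_(i < N.+1) binom_pmf p i * (x ^+ i * y ^+ (N - i)) = (p * x + q * y) ^+ N.
Proof.
rewrite addrC exprDn; apply: eq_bigr => i _.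
by rewrite /binom_pmf -mulr_natl !exprMn; ring.
Qed.

Local Notation w := (expR 1 - 1).
Local Notation c := (cX N p).

Lemma expR1_sub1_gt0 : 0 < w :> R.
Proof. by rewrite subr_gt0 -expR0 ltr_expR. Qed.

Let D := p * w + 1.

Let p0 : 0 < p. Proof. by case/andP: p01. Qed.
Let q0 : 0 < q. Proof. by case/andP: p01; rewrite subr_gt0. Qed.

Let D_gt1 : 1 < D.
Proof. by rewrite ltrDr mulr_gt0// expR1_sub1_gt0. Qed.

Let D_gt0 : 0 < D. Proof. exact: lt_trans D_gt1. Qed.

Lemma expR_cX : expR c = D ^+ N.
Proof. by rewrite /cX expRM_natl lnK. Qed.

Definition lam (i : nat) : R := expR (i%:R - c).

Lemma lam_gt0 i : 0 < lam i. Proof. exact: expR_gt0. Qed.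

Lemma lamE i : lam i = expR 1 ^+ i / D ^+ N.
Proof. by rewrite /lam expRD expRN expR_cX -expRM_natl mulr1. Qed.

Lemma lam_mean : \sum_(i < N.+1) binom_pmf p i * lam i = 1.
Proof.
have := binom_pgf (expR 1) 1.
under eq_bigr do rewrite expr1n mulr1.
under [X in _ -> X = _]eq_bigr do rewrite lamE mulrA.
rewrite -mulr_suml => ->; rewrite (_ : p * _ + _ = D); last by rewrite /D; ring.
by rewrite divff// expf_neq0// gt_eqF.
Qed.

Definition lam_moment (s : R) := \sum_(i < N.+1) binom_pmf p i * lam i `^ s.

Lemma lam_momentE s : lam_moment s = (p * (expR s - 1) + 1) ^+ N * expR (- (s * c)).
Proof.
have := binom_pgf (expR s) 1.
under eq_bigr do rewrite expr1n mulr1.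
rewrite (_ : p * _ + _ = p * (expR s - 1) + 1); last by ring.
move=> <-; rewrite mulr_suml; apply: eq_bigr => i _.
rewrite -mulrA /lam -expRM mulrBl expRD; congr (_ * (_ * _)).
  by rewrite -expRM_natl.
by rewrite mulrC.
Qed.

(** The point where the Krawtchouk generating function equals the mother process:
    [1 - p theta = 1 / D] and [1 + q theta = e / D], so its value for state [j] is [lam j]. *)
Definition theta := w / D.

Definition lam_corr (t : R) :=
  \sum_(i < N.+1) \sum_(j < N.+1) binom_pmf p i * bd_trans p t i j * (lam i * lam j).

Lemma bd_trans_lam t (i : 'I_N.+1) :
  \sum_j bd_trans p t i j * lam j = (krawtchouk i).[theta * expR (- t)].
Proof.
rewrite -bd_trans_krawtchouk_gen; apply: eq_bigr => j _; congr (_ * _).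
rewrite lamE /krawtchouk !(hornerM, horner_exp, hornerD, hornerN, hornerZ, hornerX, hornerC).
have DN : D != 0 by rewrite gt_eqF.
have -> : 1 - p * theta = D^-1 by rewrite /theta; apply: (mulIf DN); rewrite mulVf// mulrBl mul1r -mulrA -mulrA mulVf// mulr1 /D; ring.
have -> : 1 + q * theta = expR 1 / D.
  by rewrite /theta; apply: (mulIf DN); rewrite mulrDl mul1r -!mulrA mulVf// !mulr1 /D; ring.
rewrite exprMn mulrCA -exprVn -exprD; congr (_ * _ ^+ _).
by rewrite subnK// -ltnS.
Qed.

(** Conditioning on the first state leaves the generating function at [theta exp(- t)]. Averaging it
    over the binomial law is the binomial theorem again, hence an [N]-th power. *)
Lemma lam_corrE t : lam_corr t = (1 + p * q * theta ^+ 2 * expR (- t)) ^+ N.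
Proof.
set y := theta * expR (- t).
have -> : lam_corr t = \sum_(i < N.+1) binom_pmf p i *
    ((expR 1 * (1 + q * y)) ^+ i * (1 - p * y) ^+ (N - i)) / D ^+ N.
  apply: eq_bigr => i _.
  transitivity (binom_pmf p i * lam i * (krawtchouk i).[y]).
    by rewrite -bd_trans_lam mulr_sumr; apply: eq_bigr => j _; ring.
  rewrite lamE /krawtchouk !(hornerM, horner_exp, hornerD, hornerN, hornerZ, hornerX, hornerC).
  by rewrite exprMn; ring.
rewrite -mulr_suml binom_pgf -expr_div_n; congr (_ ^+ N).
have DN : D != 0 by rewrite gt_eqF.
apply: (mulIf DN); rewrite divfK// /y expr2 /theta.
have -> : (1 + p * q * (w / D * (w / D)) * expR (- t)) * D
   = D + p * q * (w / D) * expR (- t) * w * (D / D) by ring.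
rewrite divff// mulr1; set z := w / D; rewrite /D; ring.
Qed.

Definition corr_amp := p * q * theta ^+ 2.

Lemma corr_amp_ge0 : 0 <= corr_amp.
Proof. by rewrite /corr_amp mulr_ge0 ?sqr_ge0// mulr_ge0// ltW. Qed.

(** The second moment of the mother process; [corr0E] identifies it with the threshold for [b]. *)
Definition corr0 := (1 + corr_amp) ^+ N.

Lemma corr0E : corr0 = (p * (expR 2 - 1) + 1) ^+ N / (p * (expR 1 - 1) + 1) ^+ (2 * N).
Proof.
rewrite exprM -expr_div_n; congr (_ ^+ N).
have DN : D ^+ 2 != 0 by rewrite expf_neq0// gt_eqF.
apply: (mulIf DN); rewrite -/D -[RHS]mulrA mulVf// mulr1 /corr_amp /theta expr_div_n.
rewrite mulrDl -!mulrA mulVf// (_ : 2 = 1 + 1 :> R)// expRD /D; ring.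
Qed.

Lemma corr0_ge1 : 1 <= corr0.
Proof. by rewrite /corr0 exprn_ege1// lerDl corr_amp_ge0. Qed.

Lemma lam_corr_ge0 t : 0 <= lam_corr t.
Proof.
by rewrite lam_corrE exprn_ge0// addr_ge0// mulr_ge0 ?corr_amp_ge0// expR_ge0.
Qed.

Lemma lam_corr_le t : 0 <= t -> lam_corr t <= corr0.
Proof.
move=> t0; have le1 : 1 + corr_amp * expR (- t) <= 1 + corr_amp.
  by rewrite lerD2l ler_piMr ?corr_amp_ge0// -expR0 ler_expR oppr_le0.
have a0 := corr_amp_ge0.
have ae0 : 0 <= corr_amp * expR (- t) by rewrite mulr_ge0// expR_ge0.
by rewrite lam_corrE; apply: lerXn2r le1; rewrite nnegrE addr_ge0.
Qed.

Lemma lam_corr_decay t : 0 <= t -> lam_corr t - 1 <= corr0 * expR (- t).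
Proof.
move=> t0; rewrite lam_corrE -/corr_amp /corr0.
have e1 : expR (- t) <= 1 by rewrite -expR0 ler_expR oppr_le0.
move: (expR (- t)) (expR_ge0 (- t)) e1 => y y0 y1.
have a0 := corr_amp_ge0; set a := corr_amp in a0 *.
(* The convex function [(1 + a y)^N] lies below its chord on the unit interval; shown by induction
   on the exponent. *)
suff : (1 + a * y) ^+ N <= 1 - y + (1 + a) ^+ N * y by lra.
elim: N => [|m IH]; first by rewrite !expr0; lra.
rewrite !exprS; set u := (1 + a * y) ^+ m in IH *; set v := (1 + a) ^+ m in IH *.
have v1 : 1 <= v by rewrite exprn_ege1// lerDl.
apply: (@le_trans _ _ ((1 + a * y) * (1 - y + v * y))).
  by rewrite ler_wpM2l// addr_ge0// mulr_ge0.
have : 0 <= a * y * (1 - y) * (v - 1) by apply: mulr_ge0; [apply: mulr_ge0; [exact: mulr_ge0|]|]; rewrite subr_ge0.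
have : 0 <= a * y * (v - 1) by apply: mulr_ge0; [exact: mulr_ge0|rewrite subr_ge0].
nra.
Qed.

Lemma K_logbinE (b s : R) : 1 < b ->
  b `^ (- s) * lam_moment s = b `^ (- K_logbin N p b s).
Proof.
move=> b1; have lb : ln b != 0 by rewrite gt_eqF// ln_gt0.
have b0 : b != 0 by rewrite gt_eqF// (lt_trans _ b1).
have E0 : 0 < p * (expR s - 1) + 1.
  have := expR_gt0 s; move: (expR s) p0 q0 => e pp qq ee.
  by have : 0 < p * e by [exact: mulr_gt0]; lra.
rewrite lam_momentE /powR (negbTE b0) -[X in X ^+ N]lnK// -expRM_natl -!expRD.
rewrite /K_logbin; congr expR.
move: (ln (p * _ + 1)) (cX N p) N%:R => x y z; field.
exact: lb.
Qed.

End BirthDeathSemigroup.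

(** * Geometric convergence *)

Section GeometricConvergence.
Context d (T : measurableType d) (R : realType) (P : probability T R).
Implicit Types (f g : nat -> T -> R).

Lemma geometric_sum_le (z : R) n : 0 <= z < 1 -> \sum_(0 <= i < n) z ^+ i <= (1 - z)^-1.
Proof.
move=> /andP[z0 z1]; have z10 : 0 < 1 - z by rewrite subr_gt0.
suff -> : \sum_(0 <= i < n) z ^+ i = (1 - z ^+ n) / (1 - z).
  rewrite ler_piMl ?invr_ge0; [by []|exact: ltW|by have := exprn_ge0 n z0; lra].
apply: (mulIf (lt0r_neq0 z10)); rewrite divfK ?gt_eqF//.
elim: n => [|n IH]; first by rewrite big_geq// mul0r expr0 subrr.
by rewrite big_nat_recr//= mulrDl IH exprS; ring.
Qed.

(** A quantitative Borel-Cantelli argument: [V] is the sum of the [|g k| / s ^+ k], whose integral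
    is at most a geometric series of ratio [r / s]. *)
Lemma geometric_domination g (C r s : R) : 0 <= C -> 0 <= r -> r < s ->
  (forall k, measurable_fun setT (g k)) ->
  (forall k, (\int[P]_w (`|g k w|)%:E <= (C * r ^+ k)%:E)%E) ->
  exists V : T -> R, [/\ measurable_fun setT V, forall w, 0 <= V w,
    P.-integrable setT (EFin \o V) &
    {ae P, forall w, forall k, `|g k w| <= s ^+ k * V w}].
Proof.
move=> C0 r0 rs mg gle.
have s0 : 0 < s by exact: le_lt_trans rs.
pose h k w := ((s ^+ k)^-1 * `|g k w|)%:E.
have h0 k w : (0 <= h k w)%E.
  by rewrite lee_fin mulr_ge0// invr_ge0 exprn_ge0// ltW.
have mh k : measurable_fun setT (h k).
  apply/measurable_EFinP; apply: measurable_funM => //.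
  by apply: measurableT_comp => //; exact: mg.
pose E w := (\sum_(0 <= k <oo) h k w)%E.
have E0 w : (0 <= E w)%E by apply: nneseries_ge0 => k _ _.
have mE : measurable_fun setT E.
  exact: (ge0_emeasurable_sum (P := xpredT) (fun k w _ _ => h0 k w) (fun k _ => mh k)).
have intE : (\int[P]_w E w < +oo)%E.
  rewrite integral_nneseries//.
  apply: (@le_lt_trans _ _ (C * (1 - r / s)^-1)%:E); last exact: ltry.
  apply: lime_le.
    by apply: is_cvg_nneseries => k _ _; apply: integral_ge0 => w _.
  apply: nearW => n.
  apply: (@le_trans _ _ (\sum_(0 <= k < n) (C * (r / s) ^+ k)%:E)%E).
    apply: lee_sum => k _; rewrite /h.
    under eq_integral do rewrite EFinM.
    have sk0 : 0 <= (s ^+ k)^-1 by rewrite invr_ge0 exprn_ge0// ltW.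
    rewrite ge0_integralZl_EFin//; last first.
      by apply/measurable_EFinP; apply: measurableT_comp => //; exact: mg.
    rewrite expr_div_n mulrA. rewrite [X in (_ <= X)%E]EFinM [X in (_ <= X)%E]muleC.
    by rewrite lee_wpmul2l// lee_fin invr_ge0 exprn_ge0// ltW.
  rewrite sumEFin lee_fin -mulr_sumr ler_wpM2l// geometric_sum_le//.
  by rewrite divr_ge0 ?(ltW s0)//= ltr_pdivrMr// mul1r.
have iE : P.-integrable setT E.
  apply/integrableP; split => //.
  by under eq_integral do rewrite gee0_abs//.
have aeE : {ae P, forall w, (E w) \is a fin_num}.
  by have := integrable_ae measurableT iE; apply: filterS => w; exact.
(* [fine] turns an infinite sum into 0, so the domination holds only where [E] is finite, that is
   almost everywhere. *)
exists (fine \o E); split.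
- by apply: measurableT_comp => //; exact: fine_measurable.
- by move=> w /=; rewrite fine_ge0.
- apply: (le_integrable measurableT _ _ iE).
    by apply/measurable_EFinP; apply: measurableT_comp => //; exact: fine_measurable.
  move=> w _ /=; case: (E w) (E0 w) => [x x0| |]//=; by rewrite normr0 leey.
- apply: filterS aeE => w Efin k /=.
  rewrite -ler_pdivrMl ?exprn_gt0// -lee_fin fineK//.
  apply: le_trans (nneseries_lim_ge k.+1 _) => //.
  by rewrite big_nat_recr//= leeDr// sume_ge0.
Qed.

Lemma ae_cvg0_geometric g (C r : R) : 0 <= C -> 0 <= r < 1 ->
  (forall k, measurable_fun setT (g k)) ->
  (forall k, (\int[P]_w (`|g k w|)%:E <= (C * r ^+ k)%:E)%E) ->
  {ae P, forall w, (fun k => g k w) @ \oo --> (0 : R)}.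
Proof.
move=> C0 /andP[r0 r1] mg gle.
have [s rs s1] : exists2 s : R, r < s & s < 1 by exists ((r + 1) / 2); lra.
have [V [_ V0 _ HV]] := geometric_domination C0 r0 rs mg gle.
apply: filterS HV => w HV.
apply/cvgr0Pnorm_lt => e e0 /=.
have : (fun k => s ^+ k * V w) @ \oo --> (0 : R).
  rewrite -[X in _ --> X](mul0r (V w)); apply: cvgMl; apply: cvg_expr.
  by rewrite ger0_norm// ltW// (le_lt_trans _ rs).
move=> /cvgr0Pnorm_lt/(_ e e0); apply: filterS => k; apply: le_lt_trans.
by apply: (le_trans (HV k)); exact: ler_norm.
Qed.

(** An upper limit is total, and measurable without any convergence hypothesis; [ae_limE] returns
    the limit wherever there is one. *)
Definition ae_lim f (w : T) : R := fine (limn_esup (fun n => (f n w)%:E)).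

Lemma measurable_ae_lim f : (forall n, measurable_fun setT (f n)) ->
  measurable_fun setT (ae_lim f).
Proof.
move=> mf; apply: measurableT_comp; first exact: fine_measurable.
by apply: measurable_fun_limn_esup => n; apply/measurable_EFinP.
Qed.

Lemma ae_limE f w l : (fun n => f n w) @ \oo --> l -> ae_lim f w = l.
Proof.
move=> fl; have : (fun n => (f n w)%:E) @ \oo --> l%:E.
  by apply: cvg_EFin => //; exact: nearW.
by rewrite /ae_lim => /cvg_limn_einf_sup[_ ->].
Qed.

Lemma cvg_geometric_increments (u : nat -> R) (t V : R) : 0 <= t < 1 -> 0 <= V ->
  (forall k, `|u k.+1 - u k| <= t ^+ k * V) ->
  exists2 l, u @ \oo --> l & forall n, `|u n - l| <= t ^+ n * (V / (1 - t)).
Proof.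
move=> /andP[t0 t1] V0 Hu.
have t10 : 0 < 1 - t by rewrite subr_gt0.
have dist n m : `|u (n + m)%N - u n| <= t ^+ n * (V / (1 - t)).
  have -> : u (n + m)%N - u n = \sum_(0 <= i < m) (u (n + i).+1 - u (n + i)%N).
    elim: m => [|m IH]; first by rewrite addn0 subrr big_geq.
    by rewrite big_nat_recr//= -IH addnS; ring.
  apply: (le_trans (ler_norm_sum _ _ _)).
  apply: (@le_trans _ _ (t ^+ n * V * \sum_(0 <= i < m) t ^+ i)).
    rewrite mulr_sumr; apply: ler_sum => i _; apply: (le_trans (Hu _)).
    by rewrite exprD mulrAC.
  by rewrite -mulrA ler_wpM2l ?exprn_ge0// ler_wpM2l// geometric_sum_le// t0.
have cu : cvgn u.
  apply/cauchy_cvgP/cauchy_exP => e e0.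
  have tn0 : (fun n => t ^+ n * (V / (1 - t))) @ \oo --> (0 : R).
    rewrite -[X in _ --> X](mul0r (V / (1 - t))); apply: cvgMl; apply: cvg_expr.
    by rewrite ger0_norm.
  move: tn0 => /cvgr0Pnorm_lt/(_ _ e0)[k _ Hk].
  exists (u k); exists k => // m /= km; rewrite /ball /= distrC -(subnKC km).
  by apply: (le_lt_trans (dist _ _)); exact: le_lt_trans (ler_norm _) (Hk k (leqnn k)).
exists (limn u) => // n.
have H : (fun m => `|u (m + n)%N - u n|) @ \oo --> `|limn u - u n|.
  apply: cvg_norm; apply: cvgB; last exact: cvg_cst.
  by rewrite (cvg_shiftn n u).
rewrite distrC -(cvg_lim (@Rhausdorff R) H); apply: limr_le.
  by apply/cvg_ex; eexists; exact: H.
by apply: nearW => m; rewrite addnC dist.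
Qed.

(** A single integrable [V] controls the errors of all indices. It serves for almost sure
    convergence, for convergence in [L_2] and as a dominating function. *)
Lemma L2_geometric_limit f (C r : R) : 0 <= C -> 0 <= r < 1 ->
  (forall n, measurable_fun setT (f n)) ->
  (forall n, (\int[P]_w ((f n.+1 w - f n w) ^+ 2)%:E <= (C * r ^+ n)%:E)%E) ->
  exists V : T -> R, exists2 s : R, 0 <= s < 1 & [/\ measurable_fun setT V,
    forall w, 0 <= V w, P.-integrable setT (EFin \o V) &
    {ae P, forall w, (fun n => f n w) @ \oo --> ae_lim f w /\
      forall n, (f n w - ae_lim f w) ^+ 2 <= s ^+ n * V w}].
Proof.
move=> C0 /andP[r0 r1] mf Hf.
have [s rs s1] : exists2 s : R, r < s & s < 1 by exists ((r + 1) / 2); lra.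
have s0 : 0 < s by exact: le_lt_trans rs.
pose g k w := (f k.+1 w - f k w) ^+ 2.
have mg k : measurable_fun setT (g k).
  by apply: measurable_funX; apply: measurable_funB.
have gle k : (\int[P]_w (`|g k w|)%:E <= (C * r ^+ k)%:E)%E.
  by rewrite /g; under eq_integral do rewrite ger0_norm ?sqr_ge0//; exact: Hf.
have [V [mV V0 iV HV]] := geometric_domination C0 r0 rs mg gle.
pose t := Num.sqrt s.
have t0 : 0 <= t by exact: sqrtr_ge0.
have t2 : t ^+ 2 = s by rewrite sqr_sqrtr// ltW.
have t1 : t < 1 by rewrite -(@ltr_pXn2r _ 2)// ?nnegrE// t2 expr1n.
have t10 : 0 < 1 - t by rewrite subr_gt0.
(* Increments are at most [t ^+ k * sqrt V], hence the error at [n] is at most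
   [t ^+ n * sqrt V / (1 - t)]; its square brings this constant. *)
pose c := ((1 - t)^-1) ^+ 2.
exists (fun w => c * V w), s; first by rewrite ltW//= s1.
split.
- exact: measurable_funM.
- by move=> w; rewrite mulr_ge0// sqr_ge0.
- under [EFin \o _]eq_fun do rewrite /= EFinM.
  exact: integrableZl.
- apply: filterS HV => w HV.
  have Hu k : `|f k.+1 w - f k w| <= t ^+ k * Num.sqrt (V w).
    rewrite -(@ler_pXn2r _ 2)// ?nnegrE ?mulr_ge0 ?exprn_ge0 ?sqrtr_ge0//.
    rewrite exprMn sqr_sqrtr// -exprM mulnC exprM t2 real_normK ?num_real//.
    by have := HV k; rewrite /g ger0_norm// sqr_ge0.
  have t01 : 0 <= t < 1 by rewrite t0.
  have [l fl Hl] := cvg_geometric_increments t01 (sqrtr_ge0 _) Hu.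
  rewrite (ae_limE fl); split => // n.
  have := Hl n; rewrite -(@ler_pXn2r _ 2)// ?nnegrE; last first.
    by rewrite mulr_ge0 ?exprn_ge0// divr_ge0 ?sqrtr_ge0// ltW.
  rewrite real_normK ?num_real// => /le_trans; apply.
rewrite exprMn -exprM mulnC exprM t2. 
  by rewrite expr_div_n sqr_sqrtr// /c exprVn [V w / _]mulrC.
Qed.

Lemma dominated_cvg_real f (f' V : T -> R) :
  (forall n, measurable_fun setT (f n)) -> measurable_fun setT f' ->
  {ae P, forall w, (fun n => f n w) @ \oo --> f' w} ->
  P.-integrable setT (EFin \o V) ->
  {ae P, forall w, forall n, `|f n w| <= V w} ->
  (fun n => \int[P]_w (f n w)%:E)%E @ \oo --> (\int[P]_w (f' w)%:E)%E.
Proof.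
move=> mf mf' ff' iV fV.
have [] := @dominated_convergence _ _ _ P setT measurableT
  (fun n => EFin \o f n) (EFin \o f') (EFin \o V) => //.
- by move=> n; apply/measurable_EFinP.
- by apply/measurable_EFinP.
- apply: filterS ff' => w ff' _; apply: cvg_EFin => //; exact: nearW.
- by apply: filterS fV => w fV n _; rewrite lee_fin.
Qed.

Lemma bounded_cvg_real f (f' : T -> R) (M : R) :
  (forall n, measurable_fun setT (f n)) -> measurable_fun setT f' ->
  {ae P, forall w, (fun n => f n w) @ \oo --> f' w} ->
  (forall n w, `|f n w| <= M) ->
  (fun n => \int[P]_w (f n w)%:E)%E @ \oo --> (\int[P]_w (f' w)%:E)%E.
Proof.
move=> mf mf' ff' fM; apply: (@dominated_cvg_real f f' (cst M)) => //.
  exact: finite_measure_integrable_cst.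
exact: nearW.
Qed.

End GeometricConvergence.

(** * Finite samples of independent chains *)

Section FiniteRandomElement.
Context d (T : measurableType d) (R : realType) (P : probability T R).
Variables (I : finType) (Z : T -> I).
Hypothesis mZ : forall i, measurable [set w | Z w = i].
Implicit Type F : I -> R.

Lemma finite_indicE F w : F (Z w) = \sum_i F i * \1_[set w | Z w = i] w.
Proof.
rewrite (bigD1 (Z w)) //= big1 => [|i iZ].
  by rewrite indicE mem_set// mulr1 addr0.
by rewrite indicE memNset ?mulr0// => /= Zi; rewrite Zi eqxx in iZ.
Qed.

Lemma measurable_finite F : measurable_fun setT (fun w => F (Z w)).
Proof.
under eq_fun do rewrite finite_indicE.
by apply: measurable_sum => i; apply: measurable_funM.
Qed.

Lemma integral_finite F (pr : I -> R) :
  (forall i, P [set w | Z w = i] = (pr i)%:E) ->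
  (\int[P]_w (F (Z w))%:E)%E = (\sum_i F i * pr i)%:E.
Proof.
move=> HP; under eq_integral do rewrite finite_indicE -sumEFin.
have ii i : P.-integrable setT (fun x => (\1_[set w | Z w = i] x : R)%:E).
  by apply: integrable_indic => //; rewrite HP ltry.
rewrite integral_sum//=; last first.
  by move=> i; under eq_fun do rewrite EFinM; exact: integrableZl.
rewrite -sumEFin; apply: eq_bigr => i _.
under eq_integral do rewrite EFinM.
rewrite (integralZl measurableT (ii i)).
by rewrite integral_indic//= setIT EFinM; congr (_ * _)%E; exact: HP.
Qed.

End FiniteRandomElement.

Section Paths.
Variables (R : realType) (N : nat) (p : R).
Local Notation state := 'I_N.+1.

Fixpoint path_weight (h : R) (i0 : state) (r : seq state) : R :=
  if r is i :: r' then bd_trans p h i0 i * path_weight h i r' else 1.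

Fixpoint timed (a h : R) (r : seq state) : seq (R * state) :=
  if r is i :: r' then (a, i) :: timed (a + h) h r' else [::].

Lemma chain_prob_timed a h i0 r :
  chain_prob p a i0 (timed (a + h) h r) = path_weight h i0 r.
Proof.
elim: r a i0 => [//|i r IH] a i0 /=.
by rewrite IH addrAC subrr add0r.
Qed.

Lemma sorted_timed a h r : 0 <= h -> sorted <=%R (a :: map fst (timed (a + h) h r)).
Proof.
move=> h0; elim: r a => [//|i r IH] a /=.
by rewrite lerDl h0; exact: IH.
Qed.

(** The law of [m.+1] samples of the stationary chain taken with step [h]. *)
Definition weight m (h : R) (x : m.+1.-tuple state) : R :=
  binom_pmf p (thead x) * path_weight h (thead x) (behead x).

Context d (T : measurableType d) (P : probability T R).
Implicit Type Y : R -> T -> R.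

(** The processes are real valued; truncation recovers the state in a finite type, faithfully by
    [state_atE]. *)
Definition state_at Y s w : state := inord (Num.truncn (Y s w)).

Definition sample m Y a h w : m.+1.-tuple state :=
  [tuple state_at Y (a + i%:R * h) w | i < m.+1].

Definition timed_event Y (ts : seq (R * state)) : set T :=
  foldr (fun (ti : R * state) A => [set w | Y ti.1 w = (nat_of_ord ti.2)%:R] `&` A)
    setT ts.

Lemma timed_eventP Y a h r w : timed_event Y (timed a h r) w <->
  forall k, (k < size r)%N -> Y (a + k%:R * h) w = (nth ord0 r k : nat)%:R.
Proof.
elim: r a => [|i r IH] a /=; first by split.
rewrite IH; split=> [[Ya Hr] [|k] kr|Hr].
- by rewrite mul0r addr0.
- by have := Hr k kr; rewrite /= -addrA -{1}[h]mul1r -mulrDl -natr1 addrC [1 + _]addrC addrC.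
- split; first by have := Hr 0%N isT; rewrite mul0r addr0.
  by move=> k kr; have := Hr k.+1 kr; rewrite /= -natr1 mulrDl mul1r [_ * _ + h]addrC addrA.
Qed.

(** Reconciles the two hypotheses: independence speaks of cylinder events, the law of the chain of
    prescribed states, and a state is a cylinder over a singleton. *)
Lemma cyl_event_timed Y (ts : seq (R * state)) :
  cyl_event Y [seq (ti.1, [set (nat_of_ord ti.2)%:R]) | ti <- ts] = timed_event Y ts.
Proof.
elim: ts => [//|ti ts IH] /=; rewrite IH; congr (_ `&` _).
by apply/seteqP; split => w /=; rewrite inE.
Qed.

Section OneProcess.
Variable Y : R -> T -> R.
Hypothesis HY : stationary_birth_death P N p Y.

Lemma state_atE s w : Y s w = (state_at Y s w : nat)%:R.
Proof.
case: HY => HN _ _; have [i Yi] := HN s w.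
by rewrite /state_at Yi natrK inord_val.
Qed.

Lemma measurable_process s : measurable_fun setT (Y s).
Proof. by case: HY => _ mY _; exact: (measurable_fun_pair2 s mY). Qed.

Lemma measurable_timed_event ts : measurable (timed_event Y ts).
Proof.
elim: ts => [|ti ts IH] /=; first exact: measurableT.
apply: measurableI => //; rewrite -[X in measurable X]setTI.
exact: (measurable_process ti.1 measurableT (measurable_set1 _)).
Qed.

Lemma sampleP m a h w (x : m.+1.-tuple state) :
  sample m Y a h w = x <-> timed_event Y (timed a h x) w.
Proof.
rewrite timed_eventP size_tuple; split => [<- k km|H].
  by rewrite (_ : k = Ordinal km)// -tnth_nth tnth_mktuple -state_atE.
apply: eq_from_tnth => i; rewrite tnth_mktuple; apply: val_inj => /=.
apply/eqP; rewrite -(eqr_nat R) -state_atE H// (tnth_nth ord0).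
exact: eqxx.
Qed.

Lemma prob_timed_event m a h (x : m.+1.-tuple state) : 0 <= a -> 0 <= h ->
  P (timed_event Y (timed a h x)) = (weight h x)%:E.
Proof.
move=> a0 h0; case/tupleP: x => i x /=; case: HY => _ _ HP.
have := HP a i (timed (a + h) h x) a0 (sorted_timed _ _ h0).
rewrite chain_prob_timed /weight /= theadE => <-; congr (P _).
Qed.

End OneProcess.

Section ManyProcesses.
Variables (b : R) (m : nat).
Hypothesis b0 : 0 < b.
Variable X : nat -> R -> T -> R.
Hypothesis HX : forall j, stationary_birth_death P N p (X j).
Hypothesis HI : independent_processes P X.
Local Notation cfg := (m.+1.-tuple state).

(** Multiplying the times by [b ^+ j] at level [j] makes the [i]-th samples of all levels the
    factors of the density at [a + i h]. *)
Definition samples n a h w : n.-tuple cfg :=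
  [tuple sample m (X j) (a * b ^+ j) (h * b ^+ j) w | j < n].

Let lev (l : seq cfg) j : cfg := nth [tuple ord0 | _ < m.+1] l j.

Lemma samplesE n a h (l : n.-tuple cfg) : [set w | samples n a h w = l] =
  \bigcap_(j in [set j | j \in iota 0 n])
     cyl_event (X j) [seq (ti.1, [set (nat_of_ord ti.2)%:R])
                     | ti <- timed (a * b ^+ j) (h * b ^+ j) (lev l j)].
Proof.
apply/seteqP; split => w /=.
  move=> wl j /=; rewrite mem_iota add0n => /andP[_ jn].
  rewrite cyl_event_timed -sampleP// -[j]/(nat_of_ord (Ordinal jn)) /lev -tnth_nth -wl.
  by rewrite tnth_mktuple.
move=> H; apply: eq_from_tnth => j; rewrite tnth_mktuple (tnth_nth [tuple ord0 | _ < m.+1]).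
by apply/sampleP => //; rewrite -cyl_event_timed; apply: H => /=; rewrite mem_iota add0n ltn_ord.
Qed.

Lemma measurable_samples n a h (l : n.-tuple cfg) :
  measurable [set w | samples n a h w = l].
Proof.
rewrite samplesE bigcap_seq; apply: bigsetI_measurable => j _.
by rewrite cyl_event_timed; exact: measurable_timed_event.
Qed.

Lemma prob_samples n a h (l : n.-tuple cfg) : 0 <= a -> 0 <= h ->
  P [set w | samples n a h w = l] = (\prod_(j < n) weight (h * b ^+ j) (tnth l j))%:E.
Proof.
move=> a0 h0; rewrite samplesE HI ?iota_uniq//; last first.
  by move=> j tB /mapP[ti _ ->] /=; exact: measurable_set1.
rewrite -prodEFin (eq_bigr (fun j : 'I_n => (weight (h * b ^+ j) (lev l j))%:E)); last first.
  by move=> j _; rewrite (tnth_nth [tuple ord0 | _ < m.+1]).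
rewrite -(big_mkord xpredT (fun j => (weight (h * b ^+ j) (lev l j))%:E)).
rewrite /index_iota subn0; apply: eq_bigr => j _.
rewrite cyl_event_timed; apply: prob_timed_event => //;
  by apply: mulr_ge0 => //; apply: exprn_ge0; exact: ltW.
Qed.

(* The expectation of [F] over the samples of [n] successive levels; the step is
   multiplied by [b] from one level to the next. By stationarity the left
   endpoint of the window plays no role. *)
Fixpoint iter_mean n (h : R) (F : seq cfg -> R) : R :=
  if n is n'.+1 then
    \sum_(x : cfg) weight h x * iter_mean n' (h * b) (fun l => F (x :: l))
  else F [::].

Lemma iter_meanE n h (F : seq cfg -> R) :
  \sum_(l : n.-tuple cfg) F l * \prod_(j < n) weight (h * b ^+ j) (tnth l j) = iter_mean n h F.
Proof.
elim: n h F => [|n IH] h F /=.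
  rewrite (big_pred1 [tuple]) => [|l]; last by apply/esym/eqP; exact: tuple0.
  by rewrite big_ord0 mulr1.
rewrite (reindex (fun xl : cfg * n.-tuple cfg => [tuple of xl.1 :: xl.2])) /=; last first.
  exists (fun l : n.+1.-tuple cfg => (thead l, [tuple of behead l])) => [[x l] _|l _] /=.
    by rewrite theadE; congr (_, _); exact: val_inj.
  by rewrite -tuple_eta.
rewrite -(pair_bigA _ (fun x (l : n.-tuple cfg) => F (x :: l) *
  \prod_(j < n.+1) weight (h * b ^+ j) (tnth [tuple of x :: l] j))) /=.
apply: eq_bigr => x _; rewrite -IH mulr_sumr; apply: eq_bigr => l _.
rewrite big_ord_recl tnth0 expr0 mulr1 mulrCA; congr (_ * (_ * _)).
by apply: eq_bigr => j _; rewrite tnthS exprS mulrA.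
Qed.

Lemma measurable_of_samples n a h (F : seq cfg -> R) :
  measurable_fun setT (fun w => F (samples n a h w)).
Proof.
exact: (measurable_finite (measurable_samples a h) (fun l : n.-tuple cfg => F l)).
Qed.

Lemma integral_samples n a h (F : seq cfg -> R) : 0 <= a -> 0 <= h ->
  (\int[P]_w (F (samples n a h w))%:E)%E = (iter_mean n h F)%:E.
Proof.
move=> a0 h0; rewrite -iter_meanE.
apply: (@integral_finite _ _ _ _ _ _ (measurable_samples a h) (fun l : n.-tuple cfg => F l)).
by move=> l; exact: prob_samples.
Qed.

End ManyProcesses.
End Paths.

(** * Two-point laws, jump probabilities and sample means of one chain *)

Section OneProcessMoments.
Variables (R : realType) (N : nat) (p : R).
Hypothesis p01 : 0 < p < 1.
Context d (T : measurableType d) (P : probability T R) (Y : R -> T -> R).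
Hypothesis HY : stationary_birth_death P N p Y.
Local Notation state := 'I_N.+1.
Local Notation pmf := (@binom_pmf R N p).

Lemma pmf_ge0 i : 0 <= pmf i.
Proof.
case/andP: p01 => p0 p1; rewrite /binom_pmf mulr_ge0//; last by rewrite exprn_ge0// subr_ge0 ltW.
by rewrite mulr_ge0// exprn_ge0// ltW.
Qed.

Lemma pmf_sum : \sum_i pmf i = 1.
Proof.
have := binom_pgf N p 1 1; under eq_bigr do rewrite !expr1n mulr1 mulr1.
by move=> ->; rewrite !mulr1 addrC subrK expr1n.
Qed.

Lemma measurable_state s (i : state) : measurable [set w | state_at N Y s w = i].
Proof.
rewrite (_ : [set w | _] = setT `&` Y s @^-1` [set (i : nat)%:R]).
  by apply: (measurable_process HY s measurableT).
rewrite setTI; apply/seteqP; split=> w /=; first by rewrite (state_atE HY) => ->.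
by rewrite (state_atE HY) => /eqP; rewrite eqr_nat => /eqP/val_inj.
Qed.

Lemma integral_state s (f : state -> R) : 0 <= s ->
  (\int[P]_w (f (state_at N Y s w))%:E)%E = (\sum_i pmf i * f i)%:E.
Proof.
move=> s0; rewrite (integral_finite (measurable_state s) f (pr := pmf)).
  by congr EFin; apply: eq_bigr => i _; rewrite mulrC.
move=> i; case: HY => _ _ /(_ s i [::] s0 isT); rewrite /= mulr1 => <-.
congr (P _); apply/seteqP; split=> w /=.
  by move=> <-; split => //; exact: (state_atE HY).
by rewrite /state_event /= (state_atE HY) => -[/eqP + _]; rewrite eqr_nat => /eqP/val_inj.
Qed.

Lemma integral_state2 s s' (f : state -> state -> R) : 0 <= s <= s' ->
  (\int[P]_w (f (state_at N Y s w) (state_at N Y s' w))%:E)%E =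
  (\sum_i \sum_j pmf i * bd_trans p (s' - s) i j * f i j)%:E.
Proof.
move=> /andP[s0 ss']; rewrite pair_bigA /=.
pose Z w := (state_at N Y s w, state_at N Y s' w).
have ZE (ij : state * state) : [set w | Z w = ij]
    = [set w | state_at N Y s w = ij.1] `&` [set w | state_at N Y s' w = ij.2].
  by apply/seteqP; split=> w /=; rewrite /Z; case: ij => i j /=; [case|case=> -> ->].
have mZ (ij : state * state) : measurable [set w | Z w = ij].
  by rewrite ZE; apply: measurableI; exact: measurable_state.
rewrite (integral_finite mZ (fun ij => f ij.1 ij.2)
  (pr := fun ij => pmf ij.1 * bd_trans p (s' - s) ij.1 ij.2)).
  by congr EFin; apply: eq_bigr => i _; rewrite mulrC.
move=> [i j]; rewrite ZE /=.
case: HY => _ _ /(_ s i [:: (s', j)] s0); rewrite /= ss' mulr1 => /(_ isT) <-.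
congr (P _); apply/seteqP; split=> w /=.
  by move=> [<- <-]; split; [exact: (state_atE HY)|split => //; exact: (state_atE HY)].
rewrite /state_event /= !(state_atE HY) => -[/eqP + [/eqP + _]].
by rewrite !eqr_nat => /eqP/val_inj -> /eqP/val_inj ->.
Qed.

Local Notation jump_const := (sojourn_const N p).

Lemma jump_const_ge1 : 1 <= jump_const.
Proof. by rewrite /sojourn_const lerDl expR_ge0. Qed.

Lemma integral_jump s h : 0 <= s -> 0 <= h ->
  (\int[P]_w ((state_at N Y s w != state_at N Y (s + h) w)%:R)%:E <= (jump_const * h)%:E)%E.
Proof.
move=> s0 h0; have ssh : 0 <= s <= s + h by rewrite s0 lerDl.
rewrite (integral_state2 (fun i j => (i != j)%:R) ssh) lee_fin addrAC subrr add0r.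
(* That the two-point law has mass 1 is read off the process, and so is its nonnegativity below,
   rather than derived from the matrix exponential. *)
have := integral_state2 (fun i j => 1) ssh.
have -> : (\int[P]_w (1 : R)%:E = 1%:E)%E.
  by rewrite (integral_cst P measurableT (1 : R)%:E) mul1e; exact: probability_setT.
rewrite addrAC subrr add0r => -[].
under [X in _ = X -> _]eq_bigr do under eq_bigr do rewrite mulr1.
move=> tot; have [h1|h1] := leP h 1; last first.
  apply: (@le_trans _ _ 1); last first.
    by have := jump_const_ge1; move: (sojourn_const _ _) => c c1; nra.
  have nn i j : 0 <= pmf i * bd_trans p h i j.
    have := integral_state2 (fun i' j' => ((i' == i) && (j' == j))%:R) ssh.
    rewrite (bigD1 i) //= [X in (_ + X)%:E]big1 => [|k ki]; last first.
      by rewrite big1// => l _; rewrite (negbTE ki) mulr0.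
    rewrite (bigD1 j) //= big1 => [|k kj]; last by rewrite (negbTE kj) andbF mulr0.
    rewrite !eqxx mulr1 !addr0 addrAC subrr add0r => H; rewrite -lee_fin -H.
    by apply: integral_ge0 => w _; rewrite lee_fin.
  rewrite [leRHS]tot; apply: ler_sum => i _; apply: ler_sum => j _.
  by rewrite ler_piMr ?nn//; case: (_ != _).
have -> : \sum_i \sum_j pmf i * bd_trans p h i j * (i != j)%:R
  = 1 - \sum_i pmf i * bd_trans p h i i.
  rewrite [in RHS]tot -sumrB; apply: eq_bigr => i _.
  rewrite [in RHS](bigD1 i) //= addrAC subrr add0r (bigD1 i) //= eqxx mulr0 add0r.
  by apply: eq_bigr => j ij; rewrite eq_sym ij mulr1.
have : \sum_i pmf i * (1 - jump_const * h) <= \sum_i pmf i * bd_trans p h i i.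
  apply: ler_sum => i _; rewrite ler_wpM2l ?pmf_ge0//.
  by apply: bd_trans_diag; rewrite h0.
by rewrite -mulr_suml pmf_sum mul1r; lra.
Qed.

Section Sample.
Variables (m : nat) (h : R).
Hypothesis h0 : 0 <= h.
Local Notation cfg := (m.+1.-tuple state).
Definition sample_mean (f : cfg -> R) := \sum_(x : cfg) weight p h x * f x.

Lemma measurable_sample a (x : cfg) : measurable [set w | sample N m Y a h w = x].
Proof.
rewrite (_ : [set w | _] = timed_event Y (timed a h x)); last first.
  by apply/seteqP; split => w /=; rewrite (sampleP HY).
exact: measurable_timed_event HY _.
Qed.

Lemma prob_sample a (x : cfg) : 0 <= a ->
  P [set w | sample N m Y a h w = x] = (weight p h x)%:E.
Proof.
move=> a0; rewrite (_ : [set w | _] = timed_event Y (timed a h x)); last first.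
  by apply/seteqP; split => w /=; rewrite (sampleP HY).
exact: prob_timed_event.
Qed.

Lemma integral_sample (f : cfg -> R) :
  (\int[P]_w (f (sample N m Y 0 h w))%:E)%E = (sample_mean f)%:E.
Proof.
rewrite (integral_finite (measurable_sample 0) f (pr := weight p h)).
  by congr EFin; apply: eq_bigr => x _; rewrite mulrC.
by move=> x; exact: prob_sample.
Qed.

Lemma weight_ge0 (x : cfg) : 0 <= weight p h x.
Proof. by rewrite -lee_fin -(prob_sample x (lexx 0)). Qed.

Lemma sample_mean_le f g : (forall x, f x <= g x) -> sample_mean f <= sample_mean g.
Proof. by move=> fg; apply: ler_sum => x _; rewrite ler_wpM2l// weight_ge0. Qed.

Lemma sample_meanD f g : sample_mean (fun x => f x + g x) = sample_mean f + sample_mean g.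
Proof. by rewrite -big_split; apply: eq_bigr => x _; rewrite mulrDr. Qed.

Lemma sample_meanZ c f : sample_mean (fun x => c * f x) = c * sample_mean f.
Proof. by rewrite mulr_sumr; apply: eq_bigr => x _; rewrite mulrCA. Qed.

Lemma sample_mean_sum (I : finType) (f : I -> cfg -> R) :
  sample_mean (fun x => \sum_i f i x) = \sum_i sample_mean (f i).
Proof.
by rewrite exchange_big; apply: eq_bigr => x _; rewrite mulr_sumr.
Qed.

Lemma sample_mean1 i (f : state -> R) :
  sample_mean (fun x => f (tnth x i)) = \sum_j pmf j * f j.
Proof.
have i0 : 0 <= 0 + i%:R * h by rewrite add0r mulr_ge0.
have := integral_sample (fun x => f (tnth x i)).
under eq_integral do rewrite tnth_mktuple.
by rewrite (integral_state f i0) => -[].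
Qed.

Lemma sample_mean2 (i j : 'I_m.+1) (f : state -> state -> R) : (i <= j)%N ->
  sample_mean (fun x => f (tnth x i) (tnth x j)) =
  \sum_k \sum_l pmf k * bd_trans p (h * `|i%:R - j%:R|) k l * f k l.
Proof.
move=> ij; have ijR : i%:R <= j%:R :> R by rewrite ler_nat.
have i0 : 0 <= 0 + i%:R * h <= 0 + j%:R * h.
  by rewrite !add0r mulr_ge0// ler_wpM2r.
have := integral_sample (fun x => f (tnth x i) (tnth x j)).
under eq_integral do rewrite !tnth_mktuple.
rewrite (integral_state2 f i0) => -[<-].
rewrite !add0r -mulrBl mulrC -normrN opprB ger0_norm//; by rewrite subr_ge0.
Qed.

Lemma sample_mean_lam : forall i, sample_mean (fun x => lam N p (tnth x i)) = 1.
Proof. by move=> i; rewrite (sample_mean1 i (fun j => lam N p j)) lam_mean. Qed.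

Lemma sample_mean_corr (i j : 'I_m.+1) :
  sample_mean (fun x => lam N p (tnth x i) * lam N p (tnth x j))
  = lam_corr N p (h * `|i%:R - j%:R|).
Proof.
wlog ij : i j / (i <= j)%N => [W|].
  have [|/ltnW] := leqP i j; first exact: W.
  by move=> /W; rewrite distrC => <-; apply: eq_bigr => x _; rewrite [lam _ _ _ * _]mulrC.
by rewrite (sample_mean2 (fun k l => lam N p k * lam N p l) ij).
Qed.

Definition jumps (x : cfg) := [exists i, tnth x i != thead x].

(** A configuration that leaves its first state changes between two consecutive times. The union
    bound over the steps depends only on the length [m h], not on the mesh. *)
Lemma sample_mean_jumps : sample_mean (fun x => (jumps x)%:R) <= jump_const * (m%:R * h).
Proof.
apply: (@le_trans _ _ (sample_mean (fun x : cfg => \sum_(i < m)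
   (tnth x (widen_ord (leqnSn m) i) != tnth x (lift ord0 i))%:R))).
  apply: sample_mean_le => x; rewrite -natr_sum ler_nat.
  have [/existsP[i xi]|//] := boolP (jumps x); rewrite lt0n; apply/negP.
  rewrite sum_nat_eq0 => /forallP H; move/negP: xi; apply; apply/eqP.
  case: i => k; elim: k => [|k IH] km; first by congr tnth; exact: val_inj.
  rewrite -(IH (ltnW km)); have := H (Ordinal (km : k < m)%N).
  rewrite /= eqb0 negbK => /eqP E; apply/esym; apply: etrans (etrans _ E) _.
    by congr tnth; exact: val_inj.
  by congr tnth; exact: val_inj.
rewrite sample_mean_sum; apply: (@le_trans _ _ (\sum_(i < m) jump_const * h)).
  apply: ler_sum => i _; set f := (fun x : cfg => _).
  have i0 : 0 <= 0 + i%:R * h by rewrite add0r mulr_ge0.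
  rewrite -lee_fin -integral_sample; apply: le_trans (integral_jump i0 h0).
  rewrite le_eqVlt; apply/orP; left; apply/eqP/eq_integral => w _.
  rewrite /f !tnth_mktuple /= /bump /= add1n -natr1 mulrDl mul1r addrA.
  by [].
by rewrite big_const_ord iter_addr_0 -mulr_natl; lra.
Qed.

End Sample.
End OneProcessMoments.

(** * The discretized cascade *)

Section DiscreteCascade.
Variables (R : realType) (N : nat) (p b : R) (m : nat).
Hypothesis p01 : 0 < p < 1.
Hypothesis b0 : 0 < b.
Context d (T : measurableType d) (P : probability T R) (Y : R -> T -> R).
Hypothesis HY : stationary_birth_death P N p Y.
Local Notation cfg := (m.+1.-tuple 'I_N.+1).
Local Notation lam := (lam N p).
Local Notation iter_mean := (@iter_mean R N p b m).
Local Notation mean := (@sample_mean R N p m).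

Lemma iter_meanS n h (F : seq cfg -> R) :
  iter_mean n.+1 h F = mean h (fun x => iter_mean n (h * b) (fun l => F (x :: l))).
Proof. by []. Qed.

Lemma eq_iter_mean n h (F G : seq cfg -> R) : (forall l, size l = n -> F l = G l) ->
  iter_mean n h F = iter_mean n h G.
Proof.
elim: n h F G => [|n IH] h F G FG; first exact: FG.
by rewrite !iter_meanS; congr sample_mean; apply/funext => x; apply: IH => l ls;
  apply: FG; rewrite /= ls.
Qed.

Lemma le_iter_mean n h (F G : seq cfg -> R) : 0 <= h -> (forall l, size l = n -> F l <= G l) ->
  iter_mean n h F <= iter_mean n h G.
Proof.
elim: n h F G => [|n IH] h F G h0 FG; first exact: FG.
rewrite !iter_meanS; apply: (sample_mean_le HY h0) => x.
by apply: IH => [|l ls]; [rewrite mulr_ge0// ltW|apply: FG; rewrite /= ls].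
Qed.

Lemma iter_meanZ n h c (F : seq cfg -> R) :
  iter_mean n h (fun l => c * F l) = c * iter_mean n h F.
Proof.
elim: n h F => [//|n IH] h F; rewrite !iter_meanS -sample_meanZ.
by congr sample_mean; apply/funext => x; exact: IH.
Qed.

Lemma iter_mean_sum (I : finType) n h (F : I -> seq cfg -> R) :
  iter_mean n h (fun l => \sum_i F i l) = \sum_i iter_mean n h (F i).
Proof.
elim: n h F => [//|n IH] h F; rewrite !iter_meanS -sample_mean_sum.
by congr sample_mean; apply/funext => x; exact: IH.
Qed.

Lemma iter_mean_ge0 n h (F : seq cfg -> R) : 0 <= h -> (forall l, 0 <= F l) ->
  0 <= iter_mean n h F.
Proof.
move=> h0 F0; rewrite -[leLHS](mul0r (iter_mean n h (fun=> 0))) -iter_meanZ.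
by apply: le_iter_mean => // l _; rewrite mul0r.
Qed.

Definition lamprod i (l : seq cfg) : R := \prod_(x <- l) lam (tnth x i).

Lemma lamprod_cons i x l : lamprod i (x :: l) = lam (tnth x i) * lamprod i l.
Proof. by rewrite /lamprod big_cons. Qed.

Lemma lamprod_gt0 i l : 0 < lamprod i l.
Proof. by rewrite /lamprod; apply: prodr_gt0 => x _; exact: lam_gt0. Qed.

Definition riemann (h : R) (l : seq cfg) : R := h * \sum_i lamprod i l.

Lemma riemann_ge0 h l : 0 <= h -> 0 <= riemann h l.
Proof.
by move=> h0; rewrite mulr_ge0//; apply: sumr_ge0 => i _; rewrite ltW// lamprod_gt0.
Qed.

Lemma iter_mean_lamprod n h i : 0 <= h -> iter_mean n h (lamprod i) = 1.
Proof.
elim: n h => [|n IH] h h0; first by rewrite /= /lamprod big_nil.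
rewrite iter_meanS -[RHS](sample_mean_lam p01 HY h0 i); congr sample_mean.
apply/funext => x; under eq_iter_mean do rewrite lamprod_cons.
by rewrite iter_meanZ IH ?mulr1// mulr_ge0// ltW.
Qed.

Lemma iter_mean_riemann n h : 0 <= h -> iter_mean n h (riemann h) = h * m.+1%:R.
Proof.
move=> h0; rewrite iter_meanZ iter_mean_sum; congr (_ * _).
under eq_bigr do rewrite (iter_mean_lamprod _ _ h0).
by rewrite sumr_const card_ord.
Qed.

Let incr n i (l : seq cfg) : R := lamprod i l - lamprod i (take n l).

(** Each earlier level contributes a correlation of at most [corr0]. The last one contributes a
    covariance, which decays on its own time scale [h * b ^+ n]. *)
Lemma iter_mean_incr n h i j : 0 <= h ->
  iter_mean n.+1 h (fun l => incr n i l * incr n j l) <=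
  corr0 N p ^+ n.+1 * expR (- (h * b ^+ n * `|i%:R - j%:R|)).
Proof.
elim: n h => [|n IH] h h0.
  have -> : iter_mean 1 h (fun l => incr 0 i l * incr 0 j l) =
      lam_corr N p (h * `|i%:R - j%:R|) - 1.
    transitivity (mean h (fun x => (lam (tnth x i) - 1) * (lam (tnth x j) - 1))).
      rewrite iter_meanS; congr sample_mean; apply/funext => x.
      by rewrite /= /incr !lamprod_cons /lamprod !big_nil !mulr1.
    have one : mean h (fun=> 1) = 1.
      by rewrite (sample_mean1 HY h0 i (fun=> 1)); under eq_bigr do rewrite mulr1; rewrite pmf_sum.
    have E : mean h (fun x => (lam (tnth x i) - 1) * (lam (tnth x j) - 1))
        + mean h (fun x => lam (tnth x i)) + mean h (fun x => lam (tnth x j))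
       = mean h (fun x => lam (tnth x i) * lam (tnth x j)) + mean h (fun=> 1).
      by rewrite -!sample_meanD; congr (\sum_x _); apply/funext => x; congr (_ * _); ring.
    move: E; rewrite !(sample_mean_lam p01 HY h0) one.
    by rewrite (sample_mean_corr HY h0); lra.
  rewrite expr0 mulr1 expr1; apply: lam_corr_decay => //.
  by rewrite mulr_ge0.
rewrite iter_meanS.
have hb0 : 0 <= h * b by rewrite mulr_ge0// ltW.
have c0 : 0 <= corr0 N p by rewrite (le_trans ler01)// corr0_ge1.
set G := fun l => incr n i l * incr n j l.
have -> : (fun x => iter_mean n.+1 (h * b) (fun l => incr n.+1 i (x :: l) * incr n.+1 j (x :: l)))
   = (fun x => iter_mean n.+1 (h * b) G * (lam (tnth x i) * lam (tnth x j))).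
  apply/funext => x; rewrite [RHS]mulrC -iter_meanZ; apply: eq_iter_mean => l _.
  by rewrite /G /incr /= !lamprod_cons; ring.
rewrite sample_meanZ (sample_mean_corr HY h0) mulrC.
apply: (@le_trans _ _ (lam_corr N p (h * `|i%:R - j%:R|) *
  (corr0 N p ^+ n.+1 * expR (- (h * b * b ^+ n * `|i%:R - j%:R|))))).
  by rewrite ler_wpM2l ?lam_corr_ge0//; exact: IH.
rewrite [corr0 N p ^+ n.+2]exprS -[X in _ <= X]mulrA.
rewrite (_ : h * b ^+ n.+1 = h * b * b ^+ n); last by rewrite exprS mulrA.
apply: ler_wpM2r; last by rewrite lam_corr_le// mulr_ge0.
by apply: mulr_ge0; [exact: exprn_ge0|exact: expR_ge0].
Qed.

Lemma sum_eq_nat_le1 n (c : nat) : (\sum_(j < n) (j == c :> nat) <= 1)%N.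
Proof.
have [cn|nc] := ltnP c n.
  rewrite (bigD1 (Ordinal cn)) //= eqxx big1 => [|j]; first by rewrite addn0.
  by rewrite -val_eqE /= => /negbTE ->.
rewrite big1// => j _; apply/eqP; rewrite eqb0.
by apply: contraTneq nc => <-; rewrite -ltnNge.
Qed.

(** Each row is at most two geometric series of ratio [exp(- t)], and
    [1 / (1 - exp(- t)) <= 1 + 1 / t]. *)
Lemma exp_dist_sum (t : R) : 0 < t ->
  \sum_(i < m.+1) \sum_(j < m.+1) expR (- (t * `|i%:R - j%:R|)) <= m.+1%:R * (2 * (1 + t^-1)).
Proof.
move=> t0; set z := expR (- t).
have z01 : 0 <= z < 1 by rewrite expR_ge0 /= /z -expR0 ltr_expR oppr_lt0.
have Z : \sum_(0 <= k < m.+1) z ^+ k <= 1 + t^-1.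
  apply: (le_trans (geometric_sum_le _ z01)).
  have zle : z <= (1 + t)^-1 by rewrite /z expRN lef_pV2 ?posrE ?expR_gt0 ?addr_gt0// expR_ge1Dx.
  have -> : 1 + t^-1 = (1 - (1 + t)^-1)^-1.
    have t10 : 1 + t != 0 by rewrite gt_eqF// addr_gt0.
    have tn : t != 0 by rewrite gt_eqF.
    have -> : 1 - (1 + t)^-1 = t / (1 + t) by apply: (mulIf t10); rewrite mulrBl mulVf// divfK//; ring.
    by rewrite invf_div mulrDl mul1r divff// addrC.
  rewrite lef_pV2 ?posrE ?subr_gt0.
  - by lra.
  - by case/andP: z01.
  - by rewrite invf_lt1 ?addr_gt0// ltrDl.
apply: (@le_trans _ _ (\sum_(i < m.+1) 2 * (1 + t^-1))); last first.
  by rewrite sumr_const card_ord -[leLHS]mulr_natl.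
apply: ler_sum => i _.
(* Indices [j] are sorted by their distance [k] to [i]: at most one lies on each side. *)
apply: (@le_trans _ _ (\sum_(j < m.+1) \sum_(k < m.+1)
    ((j == i + k :> nat)%N%:R + (i == j + k :> nat)%N%:R) * z ^+ k)).
  apply: ler_sum => j _.
  have E (k : nat) : `|i%:R - j%:R| = k%:R :> R -> expR (- (t * `|i%:R - j%:R|)) = z ^+ k.
    by move=> ->; rewrite -mulNr expRM_natr.
  have [ij|ji] := leqP i j.
    have kj : (j - i < m.+1)%N by rewrite (leq_ltn_trans (leq_subr _ _)).
    rewrite (E (j - i)%N); last by rewrite distrC natrB// ger0_norm// subr_ge0 ler_nat.
    rewrite (bigD1 (Ordinal kj)) //= subnKC// eqxx mulrDl mul1r -addrA lerDl addr_ge0//.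
      by rewrite mulr_ge0// exprn_ge0// expR_ge0.
    by apply: sumr_ge0 => k _; rewrite mulr_ge0// ?exprn_ge0// expR_ge0.
  have ki : (i - j < m.+1)%N by rewrite (leq_ltn_trans (leq_subr _ _)).
  rewrite (E (i - j)%N); last by rewrite natrB ?(ltnW ji)// ger0_norm// subr_ge0 ler_nat ltnW.
  rewrite (bigD1 (Ordinal ki)) //= subnKC 1?ltnW// eqxx mulrDl mul1r addrAC addrC lerDl addr_ge0//.
    by rewrite mulr_ge0// exprn_ge0// expR_ge0.
  by apply: sumr_ge0 => k _; rewrite mulr_ge0// ?exprn_ge0// expR_ge0.
rewrite exchange_big /=; apply: (@le_trans _ _ (2 * \sum_(k < m.+1) z ^+ k)); last first.
  by rewrite ler_wpM2l//; move: Z; rewrite big_mkord.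
rewrite mulr_sumr; apply: ler_sum => k _; rewrite -mulr_suml ler_wpM2r ?exprn_ge0 ?expR_ge0//.
rewrite big_split /= -!natr_sum -natrD ler_nat.
apply: (@leq_add _ _ 1 1); first exact: sum_eq_nat_le1.
apply: leq_trans (sum_eq_nat_le1 m.+1 (i - k)).
by apply: leq_sum => j _; case: (eqVneq (i : nat) (j + k)%N) => // ->; rewrite addnK eqxx.
Qed.

(** Here [h * m.+1%:R] is the length of the window. The isolated [h] disappears as the mesh is
    refined, which leaves the ratio [corr0 / b]. *)
Lemma iter_mean_increment n h : 0 < h ->
  iter_mean n.+1 h (fun l => (riemann h l - riemann h (take n l)) ^+ 2) <=
  corr0 N p ^+ n.+1 * (2 * (h * m.+1%:R) * (h + (b ^+ n)^-1)).
Proof.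
move=> h0; have h0' := ltW h0.
have bn0 : 0 < b ^+ n by rewrite exprn_gt0.
have t0 : 0 < h * b ^+ n by rewrite mulr_gt0.
have c0 : 0 <= corr0 N p by rewrite (le_trans ler01)// corr0_ge1.
have -> : (fun l => (riemann h l - riemann h (take n l)) ^+ 2)
  = (fun l => \sum_i \sum_j h ^+ 2 * (incr n i l * incr n j l)).
  apply/funext => l; rewrite /riemann -mulrBr -sumrB exprMn [X in _ * X]expr2 mulr_suml mulr_sumr.
  by apply: eq_bigr => i _; rewrite !mulr_sumr.
rewrite iter_mean_sum.
under eq_bigr do rewrite iter_mean_sum.
apply: (@le_trans _ _ (\sum_(i < m.+1) \sum_(j < m.+1) h ^+ 2 *
   (corr0 N p ^+ n.+1 * expR (- (h * b ^+ n * `|i%:R - j%:R|))))).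
  apply: ler_sum => i _; apply: ler_sum => j _; rewrite iter_meanZ ler_wpM2l ?sqr_ge0//.
  exact: iter_mean_incr.
rewrite (_ : \sum_i _ = h ^+ 2 * corr0 N p ^+ n.+1 *
  \sum_(i < m.+1) \sum_(j < m.+1) expR (- (h * b ^+ n * `|i%:R - j%:R|))); last first.
  by rewrite mulr_sumr; apply: eq_bigr => i _; rewrite mulr_sumr; apply: eq_bigr => j _; rewrite mulrA.
apply: (@le_trans _ _ (h ^+ 2 * corr0 N p ^+ n.+1 * (m.+1%:R * (2 * (1 + (h * b ^+ n)^-1))))).
  apply: ler_wpM2l; last exact: (exp_dist_sum t0).
  by apply: mulr_ge0; apply: exprn_ge0.
rewrite le_eqVlt; apply/orP; left; apply/eqP.
have hn : h != 0 by rewrite gt_eqF.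
have bn : b ^+ n != 0 by rewrite gt_eqF.
move: (b ^+ n) bn => B Bn.
by field; rewrite hn Bn.
Qed.

Definition lam_max : R := lam N.
Definition lam_min : R := lam 0.

Lemma lam_le i j : (i <= j)%N -> lam i <= lam j.
Proof. by move=> ij; rewrite ler_expR lerD2r ler_nat. Qed.

Lemma lam_bounds (i : 'I_N.+1) : lam_min <= lam i <= lam_max.
Proof. by rewrite !lam_le// -ltnS. Qed.

(** [sup_lam] and [inf_lam] bound the first level on the whole window. They coincide when there is
    no jump, so the crude extremes are paid for only on an event of probability of the order of the
    length. *)
Definition sup_lam (x : cfg) := if jumps x then lam_max else lam (thead x).
Definition inf_lam (x : cfg) := if jumps x then lam_min else lam (thead x).

Lemma no_jumps (x : cfg) i : ~~ jumps x -> tnth x i = thead x.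
Proof. by rewrite negb_exists => /forallP/(_ i); rewrite negbK => /eqP. Qed.

Lemma sup_lamP (x : cfg) i : lam (tnth x i) <= sup_lam x.
Proof.
rewrite /sup_lam; case: ifPn => [_|/no_jumps->//].
by case/andP: (lam_bounds (tnth x i)).
Qed.

Lemma inf_lamP (x : cfg) i : inf_lam x <= lam (tnth x i).
Proof.
rewrite /inf_lam; case: ifPn => [_|/no_jumps->//].
by case/andP: (lam_bounds (tnth x i)).
Qed.

Lemma sup_lam_ge (x : cfg) : lam_min <= sup_lam x.
Proof. by have [] := andP (lam_bounds (thead x)) => /le_trans + _; apply; exact: sup_lamP. Qed.

Lemma inf_lam_le (x : cfg) : inf_lam x <= lam_max.
Proof. by have [] := andP (lam_bounds (thead x)) => _; apply: le_trans; exact: inf_lamP. Qed.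

Lemma inf_lam_ge (x : cfg) : lam_min <= inf_lam x.
Proof. by rewrite /inf_lam; case: ifP => // _; have [] := andP (lam_bounds (thead x)). Qed.

Lemma lam_min_gt0 : 0 < lam_min. Proof. exact: lam_gt0. Qed.
Lemma lam_max_gt0 : 0 < lam_max. Proof. exact: lam_gt0. Qed.

Lemma powR_div (x q : R) : 0 <= x -> (x / b) `^ q = b `^ (- q) * x `^ q.
Proof.
move=> x0; rewrite powRM ?invr_ge0 ?(ltW b0)// mulrC -powR_inv1 ?(ltW b0)//.
by rewrite -powRrM mulN1r.
Qed.

(** * Removing one level from a truncated moment *)

Section Power.
Variable q : R.
Hypothesis q0 : 0 < q.

Let jump_cost := lam_max `^ q * sojourn_const N p.

Lemma mean_sup_lam h : 0 <= h ->
  mean h (fun x => sup_lam x `^ q) <= lam_moment N p q + jump_cost * (h * m.+1%:R).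
Proof.
move=> h0.
apply: (@le_trans _ _ (mean h (fun x => lam (thead x) `^ q + lam_max `^ q * (jumps x)%:R))).
  apply: (sample_mean_le HY h0) => x; rewrite /sup_lam; case: ifP => _.
    by rewrite mulr1 lerDr powR_ge0.
  by rewrite mulr0 addr0.
rewrite sample_meanD sample_meanZ (sample_mean1 HY h0 ord0 (fun i => lam i `^ q)).
rewrite lerD2l /jump_cost -mulrA ler_wpM2l ?powR_ge0//.
apply: (le_trans (sample_mean_jumps p01 HY m h0)).
rewrite ler_wpM2l ?(le_trans ler01 (jump_const_ge1 _ _))//.
by rewrite mulrC ler_wpM2l// ler_nat.
Qed.

(** The second entry of the maximum is sharp for short windows but may be negative for long ones,
    where the first keeps the bound positive. *)
Lemma mean_inf_lam h : 0 <= h ->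
  Num.max (lam_min `^ q) (lam_moment N p q - jump_cost * (h * m.+1%:R))
  <= mean h (fun x => inf_lam x `^ q).
Proof.
move=> h0; rewrite ge_max; apply/andP; split.
  have one : mean h (fun=> 1) = 1.
    by rewrite (sample_mean1 HY h0 ord0 (fun=> 1)); under eq_bigr do rewrite mulr1; rewrite pmf_sum.
  rewrite -[leLHS]mulr1 -one -sample_meanZ; apply: (sample_mean_le HY h0) => x.
  rewrite mulr1; apply: ge0_ler_powR; rewrite ?nnegrE ?inf_lam_ge ?(ltW q0)//.
    exact: ltW lam_min_gt0.
  exact: le_trans (ltW lam_min_gt0) (inf_lam_ge x).
apply: (@le_trans _ _ (mean h (fun x => lam (thead x) `^ q + - lam_max `^ q * (jumps x)%:R))).
  rewrite sample_meanD sample_meanZ (sample_mean1 HY h0 ord0 (fun i => lam i `^ q)).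
  rewrite lerD2l mulNr lerN2 -mulrA ler_wpM2l ?powR_ge0//.
  apply: (le_trans (sample_mean_jumps p01 HY m h0)).
  rewrite ler_wpM2l ?(le_trans ler01 (jump_const_ge1 _ _))//.
  by rewrite mulrC ler_wpM2l// ler_nat.
apply: (sample_mean_le HY h0) => x; rewrite /inf_lam; case: ifP => _.
  rewrite mulr1; apply: (@le_trans _ _ 0); last exact: powR_ge0.
  rewrite subr_le0; apply: ge0_ler_powR; rewrite ?nnegrE ?(ltW q0) ?(ltW lam_max_gt0)//.
    by rewrite ltW// lam_gt0.
  by case/andP: (lam_bounds (thead x)).
by rewrite mulr0 addr0.
Qed.

Definition trunc_pow (M y : R) : R := Num.min `|y| M `^ q.

Lemma trunc_pow_ge0 M y : 0 <= trunc_pow M y. Proof. exact: powR_ge0. Qed.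

Lemma trunc_pow_mono M y y' : 0 <= M -> 0 <= y <= y' -> trunc_pow M y <= trunc_pow M y'.
Proof.
move=> M0 /andP[y0 yy']; have y'0 := le_trans y0 yy'.
rewrite /trunc_pow !ger0_norm//; apply: ge0_ler_powR; rewrite ?nnegrE ?(ltW q0)//.
- by rewrite le_min y0.
- by rewrite le_min y'0.
- by rewrite le_min !ge_min yy' lexx orbT.
Qed.

(** Truncation is not homogeneous: extracting a factor [z] turns the level [M] into [M / z]. Here
    any larger level serves; in [trunc_powM_ge] any smaller one. *)
Lemma trunc_powM M M' z y : 0 < z -> 0 <= M' -> M <= z * M' -> 0 <= y -> 0 <= M ->
  trunc_pow M (z * y) <= z `^ q * trunc_pow M' y.
Proof.
move=> z0 M'0 MM' y0 M0; have z0' := ltW z0.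
rewrite /trunc_pow !ger0_norm ?mulr_ge0// -powRM ?le_min ?y0//.
apply: ge0_ler_powR; rewrite ?nnegrE ?(ltW q0)//.
- by rewrite le_min mulr_ge0.
- by rewrite mulr_ge0// le_min y0.
- by rewrite minr_pMr// le_min !ge_min lexx MM' orbT.
Qed.

Lemma trunc_powM_ge M M' z y : 0 < z -> 0 <= M' -> z * M' <= M -> 0 <= y ->
  z `^ q * trunc_pow M' y <= trunc_pow M (z * y).
Proof.
move=> z0 M'0 MM' y0; have z0' := ltW z0.
rewrite /trunc_pow !ger0_norm ?mulr_ge0// -powRM ?le_min ?y0//.
apply: ge0_ler_powR; rewrite ?nnegrE ?(ltW q0)//.
- by rewrite mulr_ge0// le_min y0.
- by rewrite le_min mulr_ge0//= (le_trans _ MM')// mulr_ge0.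
- by rewrite minr_pMr// le_min !ge_min lexx MM' orbT.
Qed.

Lemma riemann_cons h x l : riemann h (x :: l) = h * \sum_i lam (tnth x i) * lamprod i l.
Proof. by congr (_ * _); apply: eq_bigr => i _; rewrite lamprod_cons. Qed.

(** The remaining levels are summed with step [h * b], and dividing by [b] restores the step [h]. *)
Let riemann_scale h z l : z / b * riemann (h * b) l = h * \sum_i z * lamprod i l.
Proof.
rewrite -mulr_sumr /riemann; have bn : b != 0 by rewrite gt_eqF.
by field.
Qed.

Lemma riemann_cons_le h x l : 0 <= h ->
  riemann h (x :: l) <= sup_lam x / b * riemann (h * b) l.
Proof.
move=> h0; rewrite riemann_cons riemann_scale ler_wpM2l//.
by apply: ler_sum => i _; rewrite ler_wpM2r ?sup_lamP// ltW// lamprod_gt0.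
Qed.

Lemma riemann_cons_ge h x l : 0 <= h ->
  inf_lam x / b * riemann (h * b) l <= riemann h (x :: l).
Proof.
move=> h0; rewrite riemann_cons riemann_scale ler_wpM2l//.
by apply: ler_sum => i _; rewrite ler_wpM2r ?inf_lamP// ltW// lamprod_gt0.
Qed.

(** The new level must not depend on the first configuration; [M * b / lam_min] is the worst case of
    [M * b / sup_lam x]. The lower bound uses [lam_max] in the same way. *)
Lemma iter_mean_trunc_le n h M : 0 <= h -> 0 <= M ->
  iter_mean n.+1 h (fun l => trunc_pow M (riemann h l)) <=
  b `^ (- q) * (lam_moment N p q + jump_cost * (h * m.+1%:R)) *
  iter_mean n (h * b) (fun l => trunc_pow (M * b / lam_min) (riemann (h * b) l)).
Proof.
move=> h0 M0; have hb0 : 0 <= h * b by rewrite mulr_ge0// ltW.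
set I := iter_mean n _ _; have I0 : 0 <= I.
  by apply: iter_mean_ge0 => // l; exact: trunc_pow_ge0.
have lm0 := lam_min_gt0.
have M'0 : 0 <= M * b / lam_min.
  by apply: divr_ge0; [apply: mulr_ge0|]; rewrite ?(ltW b0) ?(ltW lm0).
rewrite iter_meanS.
apply: (@le_trans _ _ (mean h (fun x => b `^ (- q) * I * (sup_lam x `^ q)))).
  apply: (sample_mean_le HY h0) => x.
  have s0 : 0 < sup_lam x by exact: lt_le_trans lm0 (sup_lam_ge x).
  have z0 : 0 < sup_lam x / b by rewrite divr_gt0.
  rewrite mulrAC -powR_div ?(ltW s0)// -iter_meanZ; apply: le_iter_mean => // l _.
  have r0 : 0 <= riemann (h * b) l by exact: riemann_ge0.
  apply: le_trans (trunc_powM z0 M'0 _ r0 M0); last first.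
    have -> : sup_lam x / b * (M * b / lam_min) = M * (sup_lam x / lam_min).
      by field; rewrite !gt_eqF.
    by rewrite ler_peMr// ler_pdivlMr// mul1r sup_lam_ge.
  apply: trunc_pow_mono => //; rewrite riemann_ge0//=.
  exact: riemann_cons_le.
rewrite sample_meanZ -mulrA [I * _]mulrC mulrA ler_wpM2r// ler_wpM2l ?powR_ge0//.
exact: mean_sup_lam.
Qed.

Lemma iter_mean_trunc_ge n h M : 0 <= h -> 0 <= M ->
  b `^ (- q) * Num.max (lam_min `^ q) (lam_moment N p q - jump_cost * (h * m.+1%:R)) *
  iter_mean n (h * b) (fun l => trunc_pow M (riemann (h * b) l)) <=
  iter_mean n.+1 h (fun l => trunc_pow (M * lam_max / b) (riemann h l)).
Proof.
move=> h0 M0; have hb0 : 0 <= h * b by rewrite mulr_ge0// ltW.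
set I := iter_mean n _ _; have I0 : 0 <= I.
  by apply: iter_mean_ge0 => // l; exact: trunc_pow_ge0.
have lm0 := lam_min_gt0; have lM0 := lam_max_gt0.
have M'0 : 0 <= M * lam_max / b.
  by apply: divr_ge0; [apply: mulr_ge0|]; rewrite ?(ltW b0) ?(ltW lM0).
rewrite iter_meanS.
apply: (@le_trans _ _ (mean h (fun x => b `^ (- q) * I * (inf_lam x `^ q)))).
  rewrite sample_meanZ [leLHS]mulrAC; apply: ler_wpM2l; last exact: mean_inf_lam.
  by apply: mulr_ge0 => //; exact: powR_ge0.
apply: (sample_mean_le HY h0) => x.
have s0 : 0 < inf_lam x by exact: lt_le_trans lm0 (inf_lam_ge x).
have z0 : 0 < inf_lam x / b by rewrite divr_gt0.
rewrite mulrAC -powR_div ?(ltW s0)// -iter_meanZ; apply: le_iter_mean => // l _.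
have r0 : 0 <= riemann (h * b) l by exact: riemann_ge0.
apply: (@le_trans _ _ (trunc_pow (M * lam_max / b) (inf_lam x / b * riemann (h * b) l))).
  apply: trunc_powM_ge => //.
  rewrite mulrC mulrA ler_wpM2r ?invr_ge0 ?(ltW b0)//.
  by rewrite ler_wpM2l// inf_lam_le.
apply: trunc_pow_mono => //; rewrite mulr_ge0 ?(ltW z0)//=.
exact: riemann_cons_ge.
Qed.

End Power.

End DiscreteCascade.

(** * The continuous cascade *)

Section Tonelli.
Context d (T : measurableType d) (R : realType) (P : probability T R).
Local Notation leb := (@lebesgue_measure R).
Local Notation RT := (measurableTypeR R).
Variables (g : RT * T -> R) (D : set RT).
Hypothesis mg : measurable_fun setT g.
Hypothesis g0 : forall z, 0 <= g z.
Hypothesis mD : measurable D.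

(** The restriction to [D] is moved into the integrand, so that Tonelli applies on the full product
    space. *)
Let F (z : RT * T) : \bar R := (g z * \1_D z.1)%:E.

Let mF : measurable_fun setT F.
Proof.
apply/measurable_EFinP; apply: measurable_funM => //.
by apply: measurableT_comp => //; exact: measurable_fst.
Qed.

Let F0 z : (0 <= F z)%E.
Proof. by rewrite lee_fin mulr_ge0// indicE. Qed.

Let FE w : (\int[leb]_(s in D) (g (s, w))%:E = \int[leb]_s F (s, w))%E.
Proof.
rewrite integral_mkcond; apply: eq_integral => s _.
by rewrite patchE /F indicE /=; case: ifP => _; rewrite ?mulr1 ?mulr0.
Qed.

Lemma measurable_integral_section :
  measurable_fun setT (fun w => \int[leb]_(s in D) (g (s, w))%:E)%E.
Proof.
under eq_fun do rewrite FE.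
exact: (@measurable_fun_fubini_tonelli_G _ _ _ _ _ leb F mF F0).
Qed.

Lemma tonelli_set :
  (\int[P]_w \int[leb]_(s in D) (g (s, w))%:E = \int[leb]_(s in D) \int[P]_w (g (s, w))%:E)%E.
Proof.
under eq_integral do rewrite FE.
rewrite -(@fubini_tonelli _ _ _ _ _ leb P F mF F0).
rewrite [RHS]integral_mkcond; apply: eq_integral => s _.
rewrite patchE; case: ifPn => sD.
  by apply: eq_integral => w _; rewrite /F indicE /= sD mulr1.
by rewrite [LHS]integral0_eq// => w _; rewrite /F indicE /= (negbTE sD) mulr0.
Qed.

End Tonelli.

(** Powers are [exp(q ln u)], which yields continuity away from 0 only; for the limit 0 the
    threshold is [e] to the power [1 / q]. *)
Lemma cvg_powR (R : realType) (q : R) (u : nat -> R) (l : R) : 0 < q ->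
  (forall n, 0 <= u n) -> 0 <= l -> u @ \oo --> l ->
  (fun n => u n `^ q) @ \oo --> l `^ q.
Proof.
move=> q0 u0; rewrite le_eqVlt => /predU1P[<-|l0] ul.
  rewrite powR0 ?gt_eqF//; apply/cvgr0Pnorm_lt => e e0.
  have e'0 : 0 < e `^ q^-1 by rewrite powR_gt0.
  move/cvgr0Pnorm_lt: ul => /(_ _ e'0); apply: filterS => n.
  rewrite !ger0_norm ?powR_ge0// => un.
  have -> : e = (e `^ q^-1) `^ q by rewrite -powRrM mulVf ?gt_eqF// powRr1// ltW.
  by apply: gt0_ltr_powR => //; rewrite nnegrE// ltW.
have H : (fun n => expR (q * ln (u n))) @ \oo --> expR (q * ln l).
  apply: continuous_cvg; first exact: continuous_expR.
  apply: cvgMr; apply: continuous_cvg => //; exact: continuous_ln.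
rewrite {2}/powR gt_eqF//; apply: cvg_trans H; apply: near_eq_cvg.
have : \forall n \near \oo, 0 < u n by exact: (cvgr_gt l ul _ l0).
apply: filterS => n un.
by rewrite /powR gt_eqF.
Qed.

Section Cascade.
Variables (R : realType) (N : nat) (p b : R).
Hypothesis p01 : 0 < p < 1.
Hypothesis b1 : 1 < b.
Context d (T : measurableType d) (P : probability T R) (X : nat -> R -> T -> R).
Hypothesis HX : forall j, stationary_birth_death P N p (X j).
Hypothesis HI : independent_processes P X.
Local Notation leb := (@lebesgue_measure R).
Local Notation lam := (lam N p).
Local Notation lam_max := (lam_max N p).
Local Notation J := (sojourn_const N p).

Let b0 : 0 < b. Proof. exact: lt_trans b1. Qed.

(* [n] factors, whereas [cascade_density X c b n] has [n.+1]. *)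
Definition dens n s w : R := \prod_(j < n) expR (X j (s * b ^+ j) w - cX N p).

Lemma densE n s w : dens n s w = \prod_(j < n) lam (state_at N (X j) (s * b ^+ j) w).
Proof. by apply: eq_bigr => j _; rewrite (state_atE (HX j)). Qed.

Lemma dens_ge0 n s w : 0 <= dens n s w.
Proof. by apply: prodr_ge0 => j _; exact: expR_ge0. Qed.

Lemma dens_le n s w : dens n s w <= lam_max ^+ n.
Proof.
rewrite densE; apply: (@le_trans _ _ (\prod_(j < n) lam_max)).
  apply: ler_prod => j _; rewrite ltW ?lam_gt0//=.
  by case/andP: (lam_bounds p (state_at N (X j) (s * b ^+ j) w)).
by rewrite prodr_const card_ord.
Qed.

Lemma measurable_dens n : measurable_fun setT (fun z : R * T => dens n z.1 z.2).
Proof.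
apply: measurable_prod => j _; apply: measurableT_comp => //.
apply: measurable_funB => //.
have [_ mX _] := HX j.
have m1 : measurable_fun setT (fun z : R * T => (z.1 * b ^+ j, z.2)).
  apply: measurable_fun_pair; last exact: measurable_snd.
  by apply: measurable_funM => //; exact: measurable_fst.
exact: (measurableT_comp mX m1).
Qed.

Lemma measurable_dens_time n w : measurable_fun setT (fun s => dens n s w).
Proof. exact: (measurable_fun_pair1 w (measurable_dens n)). Qed.

Lemma measurable_dens_space n s : measurable_fun setT (fun w => dens n s w).
Proof. exact: (measurable_fun_pair2 s (measurable_dens n)). Qed.

Lemma lebesgue_itv_lty (x y : R) : (leb `[x, y]%classic < +oo)%E.
Proof. by rewrite lebesgue_measure_itv/=; case: ifP => _; rewrite ltry. Qed.

Lemma lebesgue_itvD (a t : R) : 0 <= t -> leb `[a, a + t]%classic = t%:E.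
Proof.
move=> t0; rewrite lebesgue_measure_itv/= lte_fin; case: ltP => [_|].
  by rewrite -EFinB addrAC subrr add0r.
by rewrite gerDl => t0'; congr EFin; apply/eqP; rewrite eq_le t0 t0'.
Qed.

Lemma integrable_dens n w (x y : R) :
  leb.-integrable `[x, y]%classic (fun s => (dens n s w)%:E).
Proof.
apply: (@measurable_bounded_integrable _ _ _ leb (fun s => dens n s w)) => //.
- exact: lebesgue_itv_lty.
- by apply: measurable_funTS; exact: measurable_dens_time.
- exists (lam_max ^+ n); split => [|M lM s _]; first exact: num_real.
  by rewrite /= ger0_norm ?dens_ge0// (le_trans (dens_le _ _ _))// ltW.
Qed.

Lemma integrable_cst_itv (c x y : R) : leb.-integrable `[x, y]%classic (fun=> c%:E).
Proof.
apply: (@measurable_bounded_integrable _ _ _ leb (fun=> c)) => //.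
- exact: lebesgue_itv_lty.
- exists `|c|; split => [|M lM s _]; first exact: num_real.
  by rewrite /= ltW.
Qed.

Definition cA n (a t : R) w : R := \int[leb]_(s in `[a, a + t]%classic) dens n s w.

Lemma cascade_AE n t w : cascade_A X (cX N p) b n t w = cA n.+1 0 t w.
Proof. by rewrite /cA add0r. Qed.

Lemma cAE n a t w : ((cA n a t w)%:E = \int[leb]_(s in `[a, (a + t)%R]) (dens n s w)%:E)%E.
Proof.
rewrite /cA /Rintegral fineK//; apply: integrable_fin_num => //.
exact: integrable_dens.
Qed.

Lemma measurable_cA n a t : measurable_fun setT (cA n a t).
Proof.
apply: measurableT_comp; first exact: fine_measurable.
apply: (@measurable_integral_section _ _ _ (fun z => dens n z.1 z.2)).
- exact: measurable_dens.
- by move=> z; exact: dens_ge0.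
- by [].
Qed.

Lemma cA_ge0 n a t w : 0 <= cA n a t w.
Proof. by apply: Rintegral_ge0 => s _; exact: dens_ge0. Qed.

Lemma cA_le n a t w : 0 <= t -> cA n a t w <= lam_max ^+ n * t.
Proof.
move=> t0; rewrite -lee_fin cAE.
have H : (\int[leb]_(s in `[a, (a + t)%R]) (dens n s w)%:E
    <= \int[leb]_(s in `[a, (a + t)%R]) (lam_max ^+ n)%:E)%E.
  apply: ge0_le_integral => //.
  - by move=> s _; rewrite lee_fin dens_ge0.
  - by apply/measurable_EFinP; apply: measurable_funTS; exact: measurable_dens_time.
  - by move=> s _; rewrite lee_fin dens_le.
apply: (le_trans H).
by rewrite integral_cst// [X in (_ * X)%E]lebesgue_itvD.
Qed.

Lemma cAD n a t t' w : 0 <= t -> 0 <= t' ->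
  cA n a (t + t') w = cA n a t w + cA n (a + t) t' w.
Proof.
move=> t0 t'0.
have at' : a + t <= a + (t + t') by rewrite addrA lerDl.
have aat : a <= a + t by rewrite lerDl.
have := @Rintegral_itvB R (fun s => dens n s w) (BLeft a) (BRight (a + (t + t'))) (a + t).
move=> /(_ (integrable_dens _ _ _ _)); rewrite !bnd_simp => /(_ aat at').
rewrite Rintegral_itv_obnd_cbnd; last first.
  apply: integrableS (integrable_dens n w (a + t) (a + (t + t'))) => //.
  exact: subset_itv_oc_cc.
by rewrite /cA -addrA => <-; ring.
Qed.

Definition lip n := lam_max ^+ n * (\sum_(j < n) J * b ^+ j).

Lemma measurable_state_neq j s s' : measurable_fun setT
  (fun w => (state_at N (X j) s w != state_at N (X j) s' w)%:R : R).
Proof.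
pose Z w := (state_at N (X j) s w, state_at N (X j) s' w).
have mZ ij : measurable [set w | Z w = ij].
  rewrite (_ : [set w | _] = [set w | state_at N (X j) s w = ij.1]
     `&` [set w | state_at N (X j) s' w = ij.2]).
    by apply: measurableI; exact: measurable_state (HX j) _ _.
  by apply/seteqP; split=> w /=; rewrite /Z; case: ij => i k /=; [case|case=> -> ->].
exact: (measurable_finite mZ (fun ij => (ij.1 != ij.2)%:R)).
Qed.

(** Paths jump, but are Lipschitz in mean: the density changes only if one of the [n] levels does.
    Level [j] has probability at most [J * b ^+ j * h] of doing so, and the change is at most
    [lam_max ^+ n]. *)
Lemma dens_lip n s h : 0 <= s -> 0 <= h ->
  (\int[P]_w (`|dens n (s + h) w - dens n s w|)%:E <= (lip n * h)%:E)%E.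
Proof.
move=> s0 h0.
pose f w (j : 'I_n) := (state_at N (X j) (s * b ^+ j) w
  != state_at N (X j) (s * b ^+ j + h * b ^+ j) w).
have bj0 (j : 'I_n) : 0 <= b ^+ j by rewrite exprn_ge0// ltW.
have LM0 : 0 <= lam_max ^+ n by rewrite exprn_ge0// ltW// lam_max_gt0.
have pw w : `|dens n (s + h) w - dens n s w| <= lam_max ^+ n * \sum_j (f w j)%:R.
  have [/existsP[j fj]|/existsPn H] := boolP [exists j, f w j].
    apply: (@le_trans _ _ (lam_max ^+ n)).
      have := dens_ge0 n s w; have := dens_ge0 n (s + h) w.
      have := dens_le n s w; have := dens_le n (s + h) w.
      by rewrite ler_norml; move: (dens _ _ _) (dens _ _ _) => x y; lra.
    by rewrite ler_peMr// (bigD1 j) //= fj lerDl sumr_ge0.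
  rewrite [X in `|X|](_ : _ = 0); first by rewrite normr0 mulr_ge0// sumr_ge0.
  apply/eqP; rewrite subr_eq0 !densE; apply/eqP; apply: eq_bigr => j _.
  by have := H j; rewrite negbK mulrDl => /eqP ->.
have mf (j : 'I_n) : measurable_fun setT (fun w => (f w j)%:R : R).
  exact: measurable_state_neq.
apply: (@le_trans _ _ (\int[P]_w ((lam_max ^+ n)%:E * \sum_j ((f w j)%:R)%:E))%E).
  apply: ge0_le_integral => //.
  - apply/measurable_EFinP; apply: measurableT_comp => //.
    by apply: measurable_funB; exact: measurable_dens_space.
  - apply: measurable_funeM; apply: emeasurable_sum => j.
    by apply/measurable_EFinP; exact: mf.
  - by move=> w _; rewrite sumEFin -EFinM lee_fin pw.
rewrite ge0_integralZl_EFin//; last 2 first.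
- by move=> w _; apply: sume_ge0 => j _; rewrite lee_fin.
- by apply: emeasurable_sum => j; apply/measurable_EFinP; exact: mf.
rewrite ge0_integral_sum//; last by move=> j; apply/measurable_EFinP; exact: mf.
rewrite /lip -mulrA EFinM lee_wpmul2l//.
rewrite mulr_suml -sumEFin; apply: lee_sum => j _.
rewrite -mulrA [b ^+ j * h]mulrC.
by apply: (integral_jump p01 (HX j)); rewrite mulr_ge0.
Qed.

Lemma lip_ge0 n : 0 <= lip n.
Proof.
apply: mulr_ge0; first by rewrite exprn_ge0// ltW// lam_max_gt0.
apply: sumr_ge0 => j _; apply: mulr_ge0; last by rewrite exprn_ge0// ltW.
exact: le_trans (jump_const_ge1 _ _).
Qed.

Lemma cA_local n a h : 0 <= a -> 0 <= h ->
  (\int[P]_w (`|cA n a h w - h * dens n a w|)%:E <= (lip n * h ^+ 2)%:E)%E.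
Proof.
move=> a0 h0; set D := `[a, a + h]%classic.
pose g (z : R * T) := `|dens n z.1 z.2 - dens n a z.2|.
have mg : measurable_fun setT g.
  apply: measurableT_comp => //; apply: measurable_funB; first exact: measurable_dens.
  apply: (measurableT_comp (measurable_dens_space n a)); exact: measurable_snd.
have g0 z : 0 <= g z by exact: normr_ge0.
have iB w : leb.-integrable D (fun s => (dens n s w - dens n a w)%:E).
  under eq_fun do rewrite EFinB; apply: integrableB => //.
  - exact: measurable_itv.
  - exact: integrable_dens.
  - exact: integrable_cst_itv.
have mD : measurable D by exact: measurable_itv.
have pw w : ((`|cA n a h w - h * dens n a w|)%:E <= \int[leb]_(s in D) (g (s, w))%:E)%E.
  have -> : cA n a h w - h * dens n a w = \int[leb]_(s in D) (dens n s w - dens n a w).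
    rewrite RintegralB//; [|exact: integrable_dens|exact: integrable_cst_itv].
    by rewrite Rintegral_cst// [X in _ * fine X]lebesgue_itvD// /cA mulrC.
  rewrite /Rintegral -abse_EFin fineK; last exact: integrable_fin_num.
  by apply: le_abse_integral => //; exact: measurable_int (iB w).
have mG := measurable_integral_section mg g0 mD.
apply: (@le_trans _ _ (\int[P]_w \int[leb]_(s in D) (g (s, w))%:E)%E).
  apply: ge0_le_integral => //.
  apply/measurable_EFinP; apply: measurableT_comp => //; apply: measurable_funB;
    [exact: measurable_cA|by apply: measurable_funM => //; exact: measurable_dens_space].
rewrite (tonelli_set P mg g0)//.
have H : (\int[leb]_(s in D) \int[P]_w (g (s, w))%:E <= \int[leb]_(s in D) (lip n * h)%:E)%E.
  apply: ge0_le_integral => //.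
  - by move=> s _; apply: integral_ge0 => w _; rewrite lee_fin.
  - apply: measurable_funTS.
    have mF : measurable_fun setT (fun z : measurableTypeR R * T => (g z)%:E).
      by apply/measurable_EFinP.
    exact: (@measurable_fun_fubini_tonelli_F _ _ _ _ _ P _ mF).
  - move=> s; rewrite /D /= in_itv/= => /andP[as_ sah].
    rewrite /g /= -(subrK a s) addrC.
    apply: (le_trans (dens_lip _ _ _)) => //; first by rewrite subr_ge0.
    by rewrite lee_fin ler_wpM2l ?lip_ge0// lerBlDl.
apply: (le_trans H).
by rewrite integral_cst// [X in (_ * X)%E]lebesgue_itvD// -EFinM lee_fin -mulrA.
Qed.

Definition dsum n (a h : R) M w := h * \sum_(i < M) dens n (a + i%:R * h) w.

Lemma measurable_dsum n a h M : measurable_fun setT (dsum n a h M).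
Proof.
by apply: measurable_funM => //; apply: measurable_sum => i; exact: measurable_dens_space.
Qed.

(** The errors of order [h ^+ 2] of the cells add up. For a fixed length [M h] the total is of order
    [h]. *)
Lemma cA_dsum n a h M : 0 <= a -> 0 <= h ->
  (\int[P]_w (`|cA n a (M%:R * h) w - dsum n a h M w|)%:E <= (M%:R * (lip n * h ^+ 2))%:E)%E.
Proof.
move=> a0 h0; elim: M => [|M IH].
  have z w : cA n a 0 w - dsum n a h 0 w = 0.
    apply/eqP; rewrite /dsum big_ord0 mulr0 subr0 eq_le cA_ge0 andbT.
    by have := cA_le n a w (lexx 0); rewrite mulr0.
  rewrite !mul0r; under eq_integral do rewrite z normr0.
  by rewrite integral0.
have Mh0 : 0 <= M%:R * h by rewrite mulr_ge0.
have aMh0 : 0 <= a + M%:R * h by rewrite addr_ge0.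
pose u w := cA n a (M%:R * h) w - dsum n a h M w.
pose v w := cA n (a + M%:R * h) h w - h * dens n (a + M%:R * h) w.
have mu' : measurable_fun setT u.
  by apply: measurable_funB; [exact: measurable_cA|exact: measurable_dsum].
have mv : measurable_fun setT v.
  apply: measurable_funB; first exact: measurable_cA.
  by apply: measurable_funM => //; exact: measurable_dens_space.
have uv w : cA n a (M.+1%:R * h) w - dsum n a h M.+1 w = u w + v w.
  rewrite -natr1 mulrDl mul1r cAD// /dsum big_ord_recr /= mulrDr /u /v /dsum.
  ring.
apply: (@le_trans _ _ (\int[P]_w ((`|u w|)%:E + (`|v w|)%:E))%E).
  apply: ge0_le_integral => //.
  - apply/measurable_EFinP; apply: measurableT_comp => //.
    by apply: measurable_funB; [exact: measurable_cA|exact: measurable_dsum].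
  - by apply: emeasurable_funD; apply/measurable_EFinP; apply: measurableT_comp.
  - by move=> w _; rewrite -EFinD lee_fin uv ler_normD.
rewrite ge0_integralD//; [|by apply/measurable_EFinP; apply: measurableT_comp..].
rewrite -natr1 mulrDl mul1r EFinD leeD//.
exact: cA_local.
Qed.

End Cascade.

(** * From Riemann sums to integrals *)

Section RiemannLimit.
Variables (R : realType) (N : nat) (p b : R).
Hypothesis p01 : 0 < p < 1.
Hypothesis b1 : 1 < b.
Context d (T : measurableType d) (P : probability T R) (X : nat -> R -> T -> R).
Hypothesis HX : forall j, stationary_birth_death P N p (X j).
Hypothesis HI : independent_processes P X.
Local Notation lam_max := (lam_max N p).
Local Notation lam_min := (lam_min N p).
Local Notation J := (sojourn_const N p).
Local Notation cA := (cA N p b X).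
Local Notation dens := (dens N p b X).
Local Notation dsum := (dsum N p b X).

Let b0 : 0 < b. Proof. exact: lt_trans b1. Qed.

(** Configurations have one more point than their parameter; the predecessor gives exactly [2 ^ l]
    cells. *)
Definition mesh l := (2 ^ l).-1%N.
Definition riemann_sum n l (a t : R) w : R :=
  riemann p (t / 2 ^+ l) (samples N b (mesh l) X n a (t / 2 ^+ l) w).

Lemma meshS l : (mesh l).+1 = (2 ^ l)%N.
Proof. by rewrite prednK// expn_gt0. Qed.

Lemma step_mesh l (t : R) : t / 2 ^+ l * (mesh l).+1%:R = t.
Proof. by rewrite meshS natrX divfK// expf_neq0. Qed.

Lemma lamprod_samples m n a h w (i : 'I_m.+1) :
  lamprod p i (samples N b m X n a h w) = dens n (a + i%:R * h) w.
Proof.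
rewrite /lamprod (densE _ HX) big_tuple; apply: eq_bigr => j _.
by rewrite !tnth_mktuple mulrDl mulrA.
Qed.

Lemma riemann_sumE n l a t w : riemann_sum n l a t w = dsum n a (t / 2 ^+ l) (2 ^ l) w.
Proof.
rewrite /riemann_sum /riemann /dsum -meshS; congr (_ * _).
by apply: eq_bigr => i _; rewrite lamprod_samples.
Qed.

Lemma take_samples m n a h w : take n (samples N b m X n.+1 a h w) = samples N b m X n a h w.
Proof.
apply: (@eq_from_nth _ [tuple ord0 | _ < m.+1]) => [|j].
  by rewrite size_take !size_tuple ltnSn.
rewrite size_take !size_tuple ltnSn => jn; rewrite nth_take//.
have jn1 : (j < n.+1)%N by exact: ltnW.
transitivity (tnth (samples N b m X n.+1 a h w) (Ordinal jn1)).
  by rewrite (tnth_nth [tuple ord0 | _ < m.+1]).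
transitivity (tnth (samples N b m X n a h w) (Ordinal jn)).
  by rewrite !tnth_mktuple.
by rewrite (tnth_nth [tuple ord0 | _ < m.+1]).
Qed.

Lemma measurable_riemann_sum n l a t : measurable_fun setT (riemann_sum n l a t).
Proof. exact: (measurable_of_samples b HX n a _ (riemann p (t / 2 ^+ l))). Qed.

Lemma step_ge0 l (t : R) : 0 <= t -> 0 <= t / 2 ^+ l.
Proof. by move=> t0; rewrite divr_ge0// exprn_ge0. Qed.

Lemma riemann_sum_ge0 n l a t w : 0 <= t -> 0 <= riemann_sum n l a t w.
Proof. by move=> t0; apply: riemann_ge0; exact: step_ge0. Qed.

Lemma riemann_sum_le n l a t w : 0 <= t -> riemann_sum n l a t w <= lam_max ^+ n * t.
Proof.
move=> t0; rewrite riemann_sumE /dsum.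
apply: (@le_trans _ _ (t / 2 ^+ l * \sum_(i < 2 ^ l) lam_max ^+ n)).
  rewrite ler_wpM2l ?step_ge0//; apply: ler_sum => i _; exact: (dens_le b HX).
by rewrite sumr_const card_ord -meshS -[X in _ * X <= _]mulr_natr mulrCA step_mesh.
Qed.

(** Halving the mesh makes the mean error geometric in [l], which upgrades convergence in mean to
    almost sure convergence. *)
Lemma riemann_sum_cvg n a t : 0 <= a -> 0 <= t ->
  {ae P, forall w, (fun l => riemann_sum n l a t w) @ \oo --> cA n a t w}.
Proof.
move=> a0 t0.
have L0 := lip_ge0 N p b1 n.
have C0 : 0 <= lip N p b n * t ^+ 2 by rewrite mulr_ge0// sqr_ge0.
have half : 0 <= (2^-1 : R) < 1 by rewrite invr_ge0 ler0n/= invf_lt1// ltr1n.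
have := @ae_cvg0_geometric _ _ _ P (fun l w => cA n a t w - riemann_sum n l a t w) _ _ C0 half.
case=> [l|l|].
- apply: measurable_funB; first exact: measurable_cA.
  exact: measurable_riemann_sum.
- have tl : 0 <= t / 2 ^+ l by exact: step_ge0.
  have := cA_dsum p01 b1 HX n (2 ^ l) a0 tl.
  rewrite -meshS mulrC step_mesh.
  under eq_integral do rewrite meshS -riemann_sumE.
  move=> /le_trans; apply; rewrite lee_fin le_eqVlt; apply/orP; left; apply/eqP.
  rewrite meshS natrX exprVn.
  have z : (2 : R) ^+ l != 0 by rewrite expf_neq0.
  by field.
- move=> A [mA PA sA]; exists A; split => //; apply: subset_trans sA => w /= H H0; apply: H.
  rewrite -[X in _ --> X](subr0 (cA n a t w)).
  have -> : (fun l => riemann_sum n l a t w) =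
     (fun l => cA n a t w - (cA n a t w - riemann_sum n l a t w)).
    by apply/funext => l; rewrite opprB addrC subrK.
  by apply: cvgB => //; exact: cvg_cst.
Qed.

Lemma integral_riemann_sum n l a t (F : R -> R) : 0 <= a -> 0 <= t ->
  (\int[P]_w (F (riemann_sum n l a t w))%:E)%E =
  (iter_mean p b n (t / 2 ^+ l) (fun x => F (@riemann R N p (mesh l) (t / 2 ^+ l) x)))%:E.
Proof.
move=> a0 t0; rewrite -(integral_samples b0 HX HI n _ a0)//; exact: step_ge0.
Qed.

Lemma cA_mean n a t : 0 <= a -> 0 <= t -> (\int[P]_w (cA n a t w)%:E)%E = t%:E.
Proof.
move=> a0 t0.
have H : (fun l => \int[P]_w (riemann_sum n l a t w)%:E)%E @ \oo --> (\int[P]_w (cA n a t w)%:E)%E.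
  apply: (bounded_cvg_real (M := lam_max ^+ n * t)).
  - by move=> l; exact: measurable_riemann_sum.
  - exact: measurable_cA.
  - exact: riemann_sum_cvg.
  - by move=> l w; rewrite ger0_norm ?riemann_sum_ge0// riemann_sum_le.
have H' : (fun l => \int[P]_w (riemann_sum n l a t w)%:E)%E @ \oo --> t%:E.
  rewrite (_ : (fun l => _) = fun=> t%:E); first exact: cvg_cst.
  apply/funext => l; rewrite (integral_riemann_sum n l id)//.
  by rewrite (iter_mean_riemann _ p01 b0 (HX 0))// ?step_mesh ?step_ge0.
exact: (cvg_unique _ H H').
Qed.

Lemma cA_increment n a t : 0 <= a -> 0 <= t ->
  (\int[P]_w ((cA n.+1 a t w - cA n a t w) ^+ 2)%:E <=
   (corr0 N p ^+ n.+1 * (2 * t * (b ^+ n)^-1))%:E)%E.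
Proof.
(* The discrete estimate requires a positive step, so the empty window is treated apart. *)
move=> a0; rewrite le_eqVlt => /predU1P[<-|t0].
  rewrite mulr0 mul0r mulr0; under eq_integral => w _.
    have -> : cA n.+1 a 0 w = 0.
      by apply/eqP; rewrite eq_le cA_ge0 andbT; have := cA_le b HX n.+1 a w (lexx 0); rewrite mulr0.
    have -> : cA n a 0 w = 0.
      by apply/eqP; rewrite eq_le cA_ge0 andbT; have := cA_le b HX n a w (lexx 0); rewrite mulr0.
    rewrite subrr expr0n/=; over.
  by rewrite integral0.
have t0' := ltW t0.
pose D l w := (riemann_sum n.+1 l a t w - riemann_sum n l a t w) ^+ 2.
have H : (fun l => \int[P]_w (D l w)%:E)%E @ \oo -->
    (\int[P]_w ((cA n.+1 a t w - cA n a t w) ^+ 2)%:E)%E.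
  apply: (bounded_cvg_real (M := (lam_max ^+ n.+1 * t + lam_max ^+ n * t) ^+ 2)).
  - by move=> l; apply: measurable_funX; apply: measurable_funB; exact: measurable_riemann_sum.
  - by apply: measurable_funX; apply: measurable_funB; exact: measurable_cA.
  - have A1 := riemann_sum_cvg n.+1 a0 t0'; have A2 := riemann_sum_cvg n a0 t0'.
    apply: filterS2 A1 A2 => w c1 c2.
    rewrite /D; under eq_fun do rewrite expr2; rewrite expr2.
    by apply: cvgM; apply: cvgB.
  - move=> l w; rewrite ger0_norm ?sqr_ge0// /D -real_normK ?num_real//.
    rewrite lerXn2r ?nnegrE ?addr_ge0 ?(le_trans (riemann_sum_ge0 _ _ a w t0') (riemann_sum_le _ l _ _ t0'))//.
    apply: (le_trans (ler_normB _ _)).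
    by rewrite !ger0_norm ?riemann_sum_ge0// lerD// riemann_sum_le.
have H' : (fun l => (corr0 N p ^+ n.+1 * (2 * t * (t / 2 ^+ l + (b ^+ n)^-1)))%:E) @ \oo -->
   (corr0 N p ^+ n.+1 * (2 * t * (b ^+ n)^-1))%:E.
  apply: cvg_EFin; first exact: nearW.
  apply: cvgMr; apply: cvgMr.
  rewrite -[X in _ --> X]add0r; apply: cvgD; last exact: cvg_cst.
  rewrite -[X in _ --> X](mulr0 t); apply: cvgMr.
  under eq_fun do rewrite -exprVn.
  by apply: cvg_expr; rewrite ger0_norm// invf_lt1// ltr1n.
apply: (lee_cvg_to H H'); apply: nearW => l.
have h0 : 0 < t / 2 ^+ l by rewrite divr_gt0// exprn_gt0.
have -> : (\int[P]_w (D l w)%:E)%E = (iter_mean p b n.+1 (t / 2 ^+ l)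
   (fun x => (riemann p (t / 2 ^+ l) x - @riemann R N p (mesh l) (t / 2 ^+ l) (take n x)) ^+ 2))%:E.
  rewrite -(integral_samples b0 HX HI n.+1 _ a0 (ltW h0)).
  by apply: eq_integral => w _; rewrite take_samples.
rewrite lee_fin.
have := iter_mean_increment (mesh l) p01 b0 (HX 0) n h0.
by rewrite step_mesh.
Qed.

Variable q : R.
Hypothesis q0 : 0 < q.
Local Notation tpow := (trunc_pow q).

Lemma cvg_trunc_pow M (u : nat -> R) l : 0 <= M -> u @ \oo --> l ->
  (fun n => tpow M (u n)) @ \oo --> tpow M l.
Proof.
move=> M0 ul; apply: cvg_powR => //.
- by move=> n; rewrite le_min normr_ge0.
- by rewrite le_min normr_ge0.
- under eq_fun do rewrite minr_absE; rewrite minr_absE; apply: cvgMl.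
  have ul' : (fun n => `|u n|) @ \oo --> `|l| by exact: cvg_norm.
  apply: cvgB; first by apply: cvgD => //; exact: cvg_cst.
  by apply: cvg_norm; apply: cvgB => //; exact: cvg_cst.
Qed.

Lemma trunc_pow_le M y : 0 <= M -> tpow M y <= M `^ q.
Proof.
move=> M0; apply: ge0_ler_powR; rewrite ?nnegrE ?(ltW q0)//.
- by rewrite le_min normr_ge0.
- by rewrite ge_min lexx orbT.
Qed.

Lemma measurable_trunc_pow M (f : T -> R) : measurable_fun setT f ->
  measurable_fun setT (fun w => tpow M (f w)).
Proof.
move=> mf; apply: (measurableT_comp (measurable_powR q)).
by apply: measurable_minr => //; exact: measurableT_comp.
Qed.

Lemma cvg_integral_trunc M (f : nat -> T -> R) (g : T -> R) : 0 <= M ->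
  (forall n, measurable_fun setT (f n)) -> measurable_fun setT g ->
  {ae P, forall w, (fun n => f n w) @ \oo --> g w} ->
  (fun n => \int[P]_w (tpow M (f n w))%:E)%E @ \oo --> (\int[P]_w (tpow M (g w))%:E)%E.
Proof.
move=> M0 mf mg fg; apply: (bounded_cvg_real (M := M `^ q)).
- by move=> n; exact: measurable_trunc_pow.
- exact: measurable_trunc_pow.
- by apply: filterS fg => w; exact: cvg_trunc_pow.
- by move=> n w; rewrite ger0_norm ?trunc_pow_ge0// trunc_pow_le.
Qed.

Let jump_cost := lam_max `^ q * J.

(** Both sides are limits over the same meshes. Rescaling would start the window at [a * b]; by
    stationarity it may start at 0, so iteration meets only windows starting there. *)
Lemma cA_trunc_le n a t M : 0 <= a -> 0 <= t -> 0 <= M ->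
  (\int[P]_w (tpow M (cA n.+1 a t w))%:E <=
   (b `^ (- q) * (lam_moment N p q + jump_cost * t))%:E *
   \int[P]_w (tpow (M * b / lam_min) (cA n 0 (t * b) w))%:E)%E.
Proof.
move=> a0 t0 M0; have tb0 : 0 <= t * b by rewrite mulr_ge0// ltW.
have M'0 : 0 <= M * b / lam_min.
  apply: divr_ge0; [apply: mulr_ge0 => //; exact: ltW|exact: ltW (lam_min_gt0 _ _)].
have H1 : (fun l => \int[P]_w (tpow M (riemann_sum n.+1 l a t w))%:E)%E @ \oo -->
    (\int[P]_w (tpow M (cA n.+1 a t w))%:E)%E.
  apply: cvg_integral_trunc => //; [move=> l; exact: measurable_riemann_sum|exact: measurable_cA|].
  exact: riemann_sum_cvg.
have H2 : (fun l => \int[P]_w (tpow (M * b / lam_min) (riemann_sum n l 0 (t * b) w))%:E)%E @ \oo -->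
    (\int[P]_w (tpow (M * b / lam_min) (cA n 0 (t * b) w))%:E)%E.
  apply: cvg_integral_trunc => //; [move=> l; exact: measurable_riemann_sum|exact: measurable_cA|].
  exact: riemann_sum_cvg.
apply: (lee_cvg_to H1 (cvgeZl _ H2)) => //; apply: nearW => l.
rewrite !integral_riemann_sum// -EFinM lee_fin.
have := iter_mean_trunc_le (mesh l) p01 b0 (HX 0) q0 n (step_ge0 l t0) M0.
by rewrite step_mesh [t / _ * b]mulrAC.
Qed.

Lemma cA_trunc_ge n a t M : 0 <= a -> 0 <= t -> 0 <= M ->
  ((b `^ (- q) * Num.max (lam_min `^ q) (lam_moment N p q - jump_cost * t))%:E *
   \int[P]_w (tpow M (cA n 0 (t * b) w))%:E <=
   \int[P]_w (tpow (M * lam_max / b) (cA n.+1 a t w))%:E)%E.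
Proof.
move=> a0 t0 M0; have tb0 : 0 <= t * b by rewrite mulr_ge0// ltW.
have M'0 : 0 <= M * lam_max / b.
  apply: divr_ge0; [apply: mulr_ge0 => //; exact: ltW (lam_max_gt0 _ _)|exact: ltW].
have H1 : (fun l => \int[P]_w (tpow (M * lam_max / b) (riemann_sum n.+1 l a t w))%:E)%E @ \oo -->
    (\int[P]_w (tpow (M * lam_max / b) (cA n.+1 a t w))%:E)%E.
  apply: cvg_integral_trunc => //; [move=> l; exact: measurable_riemann_sum|exact: measurable_cA|].
  exact: riemann_sum_cvg.
have H2 : (fun l => \int[P]_w (tpow M (riemann_sum n l 0 (t * b) w))%:E)%E @ \oo -->
    (\int[P]_w (tpow M (cA n 0 (t * b) w))%:E)%E.
  apply: cvg_integral_trunc => //; [move=> l; exact: measurable_riemann_sum|exact: measurable_cA|].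
  exact: riemann_sum_cvg.
apply: (lee_cvg_to (cvgeZl _ H2) H1) => //; apply: nearW => l.
rewrite !integral_riemann_sum// -EFinM lee_fin.
have := iter_mean_trunc_ge (mesh l) p01 b0 (HX 0) q0 n (step_ge0 l t0) M0.
by rewrite step_mesh [t / _ * b]mulrAC.
Qed.

End RiemannLimit.

(** * The limit process *)

Section LimitCascade.
Variables (R : realType) (N : nat) (p b : R).
Hypothesis p01 : 0 < p < 1.
Hypothesis b_corr : corr0 N p < b.
Context d (T : measurableType d) (P : probability T R) (X : nat -> R -> T -> R).
Hypothesis HX : forall j, stationary_birth_death P N p (X j).
Hypothesis HI : independent_processes P X.
Local Notation lam_max := (lam_max N p).
Local Notation lam_min := (lam_min N p).
Local Notation J := (sojourn_const N p).
Local Notation cA := (cA N p b X).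

Lemma scale_gt1 : 1 < b.
Proof. exact: le_lt_trans (corr0_ge1 N p01) b_corr. Qed.

Let b1 := scale_gt1.
Let b0 : 0 < b. Proof. exact: lt_trans scale_gt1. Qed.

Definition limA a t : T -> R := ae_lim (fun n => cA n a t).

Lemma measurable_limA a t : measurable_fun setT (limA a t).
Proof. by apply: measurable_ae_lim => n; exact: measurable_cA. Qed.

(** The increments decay with ratio [corr0 / b], which is below 1 by [b_corr]. *)
Lemma limA_approx a t : 0 <= a -> 0 <= t ->
  exists V : T -> R, exists2 s : R, 0 <= s < 1 & [/\ measurable_fun setT V,
    forall w, 0 <= V w, P.-integrable setT (EFin \o V) &
    {ae P, forall w, (fun n => cA n a t w) @ \oo --> limA a t w /\
      forall n, (cA n a t w - limA a t w) ^+ 2 <= s ^+ n * V w}].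
Proof.
move=> a0 t0; have c1 := corr0_ge1 N p01.
have c0 : 0 <= corr0 N p by exact: le_trans c1.
apply: (@L2_geometric_limit _ _ _ P _ (corr0 N p * (2 * t)) (corr0 N p / b)).
- by rewrite !mulr_ge0.
- by rewrite divr_ge0 ?(ltW b0)//= ltr_pdivrMr// mul1r.
- by move=> n; exact: measurable_cA.
- move=> n; apply: (le_trans (cA_increment p01 b1 HX HI n a0 t0)).
  by rewrite lee_fin exprS expr_div_n le_eqVlt; apply/orP; left; apply/eqP; ring.
Qed.

Lemma limA_cvg a t : 0 <= a -> 0 <= t ->
  {ae P, forall w, (fun n => cA n a t w) @ \oo --> limA a t w}.
Proof.
move=> a0 t0; have [V [s _ [_ _ _ H]]] := limA_approx a0 t0.
by apply: filterS H => w [].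
Qed.

Lemma limA_ge0 a t : 0 <= a -> 0 <= t -> {ae P, forall w, 0 <= limA a t w}.
Proof.
move=> a0 t0; apply: filterS (limA_cvg a0 t0) => w H.
by apply: (cvgr_to_ge H); apply: nearW => n; exact: cA_ge0.
Qed.

Lemma limA_add a t t' : 0 <= a -> 0 <= t -> 0 <= t' ->
  {ae P, forall w, limA a (t + t') w = limA a t w + limA (a + t) t' w}.
Proof.
move=> a0 t0 t'0.
have A1 := limA_cvg a0 (addr_ge0 t0 t'0); have A2 := limA_cvg a0 t0.
have A3 := limA_cvg (addr_ge0 a0 t0) t'0.
apply: filterS3 A1 A2 A3 => w c1 c2 c3.
have c4 : (fun n => cA n a (t + t') w) @ \oo --> limA a t w + limA (a + t) t' w.
  suff <- : (fun n => cA n a t w + cA n (a + t) t' w) = (fun n => cA n a (t + t') w).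
    exact: cvgD c2 c3.
  by apply/funext => n; rewrite (cAD b HX).
exact: (cvg_unique _ c1 c4).
Qed.

Lemma limA_L2 a t : 0 <= a -> 0 <= t ->
  (fun n => \int[P]_w ((cA n a t w - limA a t w) ^+ 2)%:E)%E @ \oo --> 0%E.
Proof.
move=> a0 t0; have [V [s /andP[s0 s1] [mV V0 iV H]]] := limA_approx a0 t0.
have Vfin : (\int[P]_w (V w)%:E)%E \is a fin_num by exact: integrable_fin_num.
apply: (@squeeze_cvge _ _ _ _ (cst 0%E) _ (fun n => (s ^+ n)%:E * \int[P]_w (V w)%:E)%E).
- apply: nearW => n; apply/andP; split; first by apply: integral_ge0 => w _; rewrite lee_fin sqr_ge0.
  rewrite -ge0_integralZl_EFin ?exprn_ge0//; last 2 first.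
    by move=> w _; rewrite lee_fin.
    exact/measurable_EFinP.
  apply: ae_ge0_le_integral => //.
  + by move=> w _; rewrite lee_fin sqr_ge0.
  + apply/measurable_EFinP; apply: measurable_funX; apply: measurable_funB.
      exact: measurable_cA.
    exact: measurable_limA.
  + by move=> w _; rewrite -EFinM lee_fin mulr_ge0// exprn_ge0.
  + by apply: measurable_funeM; exact/measurable_EFinP.
  + by apply: filterS H => w [_ +] _; move=> /(_ n); rewrite -EFinM lee_fin.
- exact: cvg_cst.
- rewrite -(fineK Vfin); under eq_fun do rewrite -EFinM.
  apply: cvg_EFin; first exact: nearW.
  rewrite -[X in _ --> X](mul0r (fine (\int[P]_w (V w)%:E))); apply: cvgMl.
  by apply: cvg_expr; rewrite ger0_norm.
Qed.

Lemma cA0_le a t w : 0 <= t -> cA 0 a t w <= t.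
Proof. by move=> t0; have := cA_le b HX 0 a w t0; rewrite expr0 mul1r. Qed.

Lemma limA_sqr_lty a t : 0 <= a -> 0 <= t -> (\int[P]_w ((limA a t w) ^+ 2)%:E < +oo)%E.
Proof.
move=> a0 t0; have [V [s /andP[s0 s1] [mV V0 iV H]]] := limA_approx a0 t0.
(* From [y^2 <= 2 x^2 + 2 (x - y)^2] with [y] the limit and [x] the cascade without levels, which is
   at most [t]. *)
have iW : P.-integrable setT (EFin \o (fun w => 2 * t ^+ 2 + 2 * V w)).
  rewrite (_ : EFin \o _ = (EFin \o cst (2 * t ^+ 2)%R) \+ (fun w => 2%:E * (V w)%:E))%E; last first.
    by apply/funext.
  by apply: integrableD => //; [exact: finite_measure_integrable_cst|exact: integrableZl].
apply: le_lt_trans (integrable_lty measurableT iW).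
have mW := measurable_int P iW.
apply: ae_ge0_le_integral => //.
- by move=> w _; rewrite lee_fin sqr_ge0.
- by apply/measurable_EFinP; apply: measurable_funX; exact: measurable_limA.
- by move=> w _; rewrite lee_fin addr_ge0 ?mulr_ge0 ?sqr_ge0.
- apply: filterS H => w [_ /(_ 0%N)]; rewrite expr0 mul1r => Hw _ /=; rewrite lee_fin.
  have := cA_ge0 N p b X 0 a t w; have := cA0_le a w t0.
  move: (cA 0 a t w) (limA a t w) (V w) Hw => x y v; rewrite !expr2 => Hw xt x0.
  have : 0 <= (2 * x - y) ^+ 2 by exact: sqr_ge0.
  by rewrite expr2; nra.
Qed.

Lemma limA_mean a t : 0 <= a -> 0 <= t -> (\int[P]_w (limA a t w)%:E)%E = t%:E.
Proof.
move=> a0 t0; have [V [s /andP[s0 s1] [mV V0 iV H]]] := limA_approx a0 t0.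
(* The triangle inequality through the limit and the cascade without levels costs two distances,
   each at most [1 + V] since its square is at most [V]. *)
have iW : P.-integrable setT (EFin \o (fun w => (t + 2) + 2 * V w)).
  rewrite (_ : EFin \o _ = (EFin \o cst (t + 2)%R) \+ (fun w => 2%:E * (V w)%:E))%E; last first.
    by apply/funext.
  by apply: integrableD => //; [exact: finite_measure_integrable_cst|exact: integrableZl].
have C : (fun n => \int[P]_w (cA n a t w)%:E)%E @ \oo --> (\int[P]_w (limA a t w)%:E)%E.
  apply: (dominated_cvg_real _ (measurable_limA a t) (limA_cvg a0 t0) iW).
    by move=> n; exact: measurable_cA.
  apply: filterS H => w [_ Hw] n; rewrite ger0_norm ?cA_ge0//.
  have sn1 : s ^+ n * V w <= V w by rewrite ler_piMl// exprn_ile1// ltW.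
  have := Hw n; have := Hw 0%N; rewrite expr0 mul1r.
  have := cA_ge0 N p b X 0 a t w; have := cA0_le a w t0.
  move: (cA 0 a t w) (cA n a t w) (limA a t w) (V w) sn1 (V0 w) => x z y v sn1 v0 xt x0 h0 hn.
  have {}hn := le_trans hn sn1.
  have A (u : R) : u ^+ 2 <= v -> - (1 + v) <= u <= 1 + v.
    by rewrite expr2 => uv; nra.
  by have := A _ h0; have := A _ hn; lra.
have C' : (fun n => \int[P]_w (cA n a t w)%:E)%E @ \oo --> t%:E.
  under eq_fun do rewrite (cA_mean p01 b1 HX HI)//.
  exact: cvg_cst.
exact: (cvg_unique _ C C').
Qed.

(** * Moments of the limit process across one scale *)

Section Moment.
Variable q : R.
Hypothesis q0 : 0 < q.
Local Notation tpow := (trunc_pow q).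

Definition momA a t : \bar R := (\int[P]_w (powR `|limA a t w| q)%:E)%E.

Lemma measurable_pow (f : T -> R) : measurable_fun setT f ->
  measurable_fun setT (fun w => powR `|f w| q).
Proof. by move=> mf; apply: (measurableT_comp (measurable_powR q)); exact: measurableT_comp. Qed.

Lemma momA_ge0 a t : (0 <= momA a t)%E.
Proof. by apply: integral_ge0 => w _; rewrite lee_fin powR_ge0. Qed.

Lemma trunc_le_momA M a t : 0 <= M -> (\int[P]_w (tpow M (limA a t w))%:E <= momA a t)%E.
Proof.
move=> M0; apply: ge0_le_integral => //.
- by move=> w _; rewrite lee_fin powR_ge0.
- by apply/measurable_EFinP; apply: measurable_trunc_pow; exact: measurable_limA.
- by apply/measurable_EFinP; apply: measurable_pow; exact: measurable_limA.
- move=> w _; rewrite lee_fin; apply: ge0_ler_powR; rewrite ?nnegrE ?(ltW q0)//.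
    by rewrite le_min normr_ge0.
  by rewrite ge_min lexx.
Qed.

(** Monotone convergence in the truncation level. It remains valid for infinite moments. *)
Lemma momA_le_trunc a t C : (forall k : nat, (\int[P]_w (tpow k%:R (limA a t w))%:E <= C)%E) ->
  (momA a t <= C)%E.
Proof.
move=> HC.
have H : (fun k => \int[P]_w (tpow k%:R (limA a t w))%:E)%E @ \oo -->
    (\int[P]_w limn (fun k => (tpow k%:R (limA a t w))%:E))%E.
  apply: (@cvg_monotone_convergence _ _ _ P setT measurableT
    (fun k w => (tpow k%:R (limA a t w))%:E)).
  - by move=> k; apply/measurable_EFinP; apply: measurable_trunc_pow; exact: measurable_limA.
  - by move=> k w _; rewrite lee_fin powR_ge0.
  - move=> w _ m n mn; rewrite lee_fin; apply: ge0_ler_powR;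
      rewrite ?nnegrE ?le_min ?normr_ge0 ?ler0n ?(ltW q0)//.
    by rewrite !ge_min lexx/= ler_nat mn orbT.
have HE : (\int[P]_w limn (fun k => (tpow k%:R (limA a t w))%:E))%E = momA a t.
  apply: eq_integral => w _; apply/cvg_lim => //; apply: cvg_near_cst.
  have : \forall k \near \oo, `|limA a t w| <= k%:R by exact: (nbhs_infty_ger `|limA a t w|).
  by apply: filterS => k /min_idPl; rewrite /trunc_pow => ->.
rewrite -HE; apply: (cvge_to_le H); exact: nearW.
Qed.

Definition growth_sup t := b `^ (- q) * (lam_moment N p q + lam_max `^ q * J * t).
Definition growth_inf t :=
  b `^ (- q) * Num.max (lam_min `^ q) (lam_moment N p q - lam_max `^ q * J * t).

Let tb_ge0 t : 0 <= t -> 0 <= t * b.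
Proof. by move=> t0; rewrite mulr_ge0// ltW. Qed.

Lemma cvg_trunc_limA M a t : 0 <= M -> 0 <= a -> 0 <= t ->
  (fun n => \int[P]_w (tpow M (cA n a t w))%:E)%E @ \oo --> (\int[P]_w (tpow M (limA a t w))%:E)%E.
Proof.
move=> M0 a0 t0; apply: cvg_integral_trunc => //.
- by move=> n; exact: measurable_cA.
- exact: measurable_limA.
- exact: limA_cvg.
Qed.

(** The truncation levels on the two sides differ. The right one is dropped first, by bounding with
    the full moment; then the left one tends to infinity. *)
Lemma momA_le a t : 0 <= a -> 0 <= t -> (momA a t <= (growth_sup t)%:E * momA 0 (t * b))%E.
Proof.
move=> a0 t0; have tb0 := tb_ge0 t0; apply: momA_le_trunc => k.
have l0 := lam_min_gt0 N p.
have M'0 : 0 <= k%:R * b / lam_min.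
  by apply: divr_ge0; [apply: mulr_ge0 => //; exact: ltW|exact: ltW].
have g0 : 0 <= growth_sup t.
  apply: mulr_ge0; first exact: powR_ge0.
  apply: addr_ge0; last first.
    apply: mulr_ge0 => //; apply: mulr_ge0; first exact: powR_ge0.
    exact: le_trans (jump_const_ge1 _ _).
  by apply: sumr_ge0 => i _; rewrite mulr_ge0 ?powR_ge0// (pmf_ge0 p01).
have H1 := cvg_trunc_limA (ler0n _ k) a0 t0; have H2 := cvg_trunc_limA M'0 (lexx 0) tb0.
apply: (@le_trans _ _ ((growth_sup t)%:E * \int[P]_w (tpow (k%:R * b / lam_min) (limA 0 (t * b) w))%:E)%E).
  move: H1; rewrite -(cvg_shiftS (fun n => \int[P]_w (tpow k%:R (cA n a t w))%:E)%E) => H1.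
  apply: (lee_cvg_to H1 (cvgeZl _ H2)) => //; apply: nearW => n.
  exact: (cA_trunc_le p01 b1 HX HI q0 n a0 t0 (ler0n _ k)).
by apply: lee_wpmul2l; [rewrite lee_fin|exact: trunc_le_momA].
Qed.

Lemma growth_inf_gt0 t : 0 < growth_inf t.
Proof.
rewrite mulr_gt0 ?powR_gt0// lt_max powR_gt0//; exact: lam_min_gt0.
Qed.

Lemma momA_ge a t : 0 <= a -> 0 <= t -> ((growth_inf t)%:E * momA 0 (t * b) <= momA a t)%E.
Proof.
move=> a0 t0; have tb0 := tb_ge0 t0; have g0 := growth_inf_gt0 t.
(* Dividing by the positive factor isolates the moment at [t * b], to which the truncation argument
   then applies. *)
rewrite -lee_pdivlMl//; apply: momA_le_trunc => k; rewrite lee_pdivlMl//.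
have M'0 : 0 <= k%:R * lam_max / b.
  by apply: divr_ge0; [apply: mulr_ge0 => //; exact: ltW (lam_max_gt0 _ _)|exact: ltW].
have H1 := cvg_trunc_limA M'0 a0 t0; have H2 := cvg_trunc_limA (ler0n _ k) (lexx 0) tb0.
apply: le_trans (trunc_le_momA a t M'0).
move: H1; rewrite -(cvg_shiftS (fun n => \int[P]_w (tpow (k%:R * lam_max / b) (cA n a t w))%:E)%E) => H1.
apply: (lee_cvg_to (cvgeZl _ H2) H1) => //; apply: nearW => n.
exact: (cA_trunc_ge p01 b1 HX HI q0 n a0 t0 (ler0n _ k)).
Qed.

(** Additivity with a nonnegative second piece makes the cascade on the longer window almost surely
    larger. *)
Lemma momA_mono a t t' : 0 <= a -> 0 <= t <= t' -> (momA a t <= momA a t')%E.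
Proof.
move=> a0 /andP[t0 tt']; have d0 : 0 <= t' - t by rewrite subr_ge0.
apply: ae_ge0_le_integral => //.
- by apply/measurable_EFinP; apply: measurable_pow; exact: measurable_limA.
- by apply/measurable_EFinP; apply: measurable_pow; exact: measurable_limA.
apply: filterS3 (limA_add a0 t0 d0) (limA_ge0 a0 t0) (limA_ge0 (addr_ge0 a0 t0) d0) => w.
rewrite (_ : t + (t' - t) = t'); last by rewrite addrC subrK.
move=> ->; move: (limA a t w) (limA (a + t) _ w) => x y x0 y0 _; rewrite lee_fin.
have xy0 : 0 <= x + y by exact: addr_ge0.
rewrite !ger0_norm//; apply: ge0_ler_powR; rewrite ?nnegrE ?(ltW q0)//.
by rewrite lerDl.
Qed.

(** A zero moment would make the limit vanish almost surely, against its mean [t]. *)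
Lemma momA_gt0 a t : 0 <= a -> 0 < t -> (0 < momA a t)%E.
Proof.
move=> a0 t0; rewrite lt_neqAle momA_ge0 andbT; apply/negP => /eqP/esym m0.
have mf : measurable_fun setT (fun w => (powR `|limA a t w| q)%:E).
  by apply/measurable_EFinP; apply: measurable_pow; exact: measurable_limA.
have := (ae_eq_integral_abs P measurableT mf).1.
move=> /(_ _)[|A [mA PA sA]].
  rewrite -[RHS]m0; apply: eq_integral => w _.
  by rewrite gee0_abs// lee_fin powR_ge0.
have : (\int[P]_w (limA a t w)%:E)%E = 0%E.
  transitivity (\int[P]_w (cst 0 w))%E; last exact: integral0.
  apply: ae_eq_integral => //.
    by apply/measurable_EFinP; exact: measurable_limA.
  exists A; split => //; apply: subset_trans sA => w /= H H'; apply: H => _.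
  have := H' I => -[] /eqP; rewrite powR_eq0 normr_eq0 => /andP[/eqP -> _].
  by [].
rewrite limA_mean ?(ltW t0)// => -[] t00.
by move: t0; rewrite t00 ltxx.
Qed.

End Moment.
End LimitCascade.

(** * Power law for the moments *)

Lemma cvg0_abs_powR (R : realType) (q : R) (u : nat -> R) : 0 < q ->
  u @ \oo --> (0 : R) -> (fun n => `|u n| `^ q) @ \oo --> (0 : R).
Proof.
move=> q0 u0; rewrite -(powR0 (lt0r_neq0 q0)); apply: cvg_powR => //.
by rewrite -[X in _ --> X](normr0 R); exact: cvg_norm.
Qed.

Section PowerLaw.
Variables (R : realType) (N : nat) (p b : R).
Hypothesis p01 : 0 < p < 1.
Hypothesis b_corr : corr0 N p < b.
Context d (T : measurableType d) (P : probability T R) (X : nat -> R -> T -> R).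
Hypothesis HX : forall j, stationary_birth_death P N p (X j).
Hypothesis HI : independent_processes P X.
Variable q : R.
Hypothesis q0 : 0 < q.
Local Notation lam_max := (lam_max N p).
Local Notation lam_min := (lam_min N p).
Local Notation J := (sojourn_const N p).
Local Notation limA := (limA N p b X).
Local Notation momA := (momA N p b P X q).
Local Notation K := (K_logbin N p b q).
Local Notation lamq := (lam_moment N p q).

Let b1 : 1 < b. Proof. exact: scale_gt1 p01 b_corr. Qed.
Let b0 : 0 < b. Proof. exact: lt_trans b1. Qed.

Definition ratio := b `^ (- K).

Lemma ratio_gt0 : 0 < ratio. Proof. exact: powR_gt0. Qed.

Lemma lam_moment_gt0 : 0 < lamq.
Proof.
have := ratio_gt0; rewrite /ratio -K_logbinE// pmulr_rgt0//; exact: powR_gt0.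
Qed.

(** Relative cost of jumps per unit of length: [growth_sup t] is [ratio * (1 + rate_sup * t)]. *)
Definition rate_sup := lam_max `^ q * J / lamq.

Lemma rate_sup_ge0 : 0 <= rate_sup.
Proof.
apply: divr_ge0; last exact: ltW lam_moment_gt0.
apply: mulr_ge0; first exact: powR_ge0.
exact: le_trans (jump_const_ge1 _ _).
Qed.

(** The factor comes from [max_ge_expR] at [c = lam_min^q / E Lambda^q]. *)
Definition rate_inf := (2 + 2 * `|ln (lam_min `^ q / lamq)|) * rate_sup.

Lemma rate_inf_ge0 : 0 <= rate_inf.
Proof.
apply: mulr_ge0; last exact: rate_sup_ge0.
by apply: addr_ge0 => //; apply: mulr_ge0.
Qed.

Lemma growth_sup_le t : 0 <= t -> growth_sup N p b q t <= ratio * expR (rate_sup * t).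
Proof.
move=> t0; rewrite /growth_sup /ratio -K_logbinE// -[leRHS]mulrA ler_wpM2l ?powR_ge0//.
have l0 := lam_moment_gt0.
apply: (@le_trans _ _ (lamq * (1 + rate_sup * t))).
  rewrite /rate_sup le_eqVlt; apply/orP; left; apply/eqP.
  by field; rewrite gt_eqF.
by apply: ler_wpM2l; [exact: ltW|exact: expR_ge1Dx].
Qed.

(** For [x <= 1/2] one has [exp(- 2 x) <= 1 - x]. Beyond, [2 x > 1] and so
    [exp(- 2 |ln c| x) <= exp(- |ln c|) <= c]. *)
Lemma max_ge_expR (c x : R) : 0 < c -> 0 <= x ->
  expR (- ((2 + 2 * `|ln c|) * x)) <= Num.max c (1 - x).
Proof.
move=> c0 x0; rewrite le_max; have [x2|x2] := leP x (1 / 2); apply/orP; [right|left].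
  apply: (@le_trans _ _ (expR (- (2 * x)))).
    by rewrite ler_expR lerN2 ler_wpM2r// lerDl mulr_ge0.
  have E : 1 + 2 * x <= expR (2 * x) by exact: expR_ge1Dx.
  have E0 : 0 < expR (2 * x) by exact: expR_gt0.
  rewrite expRN -(ler_pM2r E0) mulVf ?gt_eqF//.
  by move: (expR _) E E0 => e E E0; nra.
rewrite -[leRHS]lnK ?posrE// ler_expR.
have := ler_norm (- ln c); rewrite normrN.
by move: (ln c) `|ln c| (normr_ge0 (ln c)) => l a a0 la; nra.
Qed.

Lemma growth_inf_ge t : 0 <= t -> ratio * expR (- (rate_inf * t)) <= growth_inf N p b q t.
Proof.
move=> t0; rewrite /growth_inf /ratio -K_logbinE// -mulrA ler_wpM2l ?powR_ge0//.
have l0 := lam_moment_gt0; have lm0 := lam_min_gt0 N p.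
have -> : Num.max (lam_min `^ q) (lamq - lam_max `^ q * J * t)
   = lamq * Num.max (lam_min `^ q / lamq) (1 - rate_sup * t).
  rewrite maxr_pMr ?(ltW l0)//; congr Num.max.
    by rewrite mulrC divfK// gt_eqF.
  by rewrite /rate_sup; field; rewrite gt_eqF.
apply: ler_wpM2l; first exact: ltW.
rewrite /rate_inf -mulrA.
apply: max_ge_expR; first by rewrite divr_gt0// powR_gt0.
by apply: mulr_ge0 => //; exact: rate_sup_ge0.
Qed.

(** One step of the geometric sum: the exponents [c t b^j] for [j < k] add up to
    [c (t b^k - t) / (b - 1)], with [B] the final window. *)
Let telescope_exp (B c t : R) : expR (c * t) * expR (c / (b - 1) * (B - t * b))
  = expR (c / (b - 1) * (B - t)).
Proof.
have bn : b - 1 != 0 by rewrite subr_eq0 gt_eqF.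
by rewrite -expRD; congr expR; field.
Qed.

(** At least one step is taken, because it is the step that moves the left endpoint from [a] to
    0. *)
Lemma momA_iter_sup k a t : 0 <= a -> 0 <= t ->
  (momA a t <= (ratio ^+ k.+1 * expR (rate_sup / (b - 1) * (t * b ^+ k.+1 - t)))%:E
     * momA 0 (t * b ^+ k.+1))%E.
Proof.
elim: k a t => [|k IH] a t a0 t0.
  apply: (le_trans (momA_le p01 b_corr HX HI q0 a0 t0)).
  rewrite expr1 lee_wpmul2r ?momA_ge0// lee_fin.
  apply: (le_trans (growth_sup_le t0)).
  by rewrite -telescope_exp subrr mulr0 expR0 mulr1.
have tb0 : 0 <= t * b by rewrite mulr_ge0// ltW.
apply: (le_trans (momA_le p01 b_corr HX HI q0 a0 t0)).
have := IH 0 (t * b) (lexx 0) tb0.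
rewrite (_ : t * b * b ^+ k.+1 = t * b ^+ k.+2); last by rewrite -mulrA -exprS.
set B := t * b ^+ k.+2 => H.
apply: (@le_trans _ _ ((ratio * expR (rate_sup * t))%:E * momA 0 (t * b))%E).
  by apply: lee_wpmul2r; [exact: momA_ge0|rewrite lee_fin; exact: growth_sup_le].
apply: (@le_trans _ _ ((ratio * expR (rate_sup * t))%:E * ((ratio ^+ k.+1 * expR (rate_sup / (b - 1) * (B - t * b)))%:E
     * momA 0 B))%E).
  apply: lee_wpmul2l => //; rewrite lee_fin.
  by apply: mulr_ge0; [exact: ltW ratio_gt0|exact: expR_ge0].
by rewrite muleA -EFinM mulrACA -exprS telescope_exp.
Qed.

Lemma momA_iter_inf k a t : 0 <= a -> 0 <= t ->
  ((ratio ^+ k.+1 * expR (- rate_inf / (b - 1) * (t * b ^+ k.+1 - t)))%:E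
     * momA 0 (t * b ^+ k.+1) <= momA a t)%E.
Proof.
elim: k a t => [|k IH] a t a0 t0.
  apply: le_trans (momA_ge p01 b_corr HX HI q0 a0 t0).
  rewrite expr1 lee_wpmul2r ?momA_ge0// lee_fin.
  apply: le_trans (growth_inf_ge t0).
  by rewrite -telescope_exp subrr mulr0 expR0 mulr1 mulNr.
have tb0 : 0 <= t * b by rewrite mulr_ge0// ltW.
apply: le_trans (momA_ge p01 b_corr HX HI q0 a0 t0).
have := IH 0 (t * b) (lexx 0) tb0.
rewrite (_ : t * b * b ^+ k.+1 = t * b ^+ k.+2); last by rewrite -mulrA -exprS.
set B := t * b ^+ k.+2 => H.
apply: (@le_trans _ _ ((ratio * expR (- rate_inf * t))%:E * momA 0 (t * b))%E); last first.
  by apply: lee_wpmul2r; [exact: momA_ge0|rewrite lee_fin mulNr; exact: growth_inf_ge].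
apply: (@le_trans _ _ ((ratio * expR (- rate_inf * t))%:E * ((ratio ^+ k.+1 * expR (- rate_inf / (b - 1) * (B - t * b)))%:E
     * momA 0 B))%E); last first.
  apply: lee_wpmul2l => //; rewrite lee_fin.
  by apply: mulr_ge0; [exact: ltW ratio_gt0|exact: expR_ge0].
by rewrite muleA -EFinM mulrACA -exprS telescope_exp.
Qed.

Lemma scale_exists t : 0 < t <= 1 -> exists k, 1 < t * b ^+ k.+1 <= b.
Proof.
move=> /andP[t0 t1].
have ex : exists k, 1 < t * b ^+ k.+1.
  have : (fun k => (b^-1) ^+ k) @ \oo --> (0 : R).
    apply: cvg_expr; rewrite ger0_norm ?invr_ge0 ?(ltW b0)//.
    by rewrite invf_lt1.
  move=> /cvgr0Pnorm_lt/(_ t t0)[k _ /(_ k (leqnn k))] /=.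
  rewrite ger0_norm ?exprn_ge0 ?invr_ge0 ?(ltW b0)// exprVn => H; exists k.
  apply: (@lt_trans _ _ (t * b ^+ k)).
    by rewrite -ltr_pdivrMr ?exprn_gt0// mul1r.
  by rewrite exprS ltr_pM2l// ltr_pMl// exprn_gt0.
case: (ex_minnP ex) => k Hk min_k; exists k; rewrite Hk/=.
case: k {Hk} min_k => [|k] min_k; first by rewrite expr1 ler_piMl// ltW.
have : ~~ (1 < t * b ^+ k.+1) by apply/negP => /min_k; rewrite ltnn.
rewrite -leNgt => H.
rewrite (_ : t * b ^+ k.+2 = b * (t * b ^+ k.+1)); last by rewrite [in LHS]exprS mulrCA.
by apply: ler_piMr => //; exact: ltW.
Qed.

(** The sign of [K] is not yet known, hence the absolute values. *)
Lemma powR_bracket (y : R) : 1 <= y <= b -> expR (- (`|K| * ln b)) <= y `^ K <= expR (`|K| * ln b).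
Proof.
move=> /andP[y1 yb]; have y0 : 0 < y by exact: lt_le_trans y1.
rewrite /powR gt_eqF// !ler_expR.
have l0 : 0 <= ln y by exact: ln_ge0.
have lb : ln y <= ln b by rewrite ler_ln.
have : `|K * ln y| <= `|K| * ln b by rewrite normrM [`|ln y|]ger0_norm// ler_wpM2l.
by rewrite ler_norml.
Qed.

Lemma ratioX k t : 0 < t -> ratio ^+ k = t `^ K * (t * b ^+ k) `^ (- K).
Proof.
move=> t0; have bk : 0 <= b ^+ k by rewrite exprn_ge0// ltW.
have -> : ratio ^+ k = (b ^+ k) `^ (- K).
  transitivity (b `^ (- K * k%:R)).
    by rewrite powRrM powR_mulrn// powR_ge0.
  by rewrite [- K * _]mulrC powRrM powR_mulrn// ltW.
rewrite powRM ?(ltW t0)// mulrA -powRD ?subrr ?powRr0 ?mul1r//.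
by rewrite (gt_eqF t0) implybT.
Qed.

Hypothesis mom_fin : (momA 0 1 < +oo)%E.

(** The lower growth inequality at [t = 1], used to bound the larger window by the smaller. *)
Lemma momA_scale_lty : (momA 0 b < +oo)%E.
Proof.
have g0 : 0 < growth_inf N p b q 1 by exact: growth_inf_gt0.
have := momA_ge p01 b_corr HX HI q0 (lexx 0) ler01; rewrite mul1r => H.
have : ((growth_inf N p b q 1)%:E * momA 0 b < +oo)%E by exact: le_lt_trans mom_fin.
have := momA_ge0 N p b P X q 0 b; case: (momA 0 b) => [x| |]//= _.
  by move=> _; exact: ltry.
by rewrite gt0_muley ?lte_fin.
Qed.

Let le_prod4 (A B A' B' u v : R) : 0 <= u -> 0 <= v -> 0 <= A -> 0 <= B ->
  A <= A' -> B <= B' -> A * B * u * v <= v * A' * B' * u.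
Proof.
move=> u0 v0 A0 B0 AA BB.
have -> : v * A' * B' * u = A' * B' * u * v by ring.
by rewrite !ler_wpM2r// ler_pM.
Qed.

(** The iteration stops at a length [y] between 1 and [b], where monotonicity places the moment
    between [momA 0 1] and [momA 0 b]. *)
Lemma momA_power_law : exists Cl Cu : R, [/\ 0 < Cl, Cl <= Cu &
  forall a t, 0 <= a -> 0 < t <= 1 ->
    ((Cl * t `^ K)%:E <= momA a t <= (Cu * t `^ K)%:E)%E].
Proof.
have [g1 f1] : exists g1, momA 0 1 = g1%:E.
  exists (fine (momA 0 1)); rewrite fineK// ge0_fin_numE; [exact: mom_fin|exact: momA_ge0].
have [gb fb] : exists gb, momA 0 b = gb%:E.
  exists (fine (momA 0 b)); rewrite fineK// ge0_fin_numE; [exact: momA_scale_lty|exact: momA_ge0].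
have g10 : 0 < g1.
  have := momA_gt0 p01 b_corr HX HI q (lexx 0) ltr01.
  by rewrite f1 lte_fin.
have gb0 : 0 <= gb by have := momA_ge0 N p b P X q 0 b; rewrite fb lee_fin.
set e := `|K| * ln b; set c := rate_inf / (b - 1); set c' := rate_sup / (b - 1).
have c0 : 0 <= c by apply: divr_ge0; [exact: rate_inf_ge0|rewrite subr_ge0 ltW].
have c'0 : 0 <= c' by apply: divr_ge0; [exact: rate_sup_ge0|rewrite subr_ge0 ltW].
have main a t : 0 <= a -> 0 < t <= 1 ->
    ((expR (- e) * expR (- (c * b)) * g1 * t `^ K)%:E <= momA a t
     <= (expR e * expR (c' * b) * gb * t `^ K)%:E)%E.
  move=> a0 t01; have [k /andP[y1 yb]] := scale_exists t01.
  have /andP[t0 t1] := t01; have tK := powR_ge0 t K.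
  have := momA_iter_inf k a0 (ltW t0); have := momA_iter_sup k a0 (ltW t0).
  rewrite (ratioX k.+1 t0) mulNr; set y := t * b ^+ k.+1 in y1 yb *.
  have y1b : 1 <= y <= b by rewrite (ltW y1).
  have /andP[yK1 yK2] := powR_bracket y1b.
  have y0 : 0 < y by exact: lt_trans y1.
  have yNK1 : expR (- e) <= y `^ (- K).
    by rewrite powRN expRN lef_pV2 ?posrE ?expR_gt0 ?powR_gt0.
  have yNK2 : y `^ (- K) <= expR e.
    by rewrite powRN -[leRHS]invrK -expRN lef_pV2 ?posrE ?expR_gt0 ?powR_gt0.
  have my1 : (g1%:E <= momA 0 y)%E.
    by rewrite -f1; apply: (momA_mono p01 b_corr HX HI q0) => //; rewrite ler01 ltW.
  have myb : (momA 0 y <= gb%:E)%E.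
    by rewrite -fb; apply: (momA_mono p01 b_corr HX HI q0) => //; rewrite ltW.
  have nnl : 0 <= t `^ K * y `^ (- K) * expR (- c * (y - t)).
    by apply: mulr_ge0; [apply: mulr_ge0; exact: powR_ge0|exact: expR_ge0].
  have nnu : 0 <= t `^ K * y `^ (- K) * expR (c' * (y - t)).
    by apply: mulr_ge0; [apply: mulr_ge0; exact: powR_ge0|exact: expR_ge0].
  move=> Hsup Hinf; apply/andP; split.
    apply: le_trans Hinf; rewrite -/c.
    apply: (@le_trans _ _ ((t `^ K * y `^ (- K) * expR (- c * (y - t)))%:E * g1%:E)%E); last first.
      by apply: lee_wpmul2l.
    rewrite -EFinM lee_fin; apply: le_prod4; rewrite ?expR_ge0 ?(ltW g10)//.
    by rewrite mulNr ler_expR lerN2 ler_wpM2l//; lra.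
  apply: (le_trans Hsup); rewrite -/c'.
  apply: (@le_trans _ _ ((t `^ K * y `^ (- K) * expR (c' * (y - t)))%:E * gb%:E)%E).
    by apply: lee_wpmul2l.
  rewrite -EFinM lee_fin.
  have -> : t `^ K * y `^ (- K) * expR (c' * (y - t)) * gb
    = y `^ (- K) * expR (c' * (y - t)) * gb * t `^ K.
    by move: (t `^ K) (y `^ _) (expR _) => *; ring.
  have -> : expR e * expR (c' * b) * gb * t `^ K = t `^ K * expR e * expR (c' * b) * gb.
    by move: (t `^ K) (expR _) (expR _) => *; ring.
  apply: le_prod4; rewrite ?expR_ge0 ?powR_ge0//.
  by rewrite ler_expR ler_wpM2l//; lra.
exists (expR (- e) * expR (- (c * b)) * g1), (expR e * expR (c' * b) * gb); split; last exact: main.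
- by apply: mulr_gt0 => //; apply: mulr_gt0; exact: expR_gt0.
- have t11 : 0 < (1 : R) <= 1 by rewrite ltr01 lexx.
  have /andP[l1 l2] := main 0 1 (lexx 0) t11.
  by have := le_trans l1 l2; rewrite lee_fin powR1 !mulr1.
Qed.

(** If [K <= 0], the power law keeps the moments at [2 ^- n] above [Cl]. Yet the cascade there tends
    to 0 almost surely, dominated by its value at 1, which has a finite moment. *)
Lemma K_gt0 : 0 < K.
Proof.
rewrite ltNge; apply/negP => K0.
have [Cl [Cu [Cl0 _ HC]]] := momA_power_law.
have t0 n : 0 <= (2^-1 : R) ^+ n by rewrite exprn_ge0.
have half : 0 <= (2^-1 : R) < 1 by rewrite invr_ge0 ler0n/= invf_lt1// ltr1n.
have t1 n : (2^-1 : R) ^+ n <= 1 by rewrite exprn_ile1//; case/andP: half => _ /ltW.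
have ae0 : {ae P, forall w, (fun n => limA 0 ((2^-1) ^+ n) w) @ \oo --> (0 : R)}.
  apply: (@ae_cvg0_geometric _ _ _ P _ 1 2^-1) => // [n|n].
    exact: measurable_limA.
  rewrite mul1r -(limA_mean p01 b_corr HX HI (lexx 0) (t0 n)) le_eqVlt.
  apply/orP; left; apply/eqP; apply: ae_eq_integral => //.
  - by apply/measurable_EFinP; apply: measurableT_comp => //; exact: measurable_limA.
  - by apply/measurable_EFinP; exact: measurable_limA.
  - by apply: filterS (limA_ge0 p01 b_corr HX HI (lexx 0) (t0 n)) => w w0 _; rewrite ger0_norm.
have C : (fun n => momA 0 ((2^-1) ^+ n)) @ \oo --> (\int[P]_w (0 : R)%:E)%E.
  apply: (@dominated_cvg_real _ _ _ P (fun n w => powR `|limA 0 ((2^-1) ^+ n) w| q)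
    (fun=> 0) (fun w => powR `|limA 0 1 w| q)).
  - by move=> n; apply: measurable_pow; exact: measurable_limA.
  - exact: measurable_cst.
  - by apply: filterS ae0 => w; exact: cvg0_abs_powR.
  - apply/integrableP; split.
      by apply/measurable_EFinP; apply: measurable_pow; exact: measurable_limA.
    apply: le_lt_trans mom_fin; apply: ge0_le_integral => //.
    + apply/measurable_EFinP; apply: measurableT_comp => //.
      by apply: measurable_pow; exact: measurable_limA.
    + by apply/measurable_EFinP; apply: measurable_pow; exact: measurable_limA.
    + by move=> w _; rewrite lee_fin ger0_norm// powR_ge0.
  - apply: ae_foralln => n.
    have d0 : 0 <= 1 - (2^-1 : R) ^+ n by rewrite subr_ge0.
    apply: filterS3 (limA_add p01 b_corr HX HI (lexx 0) (t0 n) d0)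
      (limA_ge0 p01 b_corr HX HI (lexx 0) (t0 n))
      (limA_ge0 p01 b_corr HX HI (addr_ge0 (lexx 0) (t0 n)) d0) => w.
    rewrite (_ : (2^-1 : R) ^+ n + (1 - (2^-1 : R) ^+ n) = 1); last by rewrite addrC subrK.
    move=> ->; move: (limA 0 ((2^-1) ^+ n) w) (limA (0 + _) _ w) => x y x0 y0.
    have xy0 : 0 <= x + y by exact: addr_ge0.
    rewrite (ger0_norm (powR_ge0 _ _)) !ger0_norm//.
    by apply: ge0_ler_powR; rewrite ?nnegrE ?(ltW q0)// lerDl.
rewrite integral0 in C.
have : (Cl%:E <= 0)%E.
  apply: (cvge_to_ge C); apply: nearW => n.
  have tn : 0 < (2^-1 : R) ^+ n <= 1 by rewrite t1 exprn_gt0.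
  have /andP[H _] := HC 0 _ (lexx 0) tn; apply: le_trans H; rewrite lee_fin.
  rewrite ler_peMr ?(ltW Cl0)//.
  have /andP[x0 x1] := tn.
  rewrite /powR gt_eqF// -[leLHS]expR0 ler_expR; apply: mulr_le0 => //.
  exact: ln_le0.
by rewrite lee_fin leNgt Cl0.
Qed.

End PowerLaw.

(** * The limit measure *)

Lemma cvg_integral_indicator d (S : measurableType d) (R : realType)
    (nu : {measure set S -> \bar R}) (D I : set S) (f : nat -> S -> R) :
  measurable D -> measurable I -> I `<=` D -> (nu D < +oo)%E ->
  (forall k, measurable_fun D (f k)) -> (forall k s, 0 <= f k s <= 1) ->
  (forall s, (fun k => f k s) @ \oo --> (\1_I s : R)) ->
  (fun k => \int[nu]_(s in D) (f k s)%:E)%E @ \oo --> nu I.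
Proof.
move=> mD mI ID Dfin mf f01 fI.
have [] := @dominated_convergence _ _ _ nu D mD (fun k => EFin \o f k)
  (EFin \o (\1_I : S -> R)) (cst 1%E).
- by move=> k; exact/measurable_EFinP.
- exact/measurable_EFinP.
- by apply: aeW => s _; apply: cvg_EFin (fI s); exact: nearW.
- apply/integrableP; split; first exact: measurable_cst.
  under eq_integral do rewrite gee0_abs ?lee01//.
  by rewrite integral_cst// mul1e.
- apply: aeW => s k _ /=; rewrite lee_fin ger0_norm; by case/andP: (f01 k s).
- move=> _ _; rewrite [X in _ --> X](_ : _ = nu I)//.
  by rewrite integral_indic// setIidl.
Qed.

Section Bump.
Variables (R : realType) (a t : R).
Hypothesis t0 : 0 <= t.

(** The bracket is twice the distance from [s] to [[a, a + t]]. These are continuous test functions,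
    equal to 1 on the interval and tending to its indicator. *)
Definition bump (k : nat) (s : R) : R :=
  expR (- (k%:R * (`|s - a| + `|s - (a + t)| - t))).

Let gap_ge0 s : 0 <= `|s - a| + `|s - (a + t)| - t.
Proof.
have := ler_normB (s - a) (s - (a + t)).
rewrite (_ : s - a - (s - (a + t)) = t); last by ring.
by rewrite (ger0_norm t0); lra.
Qed.

Lemma bump01 k s : 0 <= bump k s <= 1.
Proof. by rewrite expR_ge0 /= -[leRHS]expR0 ler_expR oppr_le0 mulr_ge0. Qed.

Lemma bump1 k s : a <= s <= a + t -> bump k s = 1.
Proof.
move=> /andP[s1 s2]; rewrite /bump ger0_norm ?subr_ge0// ler0_norm ?subr_le0//.
by rewrite (_ : _ - _ = 0) ?mulr0 ?oppr0 ?expR0//; ring.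
Qed.

Lemma continuous_bump k : continuous (bump k).
Proof.
move=> s; apply: continuous_comp; last exact: continuous_expR.
apply: cvgN; apply: cvgMr; apply: cvgB; last exact: cvg_cst.
by apply: cvgD; apply: cvg_norm; apply: cvgB => //; exact: cvg_cst.
Qed.

Lemma measurable_bump k : measurable_fun setT (bump k).
Proof. by apply: continuous_measurable_fun; exact: continuous_bump. Qed.

Lemma cvg_bump s : (fun k => bump k s) @ \oo --> (\1_(`[a, a + t]%classic) s : R).
Proof.
have [sI|sI] := boolP (a <= s <= a + t).
  rewrite indicE mem_set /= ?in_itv//=.
  by under eq_fun do rewrite bump1//; exact: cvg_cst.
rewrite indicE memNset /= ?in_itv/=; last exact/negP.
have gap_gt0 : 0 < `|s - a| + `|s - (a + t)| - t.
  move: sI; rewrite negb_and -!ltNge => /orP[sa|sat].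
    have sa' : s <= a by exact: ltW.
    rewrite !ler0_norm ?subr_le0//; first by have := t0; lra.
    by rewrite (le_trans sa')// lerDl.
  have as' : a <= s by rewrite (le_trans _ (ltW sat))// lerDl.
  by rewrite !ger0_norm ?subr_ge0// ?ltW//; lra.
have -> : (fun k => bump k s) = (fun k => expR (- (`|s - a| + `|s - (a + t)| - t)) ^+ k).
  by apply/funext => k; rewrite /bump -mulrN expRM_natl.
by apply: cvg_expr; rewrite ger0_norm ?expR_ge0// -[ltRHS]expR0 ltr_expR oppr_lt0.
Qed.

End Bump.

(** * The mass of an interval under the weak limit *)

Section WeakLimit.
Variables (R : realType) (N : nat) (p b : R).
Hypothesis p01 : 0 < p < 1.
Hypothesis b_corr : corr0 N p < b.
Context d (T : measurableType d) (P : probability T R) (X : nat -> R -> T -> R).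
Hypothesis HX : forall j, stationary_birth_death P N p (X j).
Hypothesis HI : independent_processes P X.
Local Notation limA := (limA N p b X).
Local Notation dens := (dens N p b X).
Local Notation cA := (cA N p b X).
Local Notation leb := (@lebesgue_measure R).
Local Notation I01 := (`[0%R, 1%R]%classic : set R).
Variable mu : T -> {measure set R -> \bar R}.
Hypothesis Hmu : as_weak_limit P X (cX N p) b mu.

Let b1 : 1 < b. Proof. exact: scale_gt1 p01 b_corr. Qed.
Let b0 : 0 < b. Proof. exact: lt_trans b1. Qed.

Lemma dens_mean n s : 0 <= s -> (\int[P]_w (dens n s w)%:E = 1)%E.
Proof.
move=> s0.
(* A window reduced to a single sample point. *)
have := integral_samples b0 HX HI n (lamprod p (ord0 : 'I_1)) s0 (lexx 0).
rewrite (iter_mean_lamprod p01 b0 (HX 0) n ord0 (lexx 0)) => <-.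
apply: eq_integral => w _; rewrite (lamprod_samples b HX).
by rewrite mulr0 addr0.
Qed.

Variables (a t : R).
Hypothesis (a0 : 0 <= a) (t0 : 0 <= t) (at1 : a + t <= 1).
Local Notation Iat := (`[a, a + t]%classic : set R).

Let sub_I01 : Iat `<=` I01.
Proof.
move=> s /=; rewrite !in_itv/= => /andP[s1 s2].
by rewrite (le_trans a0 s1) (le_trans s2 at1).
Qed.

Lemma mu_finite : {ae P, forall w, (mu w setT < +oo)%E}.
Proof.
case: Hmu => _ mu0; apply: filterS => w [mufin _].
rewrite -(setvU I01) measureU ?setICl//; last by apply: measurableC.
by rewrite [X in (X + _)%E]mu0 add0e.
Qed.

Definition bump_mass k n w : \bar R := (\int[leb]_(s in I01) (bump a t k s * dens n.+1 s w)%:E)%E.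

Let measurable_bump_dens k n : measurable_fun setT
  (fun z : measurableTypeR R * T => bump a t k z.1 * dens n.+1 z.1 z.2).
Proof.
apply: measurable_funM; last exact: (measurable_dens b HX).
apply: (measurableT_comp (measurable_bump a t k)).
exact: measurable_fst.
Qed.

Let bump_dens_ge0 k n (z : measurableTypeR R * T) : 0 <= bump a t k z.1 * dens n.+1 z.1 z.2.
Proof. by rewrite mulr_ge0 ?dens_ge0// expR_ge0. Qed.

Lemma measurable_bump_mass k n : measurable_fun setT (bump_mass k n).
Proof. exact: (measurable_integral_section (measurable_bump_dens k n) (bump_dens_ge0 k n)). Qed.

Lemma bump_mass_mean k n : (\int[P]_w (bump_mass k n w) = \int[leb]_(s in I01) (bump a t k s)%:E)%E.
Proof.
rewrite (tonelli_set P (measurable_bump_dens k n) (bump_dens_ge0 k n))//.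
apply: eq_integral => s; rewrite inE/= in_itv/= => /andP[s0 _].
under eq_integral do rewrite EFinM.
rewrite ge0_integralZl_EFin ?expR_ge0//.
- by rewrite dens_mean// mule1.
- by move=> w _; rewrite lee_fin dens_ge0.
- by apply/measurable_EFinP; exact: (measurable_dens_space b HX).
Qed.

Lemma cA_le_bump_mass k n w : ((cA n.+1 a t w)%:E <= bump_mass k n w)%E.
Proof.
rewrite (cAE b HX) /bump_mass.
have mf : measurable_fun setT (fun s : measurableTypeR R => (bump a t k s * dens n.+1 s w)%:E).
  by apply/measurable_EFinP; exact: (measurable_fun_pair1 w (measurable_bump_dens k n)).
have H : (\int[leb]_(s in `[a, (a + t)%R]) (dens n.+1 s w)%:E
   <= \int[leb]_(s in `[a, (a + t)%R]) (bump a t k s * dens n.+1 s w)%:E)%E.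
  apply: ge0_le_integral => //.
  - by move=> s _; rewrite lee_fin dens_ge0.
  - by apply/measurable_EFinP; apply: measurable_funTS; exact: (measurable_dens_time b HX).
  - exact: measurable_funTS.
  - by move=> s; rewrite /= in_itv/= => sI; rewrite bump1// mul1r.
apply: (le_trans H); apply: ge0_subset_integral => //.
  exact: measurable_funTS.
by move=> s _; rewrite lee_fin mulr_ge0 ?dens_ge0// expR_ge0.
Qed.

Lemma bump_mass_cvg : {ae P, forall w, forall k,
  (fun n => bump_mass k n w) @ \oo --> (\int[mu w]_(s in I01) (bump a t k s)%:E)%E}.
Proof.
case: Hmu => _ _; apply: filterS => w [_ H] k; apply: H.
by apply: continuous_subspaceT; exact: continuous_bump.
Qed.

Lemma mu_bump_cvg w : (mu w setT < +oo)%E ->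
  (fun k => \int[mu w]_(s in I01) (bump a t k s)%:E)%E @ \oo --> mu w Iat.
Proof.
move=> mufin; apply: cvg_integral_indicator => //.
- by apply: le_lt_trans mufin; apply: le_measure; rewrite ?inE.
- by move=> k; apply: measurable_funTS; exact: measurable_bump.
- by move=> k s; exact: bump01.
- by move=> s; exact: cvg_bump.
Qed.

(** Every bump majorizes the indicator of the interval; first the number of levels tends to
    infinity, by weak convergence, then the bumps shrink. *)
Lemma limA_le_mu : {ae P, forall w, ((limA a t w)%:E <= mu w Iat)%E}.
Proof.
apply: filterS3 bump_mass_cvg mu_finite (limA_cvg p01 b_corr HX HI a0 t0) => w Hb fin HA.
apply: (cvge_to_ge (mu_bump_cvg fin)); apply: nearW => k.
have HA' : (fun n => (cA n.+1 a t w)%:E) @ \oo --> (limA a t w)%:E.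
  apply: cvg_EFin; first exact: nearW.
  by rewrite (cvg_shiftS (fun n => cA n a t w)).
apply: (lee_cvg_to HA' (Hb k)); apply: nearW => n; exact: cA_le_bump_mass.
Qed.

Let measurable_mu B : measurable B -> measurable_fun setT (fun w => mu w B).
Proof. by case: Hmu => H _ _; exact: H. Qed.

(** Fatou bounds the mean mass of each bump by its Lebesgue integral, since the density has mean 1;
    these integrals tend to the length. *)
Lemma mu_mean_le : (\int[P]_w mu w Iat <= t%:E)%E.
Proof.
have C : (fun k => \int[leb]_(s in I01) (bump a t k s)%:E)%E @ \oo --> leb Iat.
  apply: (@cvg_integral_indicator _ _ _ leb) => //.
  - exact: lebesgue_itv_lty.
  - by move=> k; apply: measurable_funTS; exact: measurable_bump.
  - by move=> k s; exact: bump01.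
  - by move=> s; exact: cvg_bump.
rewrite -(lebesgue_itvD a t0); apply: (cvge_to_ge C); apply: nearW => k.
have bm0 n w : (0 <= bump_mass k n w)%E.
  by apply: integral_ge0 => s _; rewrite lee_fin; exact: (bump_dens_ge0 k n (s, w)).
have mL : measurable_fun setT (fun w => limn_einf (fun n => bump_mass k n w)).
  rewrite (_ : (fun w => _) = (fun w => - limn_esup (fun n => - bump_mass k n w))%E).
    apply: measurableT_comp => //; apply: measurable_fun_limn_esup => n.
    by apply: measurableT_comp => //; exact: measurable_bump_mass.
  by apply/funext => w; rewrite -[LHS]oppeK -limn_esupN.
(* The lower limit stands for the integral of the bump against [mu w], with which it agrees almost
   everywhere: it is directly measurable in [w], and Fatou applies to it. *)
apply: (@le_trans _ _ (\int[P]_w limn_einf (fun n => bump_mass k n w))%E).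
  apply: ae_ge0_le_integral => //.
  - exact: measurable_mu.
  - move=> w _; rewrite limn_einf_lim; apply: lime_ge; first exact: is_cvg_einfs.
    by apply: nearW => n; apply: le_ereal_inf_tmp => _ [m _ <-].
  - apply: filterS bump_mass_cvg => w Hb _.
    rewrite (cvg_limn_einf_sup (Hb k)).1.
    have mb : measurable_fun setT (fun s => (bump a t k s)%:E).
      by apply/measurable_EFinP; exact: measurable_bump.
    apply: (@le_trans _ _ (\int[mu w]_(s in Iat) (bump a t k s)%:E)%E).
      rewrite -[leLHS]mul1e -integral_cst//; apply: ge0_le_integral => //.
      + exact: measurable_funTS.
      + by move=> s; rewrite /= in_itv/= => sI; rewrite bump1.
    apply: ge0_subset_integral => //; first exact: measurable_funTS.
    by move=> s _; rewrite lee_fin; case/andP: (bump01 a t0 k s).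
apply: le_trans (fatou _ measurableT _ _) _.
- by move=> n; exact: measurable_bump_mass.
- by [].
under [X in limn_einf X]eq_fun do rewrite bump_mass_mean.
by rewrite (cvg_limn_einf_sup (cvg_cst _)).1.
Qed.

(** The difference is almost surely nonnegative by [limA_le_mu], and its mean is at most 0 because
    [limA] has mean [t]. *)
Lemma mu_eq_limA : {ae P, forall w, mu w Iat = (limA a t w)%:E}.
Proof.
pose m w := fine (mu w Iat).
have mm : measurable_fun setT m.
  by apply: measurableT_comp; [exact: fine_measurable|exact: measurable_mu].
have mE : {ae P, forall w, mu w Iat = (m w)%:E}.
  apply: filterS mu_finite => w fin; rewrite /m fineK// ge0_fin_numE//.
  by apply: le_lt_trans fin; apply: le_measure; rewrite ?inE.
have mlim : measurable_fun setT (limA a t) by exact: (measurable_limA b HX).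
pose u w := m w - limA a t w.
have mu' : measurable_fun setT u by exact: measurable_funB.
have nE (f : T -> R) : measurable_fun setT f -> measurable_fun setT (fun w => (`|f w|)%:E).
  by move=> mf; apply/measurable_EFinP; exact: measurableT_comp.
have sum : (\int[P]_w (`|u w|)%:E + \int[P]_w (`|limA a t w|)%:E = \int[P]_w mu w Iat)%E.
  rewrite -ge0_integralD//; [|exact: nE..].
  apply: ae_eq_integral => //.
  - by apply: emeasurable_funD; exact: nE.
  - exact: measurable_mu.
  apply: filterS3 limA_le_mu mE (limA_ge0 p01 b_corr HX HI a0 t0) => w le1 e1 l0 _.
  move: le1; rewrite e1 lee_fin /u; move: (m w) (limA a t w) l0 => x y y0 yx.
  by rewrite -EFinD ger0_norm ?subr_ge0// ger0_norm// subrK.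
have E2 : (\int[P]_w (`|limA a t w|)%:E = t%:E)%E.
  rewrite -(limA_mean p01 b_corr HX HI a0 t0); apply: ae_eq_integral => //.
  - exact: nE.
  - exact/measurable_EFinP.
  - by apply: filterS (limA_ge0 p01 b_corr HX HI a0 t0) => w l0 _; rewrite ger0_norm.
have u0 : (\int[P]_w (`|u w|)%:E = 0)%E.
  have ge0 : (0 <= \int[P]_w (`|u w|)%:E)%E by apply: integral_ge0 => w _; rewrite lee_fin.
  move: sum; rewrite E2 => sum; have := mu_mean_le; rewrite -sum.
  move: (\int[P]_w (`|u w|)%:E)%E ge0 => [x| |]//=; rewrite !lee_fin => x0.
  rewrite gerDr => x0'; congr EFin; apply/eqP; by rewrite eq_le x0 x0'.
have := (ae_eq_integral_abs P measurableT ((measurable_EFinP _ _).2 mu')).1.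
move=> /(_ u0) ae0; apply: filterS2 ae0 mE => w /(_ I) [] + ->.
by rewrite /u => /subr0_eq ->.
Qed.

End WeakLimit.

Lemma cvg_div_natr (R : realType) (c : R) : (fun n : nat => c / n%:R) @ \oo --> (0 : R).
Proof.
rewrite -[X in _ --> X](mulr0 c); apply: cvgMr.
rewrite -(cvg_shiftS (fun n : nat => n%:R^-1 : R)); exact: cvg_harmonic.
Qed.

(** * The Rényi function *)

Section Renyi.
Variables (R : realType) (N : nat) (p b : R).
Hypothesis p01 : 0 < p < 1.
Hypothesis b_corr : corr0 N p < b.
Context d (T : measurableType d) (P : probability T R) (X : nat -> R -> T -> R).
Hypothesis HX : forall j, stationary_birth_death P N p (X j).
Hypothesis HI : independent_processes P X.
Variable q : R.
Hypothesis q0 : 0 < q.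
Local Notation momA := (momA N p b P X q).
Local Notation K := (K_logbin N p b q).
Variable mu : T -> {measure set R -> \bar R}.
Hypothesis Hmu : as_weak_limit P X (cX N p) b mu.

Lemma renyi_moment n : (\int[P]_w (\sum_(k < 2 ^ n) powR (fine (mu w (dyadic n k))) q)%:E
  = \sum_(k < 2 ^ n) momA (k%:R / 2 ^+ n) (2 ^- n))%E.
Proof.
have mF (k : 'I_(2 ^ n)) : measurable_fun setT (fun w => powR (fine (mu w (dyadic n k))) q).
  apply: (measurableT_comp (measurable_powR q)); apply: measurableT_comp.
    exact: fine_measurable.
  by case: Hmu => H _ _; apply: H; exact: measurable_itv.
under eq_integral do rewrite -sumEFin.
rewrite ge0_integral_sum//; last by move=> k; apply/measurable_EFinP; exact: mF.
apply: eq_bigr => k _.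
have n0 : 0 < (2 : R) ^+ n by rewrite exprn_gt0.
have a0 : 0 <= k%:R / 2 ^+ n :> R by rewrite divr_ge0// ltW.
have t0 : 0 <= (2 ^+ n)^-1 :> R by rewrite invr_ge0 ltW.
have E : k%:R / 2 ^+ n + (2 ^+ n)^-1 = k.+1%:R / 2 ^+ n :> R.
  by rewrite -[k.+1%:R]natr1 mulrDl mul1r.
have at1 : k%:R / 2 ^+ n + (2 ^+ n)^-1 <= 1 :> R.
  by rewrite E ler_pdivrMr// mul1r -natrX ler_nat.
apply: ae_eq_integral => //.
- by apply/measurable_EFinP; exact: mF.
- by apply/measurable_EFinP; apply: measurable_pow; exact: (measurable_limA b HX).
apply: filterS2 (mu_eq_limA p01 b_corr HX HI Hmu a0 t0 at1) (limA_ge0 p01 b_corr HX HI a0 t0) => w.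
rewrite E /dyadic => -> l0 _ /=.
by rewrite ger0_norm.
Qed.

Hypothesis mom_fin : (momA 0 1 < +oo)%E.

Lemma renyi_termE : exists2 v : nat -> R, v @ \oo --> K - 1 &
  forall n, renyi_term P mu q n = (v n)%:E.
Proof.
have [Cl [Cu [Cl0 ClCu HC]]] := momA_power_law p01 b_corr HX HI q0 mom_fin.
have Cu0 : 0 < Cu by exact: lt_le_trans ClCu.
have l2 : 0 < ln (2 : R) by rewrite ln_gt0// ltr1n.
have bound n : exists r, [/\ (\int[P]_w (\sum_(k < 2 ^ n) powR (fine (mu w (dyadic n k))) q)%:E = r%:E)%E,
   2 ^+ n * Cl * (2 ^- n) `^ K <= r & r <= 2 ^+ n * Cu * (2 ^- n) `^ K].
  have t01 : 0 < (2 ^- n : R) <= 1.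
    by rewrite invr_gt0 exprn_gt0//= invf_le1 ?exprn_gt0// exprn_ege1// ler1n.
  have a0 (k : nat) : 0 <= k%:R / 2 ^+ n :> R by rewrite divr_ge0// exprn_ge0.
  pose g (k : nat) := fine (momA (k%:R / 2 ^+ n) (2 ^- n)).
  have gE k : momA (k%:R / 2 ^+ n) (2 ^- n) = (g k)%:E.
    have /andP[_ H] := HC _ _ (a0 k) t01.
    rewrite /g fineK// ge0_fin_numE; last exact: momA_ge0.
    exact: le_lt_trans H (ltry _).
  exists (\sum_(k < 2 ^ n) g k); split.
  - by rewrite renyi_moment -sumEFin; apply: eq_bigr => k _; exact: gE.
  - rewrite -[X in X * _ * _ <= _]natrX -mulrA mulr_natl -[X in _ *+ X]card_ord -sumr_const; apply: ler_sum => k _.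
    by have /andP[H _] := HC _ _ (a0 k) t01; rewrite -lee_fin -gE.
  - rewrite -[X in _ <= X * _ * _]natrX -mulrA mulr_natl -[X in _ *+ X]card_ord -sumr_const; apply: ler_sum => k _.
    by have /andP[_ H] := HC _ _ (a0 k) t01; rewrite -lee_fin -gE.
have [r Hr] := choice bound.
have lnC C n : 0 < C -> ln (2 ^+ n * C * (2 ^- n) `^ K) = n%:R * ln 2 + ln C - K * (n%:R * ln 2).
  move=> C0; have n0 : 0 < (2 : R) ^+ n by rewrite exprn_gt0.
  rewrite !lnM ?posrE ?mulr_gt0 ?powR_gt0 ?invr_gt0//.
  by rewrite ln_powR lnV ?posrE// lnXn// mulrN mulr_natl.
have pos C n : 0 < C -> 0 < 2 ^+ n * C * (2 ^- n) `^ K :> R.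
  by move=> C0; rewrite !mulr_gt0 ?powR_gt0 ?invr_gt0 ?exprn_gt0.
exists (fun n => - (ln (r n) / (n%:R * ln 2))).
  apply: (@squeeze_cvgr _ _ _ _ (fun n => (K - 1) - ln Cu / ln 2 / n%:R)
      (fun n => (K - 1) - ln Cl / ln 2 / n%:R)).
  (* The bounds divide by [n], so [n = 0] is discarded. *)
  - exists 1%N => // n /= n1; have [_ r1 r2] := Hr n.
    have nr : 0 < n%:R :> R by rewrite ltr0n.
    have nl : 0 < n%:R * ln 2 :> R by rewrite mulr_gt0.
    have r0 : 0 < r n by exact: lt_le_trans (pos _ n Cl0) r1.
    have L1 : ln (2 ^+ n * Cl * (2 ^- n) `^ K) <= ln (r n) by rewrite ler_ln ?posrE// pos.
    have L2 : ln (r n) <= ln (2 ^+ n * Cu * (2 ^- n) `^ K) by rewrite ler_ln ?posrE// pos.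
    rewrite !lnC// in L1 L2.
    have F c : (K - 1) - c / ln 2 / n%:R = - ((n%:R * ln 2 + c - K * (n%:R * ln 2)) / (n%:R * ln 2)).
      by field; rewrite !gt_eqF.
    by rewrite !F !lerN2 !ler_pM2r ?invr_gt0// L1 L2.
  - rewrite -[X in _ --> X]subr0; apply: cvgB; first exact: cvg_cst.
    exact: cvg_div_natr.
  - rewrite -[X in _ --> X]subr0; apply: cvgB; first exact: cvg_cst.
    exact: cvg_div_natr.
move=> n; have [rE r1 _] := Hr n.
by rewrite /renyi_term rE (lt_le_trans (pos _ n Cl0) r1).
Qed.

Lemma renyi_functionE : renyi_function P mu q = (K - 1)%:E.
Proof.
have [v vK vE] := renyi_termE.
have : renyi_term P mu q @ \oo --> (K - 1)%:E.
  rewrite (_ : renyi_term P mu q = EFin \o v); last by apply/funext => n; rewrite vE.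
  by apply: cvg_EFin => //; exact: nearW.
by move=> /cvg_limn_einf_sup[H _]; exact: H.
Qed.

End Renyi.

Theorem theorem4 (R : realType) (N : nat) (p b : R) :
  (1 <= N)%N -> 0 < p < 1 ->
  (p * (expR 2 - 1) + 1) ^+ N / (p * (expR 1 - 1) + 1) ^+ (2 * N) < b ->
  forall (d : measure_display) (T : measurableType d) (P : probability T R)
         (X : nat -> R -> T -> R),
  (forall j, stationary_birth_death P N p (X j)) ->
  independent_processes P X ->
  exists A : R -> T -> R,
    (forall t, 0 <= t <= 1 ->
       [/\ measurable_fun [set: T] (A t),
           (\int[P]_w ((A t w) ^+ 2)%:E < +oo)%E &
           (fun n => (\int[P]_w ((cascade_A X (cX N p) b n t w - A t w) ^+ 2)%:E)%E)
             @ \oo --> 0%E]) /\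
    forall q : R, 0 < q ->
      (\int[P]_w (powR `|A 1 w| q)%:E < +oo)%E ->
      (exists Cl Cu : R, [/\ 0 < Cl, Cl <= Cu &
         forall t, 0 <= t <= 1 ->
           ((Cl * powR t (K_logbin N p b q))%:E
              <= \int[P]_w (powR `|A t w| q)%:E
              <= (Cu * powR t (K_logbin N p b q))%:E)%E]) /\
      (forall mu : T -> {measure set R -> \bar R},
         as_weak_limit P X (cX N p) b mu ->
         renyi_function P mu q = (K_logbin N p b q - 1)%:E).
Proof.
move=> _ p01 hb d T P X HX HI; have {}hb : corr0 N p < b by rewrite corr0E.
exists (limA N p b X 0); split=> [t /andP[t0 _]|q q0 mom_fin].
  split; [exact: (measurable_limA b HX)|exact: (limA_sqr_lty p01 hb HX HI)|].
  under eq_fun do under eq_integral do rewrite cascade_AE.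
  have := limA_L2 p01 hb HX HI (lexx 0) t0.
  (* [cascade_A] of index [n] has [n.+1] factors, hence the shift. *)
  by rewrite -(cvg_shiftS (fun n => \int[P]_w ((cA N p b X n 0 t w - limA N p b X 0 t w) ^+ 2)%:E)%E).
have {}mom_fin : (momA N p b P X q 0 1 < +oo)%E by exact: mom_fin.
split; last by move=> mu Hmu; exact: (renyi_functionE p01 hb HX HI q0 Hmu mom_fin).
have [Cl [Cu [Cl0 ClCu HC]]] := momA_power_law p01 hb HX HI q0 mom_fin.
exists Cl, Cu; split; [exact: Cl0|exact: ClCu|] => t /andP[].
rewrite le_eqVlt => /predU1P[<- _|t0 t1]; last by apply: HC; rewrite ?t0.
(* At [t = 0] both bounds vanish because [K] is positive, and so does the moment, every [cA] being 0
   on an empty window. *)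
rewrite powR0; last by rewrite gt_eqF//; exact: (K_gt0 p01 hb HX HI q0 mom_fin).
have -> : (\int[P]_w (powR `|limA N p b X 0 0 w| q)%:E = 0)%E.
  under eq_integral => w _.
    rewrite (_ : limA N p b X 0 0 w = 0) ?normr0 ?powR0 ?gt_eqF//; last first.
      apply: ae_limE; rewrite (_ : (fun n => _) = fun=> 0); first exact: cvg_cst.
      apply/funext => n; apply/eqP; rewrite eq_le cA_ge0 andbT.
      by have := cA_le b HX n 0 w (lexx 0); rewrite mulr0.
    over.
  exact: integral0.
by rewrite !mulr0 lexx.
Qed.
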